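(* Let $\Gamma$ be a Coxeter graph of rank $n$ such that $m_{ij}\ge 5$ for all $i\ne j$. Then for all $q_1,q_2\in Q$ such that $\pi_W(q_1)=\pi_W(q_2)$, there exists $\hat\beta\in\widehat B_\Gamma$ such that $q_2=\hat\beta\star q_1$. Consequently $\pi_A(q_1)=\pi_A(q_2)$ for all such pairs, and $A_\Gamma$ is canonically isomorphic to the dual Artin group $A^*_\Gamma$.
   Context: A Coxeter graph $\Gamma$ of rank $n$ is a finite simplicial graph with vertices $1,\dots,n$ in which each edge $\{i,j\}$ carries a label $m_{ij}\in\{3,4,\dots\}\cup\{\infty\}$; if $i\ne j$ are not joined by an edge, put $m_{ij}=2$. For group elements $g,h$ and $k\in\mathbb N$, $\Pi(g,h;k)$ is the alternating product $ghg\cdots$ beginning with $g$ and with $k$ factors. The Artin group is $A_\Gamma=\langle t_1,\dots,t_n\mid \Pi(t_i,t_j;m_{ij})=\Pi(t_j,t_i;m_{ij})\text{ for all } i\neq j\text{ with } m_{ij}\neq\infty\rangle$. The Coxeter group $W_\Gamma$ is generated by $s_1,\dots,s_n$ with the corresponding relations together with $s_i^2=1$ for all $i$. Let $B_n$ be the braid group with standard generators $\sigma_1,\dots,\sigma_{n-1}$. For a group $G$, the Hurwitz action of $B_n$ on $G^n$ is $\sigma_i\cdot(g_1,\dots,g_n)=(g_1,\dots,g_{i-1},\,g_{i+1},\,g_{i+1}^{-1}g_ig_{i+1},\,g_{i+2},\dots,g_n)$. $\mathrm{Hur}(g_1,\dots,g_n)\subseteq G$ is the set of all elements appearing at any coordinate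 of some tuple in $B_n\cdot(g_1,\dots,g_n)$. The Hurwitz group $H(g_1,\dots,g_n)$ has one generator $[r]$ for each $r\in \mathrm{Hur}(g_1,\dots,g_n)$ and relations $[r_2]^{-1}[r_1][r_2]=[r_2^{-1}r_1r_2]$ for all $(r_1,r_2,\dots,r_n)\in B_n\cdot(g_1,\dots,g_n)$. The dual Artin group is $A^*_\Gamma:=H(s_1,\dots,s_n)$ (for the Coxeter element $s_1\cdots s_n$). ''Canonically isomorphic'' means that the canonical epimorphism $A_\Gamma\to A^*_\Gamma$, $t_i\mapsto[s_i]$, is an isomorphism. $F_n$ is the free group on $x_1,\dots,x_n$; $Q:=\mathrm{Hur}(x_1,\dots,x_n)\subseteq F_n$; $\pi_A:F_n\to A_\Gamma$ and $\pi_W:F_n\to W_\Gamma$ are the homomorphisms with $x_i\mapsto t_i$ and $x_i\mapsto s_i$. The Artin action $\star$ is the left action of $B_n$ on $F_n$ by automorphisms with $\sigma_i\star x_i=x_ix_{i+1}x_i^{-1}$, $\sigma_i\star x_{i+1}=x_i$, $\sigma_i\star x_j=x_j$ for $j\ne i,i+1$. For $1\le i<j\le n$ the Birman–Ko–Lee generator is $\sigma_{ij}=\sigma_i\cdots\sigma_{j-2}\,\sigma_{j-1}\,\sigma_{j-2}^{-1}\cdots\sigma_i^{-1}\in B_n$ (so $\sigma_{i,i+1}=\sigma_i$), and $\widehat B_\Gamma\le B_n$ is the subgroup generated by all $\sigma_{ij}^{m_{ij}}$ with $i<j$ and $m_{ij}<\infty$. *)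

(* Defs.v *)
(* A groupType carries a choice structure; boolp supplies it for carriers     *)
(* that have no constructive one.                                             *)
From HB Require Import structures.
From mathcomp Require Import all_boot.
From mathcomp Require Import boolp classical_sets.

Set Implicit Arguments.
Unset Strict Implicit.
Unset Printing Implicit Defensive.

Local Open Scope classical_set_scope.
Local Open Scope group_scope.
Local Open Scope quotient_scope.

Definition group_hom (G H : groupType) := UMagmaMorphism.type G H.

(* The product of sym T is composition, (f * g) x = f (g x): a morphism into  *)
(* sym T is a left action on T.                                               *)

Record sym (T : Type) := Sym {
  sym_fun :> T -> T;
  sym_inv : T -> T;
  sym_funK : cancel sym_fun sym_inv;
  sym_invK : cancel sym_inv sym_fun }.

HB.instance Definition _ T := gen_eqMixin (sym T).
HB.instance Definition _ T := gen_choiceMixin (sym T).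

Section SymGroup.
Variable T : Type.
Implicit Types f g h : sym T.

Lemma sym_ext f g : f =1 g -> f = g.
Proof.
case: f g => [f f' fK f'K] [g g' gK g'K] /= fg.
have e : f = g by apply: funext.
have e' : f' = g' by apply: funext => x; rewrite -[in LHS](g'K x) -fg fK.
by case: _ / e in fK f'K gK g'K fg *; case: _ / e' in gK g'K *;
   congr Sym; exact: Prop_irrelevance.
Qed.

Definition sym_one : sym T := @Sym T id id (fun=> erefl) (fun=> erefl).

Lemma sym_mulK f g :
  cancel (fun x => f (g x)) (fun x => sym_inv g (sym_inv f x)).
Proof. by move=> x; rewrite !sym_funK. Qed.

Lemma sym_mulVK f g :
  cancel (fun x => sym_inv g (sym_inv f x)) (fun x => f (g x)).
Proof. by move=> x; rewrite !sym_invK. Qed.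

Definition sym_mul f g : sym T := Sym (sym_mulK f g) (sym_mulVK f g).

Definition sym_opp f : sym T := Sym (@sym_invK _ f) (@sym_funK _ f).

Lemma sym_mulgA : associative sym_mul.
Proof. by move=> f g h; apply: sym_ext. Qed.
Lemma sym_mul1g : left_id sym_one sym_mul.
Proof. by move=> f; apply: sym_ext. Qed.
Lemma sym_mulg1 : right_id sym_one sym_mul.
Proof. by move=> f; apply: sym_ext. Qed.
Lemma sym_mulVg : left_inverse sym_one sym_opp sym_mul.
Proof. by move=> f; apply: sym_ext => x /=; rewrite sym_funK. Qed.
Lemma sym_mulgV : right_inverse sym_one sym_opp sym_mul.
Proof. by move=> f; apply: sym_ext => x /=; rewrite sym_invK. Qed.

HB.instance Definition _ := isGroup.Build (sym T)
  sym_mulgA sym_mul1g sym_mulg1 sym_mulVg sym_mulgV.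

Lemma symM f g x : (f * g) x = f (g x). Proof. by []. Qed.
Lemma sym1 x : (1 : sym T) x = x. Proof. by []. Qed.

End SymGroup.

(* The pair (x, false) codes the letter x and (x, true) the letter x^{-1}.    *)

Section FreeGroup.
Variable X : choiceType.

Definition word := seq (X * bool).
HB.instance Definition _ := Choice.on word.
Implicit Types u v w : word.

Inductive free_eq : word -> word -> Prop :=
| FreeRefl w : free_eq w w
| FreeSym u v : free_eq u v -> free_eq v u
| FreeTrans v u w : free_eq u v -> free_eq v w -> free_eq u w
| FreeCat u u' v v' : free_eq u u' -> free_eq v v' -> free_eq (u ++ v) (u' ++ v')
| FreeCancel x b : free_eq [:: (x, b); (x, ~~ b)] [::].

Definition free_eqb : rel word := fun u v => `[< free_eq u v >].

Lemma free_eqb_refl : reflexive free_eqb.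
Proof. by move=> w; apply/asboolP; constructor. Qed.
Lemma free_eqb_sym : symmetric free_eqb.
Proof. by move=> u v; apply/asboolP/asboolP; exact: FreeSym. Qed.
Lemma free_eqb_trans : transitive free_eqb.
Proof. by move=> v u w /asboolP uv /asboolP vw; apply/asboolP; exact: FreeTrans uv vw. Qed.

Canonical free_equiv :=
  EquivRel free_eqb free_eqb_refl free_eqb_sym free_eqb_trans.

Definition free_group := {eq_quot free_equiv}.
HB.instance Definition _ := Choice.on free_group.

Definition free_class (w : word) : free_group := \pi_free_group w.

Lemma free_classP u v : reflect (free_eq u v) (free_class u == free_class v).
Proof. by rewrite eqmodE; exact: asboolP. Qed.

Lemma free_eq_class u v : free_eq u v -> free_class u = free_class v.
Proof. by move/free_classP/eqP. Qed.

Lemma free_reprK (a : free_group) : free_class (repr a) = a.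
Proof. exact: reprK. Qed.

Lemma free_repr w : free_eq (repr (free_class w)) w.
Proof. by apply/free_classP; rewrite free_reprK. Qed.

Definition word_inv w : word := rev [seq (p.1, ~~ p.2) | p <- w].

Lemma word_invV w : free_eq (word_inv w ++ w) [::].
Proof.
elim: w => [|[x b] w IHw]; first exact: FreeRefl.
rewrite /word_inv /= rev_cons cat_rcons.
apply: FreeTrans IHw; apply: FreeCat; first exact: FreeRefl.
rewrite -[(x, b) :: w]/([:: (x, b)] ++ w) -cat_cons -[w in X in free_eq _ X]cat0s.
apply: FreeCat; last exact: FreeRefl.
by rewrite -[b in X in [:: _; X]]negbK; exact: FreeCancel.
Qed.

Lemma word_invVr w : free_eq (w ++ word_inv w) [::].
Proof.
have invK : word_inv (word_inv w) = w.
  rewrite /word_inv map_rev revK -map_comp -[RHS]map_id; apply: eq_map.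
  by case=> x b /=; rewrite negbK.
by rewrite -{1}invK; exact: word_invV.
Qed.

Lemma word_inv_eq u v : free_eq u v -> free_eq (word_inv u) (word_inv v).
Proof.
move=> uv; apply: (FreeTrans (v := word_inv u ++ (v ++ word_inv v))).
  rewrite -[word_inv u in X in free_eq X _]cats0.
  by apply: FreeCat; [exact: FreeRefl | apply/FreeSym/word_invVr].
rewrite catA -[word_inv v in X in free_eq _ X]cat0s.
apply: FreeCat; last exact: FreeRefl.
apply: FreeTrans (word_invV u).
by apply: FreeCat; [exact: FreeRefl | exact: FreeSym].
Qed.

Definition free_mul (a b : free_group) := free_class (repr a ++ repr b).
Definition free_one := free_class [::].
Definition free_inv (a : free_group) := free_class (word_inv (repr a)).

Lemma free_mulE u v :
  free_mul (free_class u) (free_class v) = free_class (u ++ v).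
Proof. by apply: free_eq_class; apply: FreeCat; exact: free_repr. Qed.

Lemma free_invE u : free_inv (free_class u) = free_class (word_inv u).
Proof. by apply: free_eq_class; apply: word_inv_eq; exact: free_repr. Qed.

Lemma free_mulA : associative free_mul.
Proof.
move=> a b c; rewrite -(free_reprK a) -(free_reprK b) -(free_reprK c).
by rewrite !free_mulE catA.
Qed.
Lemma free_mul1g : left_id free_one free_mul.
Proof. by move=> a; rewrite -(free_reprK a) free_mulE. Qed.
Lemma free_mulg1 : right_id free_one free_mul.
Proof. by move=> a; rewrite -(free_reprK a) free_mulE cats0. Qed.
Lemma free_mulVg : left_inverse free_one free_inv free_mul.
Proof.
move=> a; rewrite -(free_reprK a) free_invE free_mulE.
exact/free_eq_class/word_invV.
Qed.
Lemma free_mulgV : right_inverse free_one free_inv free_mul.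
Proof.
move=> a; rewrite -(free_reprK a) free_invE free_mulE.
exact/free_eq_class/word_invVr.
Qed.

HB.instance Definition _ := isGroup.Build free_group
  free_mulA free_mul1g free_mulg1 free_mulVg free_mulgV.

Definition free_gen (x : X) : free_group := free_class [:: (x, false)].

Section Lift.
Variables (G : groupType) (f : X -> G).

Definition letter_eval (p : X * bool) : G := if p.2 then (f p.1)^-1 else f p.1.
Definition word_eval w : G := \prod_(p <- w) letter_eval p.

Lemma word_eval_eq u v : free_eq u v -> word_eval u = word_eval v.
Proof.
elim=> {u v} // [u v w _ -> _ -> // | u u' v v' _ + _ | x b].
  by rewrite /word_eval !big_cat /= => -> ->.
rewrite /word_eval !big_cons !big_nil mulg1 /letter_eval /=.
by case: b; rewrite ?mulgV ?mulVg.
Qed.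

Definition free_lift_fun (a : free_group) : G := word_eval (repr a).

Lemma free_lift_class w : free_lift_fun (free_class w) = word_eval w.
Proof. exact/word_eval_eq/free_repr. Qed.

Lemma free_liftM : {morph free_lift_fun : a b / a * b}.
Proof.
move=> a b; rewrite -[LHS]free_lift_class free_reprK.
by rewrite /mul /= /free_mul free_lift_class /word_eval big_cat.
Qed.

Lemma free_lift1 : free_lift_fun 1 = 1.
Proof. by rewrite /one /= free_lift_class /word_eval big_nil. Qed.

HB.instance Definition _ :=
  isMultiplicative.Build free_group G free_lift_fun free_liftM.
HB.instance Definition _ :=
  Multiplicative_isUMagmaMorphism.Build free_group G free_lift_fun free_lift1.

Definition free_lift : group_hom free_group G := free_lift_fun.

Lemma free_lift_gen x : free_lift (free_gen x) = f x.
Proof. by rewrite /= free_lift_class /word_eval big_seq1. Qed.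

End Lift.

Lemma free_group_ind (P : free_group -> Prop) :
    P 1 -> (forall x a, P a -> P (free_gen x * a)) ->
    (forall x a, P a -> P ((free_gen x)^-1 * a)) -> forall a, P a.
Proof.
move=> P1 PM PV a; rewrite -(free_reprK a).
elim: (repr a) => [|[x b] w IHw]; first exact: P1.
have -> : free_class ((x, b) :: w) =
          (if b then (free_gen x)^-1 else free_gen x) * free_class w.
  rewrite /free_gen -[_^-1]/(free_inv _) free_invE -fun_if.
  rewrite -[_ * _]/(free_mul _ _) free_mulE.
  by case: b.
by case: b; [exact: PV | exact: PM].
Qed.

Lemma free_hom_ext (G : groupType) (f g : group_hom free_group G) :
  (forall x, f (free_gen x) = g (free_gen x)) -> f =1 g.
Proof.
move=> fg; elim/free_group_ind => [|x a IH|x a IH].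
- by rewrite !gmulf1.
- by rewrite !gmulfM fg IH.
- by rewrite !gmulfM !gmulfV fg IH.
Qed.

End FreeGroup.

Definition is_subgroup (G : groupType) (H : set G) :=
  H 1 /\ forall x y, H x -> H y -> H (x / y).

Definition is_normal_subgroup (G : groupType) (H : set G) :=
  is_subgroup H /\ forall x y, H x -> H (x ^ y).

Definition generated_subgroup (G : groupType) (S : set G) : set G :=
  smallest (@is_subgroup G) S.

Definition normal_closure (G : groupType) (S : set G) : set G :=
  smallest (@is_normal_subgroup G) S.

Lemma normal_closure_normal (G : groupType) (S : set G) :
  is_normal_subgroup (normal_closure S).
Proof.
split; first split.
- by move=> H [[[H1 _] _] _].
- by move=> x y Nx Ny H HH; move: (HH) => [[[_ HF] _] _]; exact: HF (Nx H HH) (Ny H HH).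
- by move=> x y Nx H HH; move: (HH) => [[_ HJ] _]; exact: HJ (Nx H HH).
Qed.

(* The quotient of G by the normal closure of the elements u^{-1} v for which *)
(* the relation u = v is imposed.                                             *)
Section QuotientGroup.
Variables (G : groupType) (R : G -> G -> Prop).
Implicit Types x y z : G.

Definition relators : set G := [set z | exists u v, R u v /\ z = u^-1 * v].

Local Notation N := (normal_closure relators).

Lemma rel_closure1 : N 1.
Proof. by case: (normal_closure_normal relators) => [[]]. Qed.
Lemma rel_closureF x y : N x -> N y -> N (x / y).
Proof. by case: (normal_closure_normal relators) => [[_ H] _]; exact: H. Qed.
Lemma rel_closureJ x y : N x -> N (x ^ y).
Proof. by case: (normal_closure_normal relators) => [_ H]; exact: H. Qed.
Lemma rel_closureV x : N x -> N x^-1.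
Proof. by move=> Nx; rewrite -div1g; apply: rel_closureF Nx; exact: rel_closure1. Qed.
Lemma rel_closureM x y : N x -> N y -> N (x * y).
Proof. by move=> Nx /rel_closureV Ny; rewrite -[y]invgK; exact: rel_closureF. Qed.

Definition quot_eqb : rel G := fun x y => `[< N (x^-1 * y) >].

Lemma quot_eqb_refl : reflexive quot_eqb.
Proof. by move=> x; apply/asboolP; rewrite mulVg; exact: rel_closure1. Qed.
Lemma quot_eqb_sym : symmetric quot_eqb.
Proof.
by move=> x y; apply/asboolP/asboolP => /rel_closureV; rewrite invgM invgK.
Qed.
Lemma quot_eqb_trans : transitive quot_eqb.
Proof.
move=> y x z /asboolP xy /asboolP yz; apply/asboolP.
by have := rel_closureM xy yz; rewrite -mulgA mulVKg.
Qed.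

Canonical quot_equiv :=
  EquivRel quot_eqb quot_eqb_refl quot_eqb_sym quot_eqb_trans.

Definition quotient_group := {eq_quot quot_equiv}.
HB.instance Definition _ := Choice.on quotient_group.

Definition quot_class x : quotient_group := \pi_quotient_group x.

Lemma quot_classP x y : reflect (N (x^-1 * y)) (quot_class x == quot_class y).
Proof. by rewrite eqmodE; exact: asboolP. Qed.

Lemma quot_reprK (a : quotient_group) : quot_class (repr a) = a.
Proof. exact: reprK. Qed.

Lemma quot_repr x : N ((repr (quot_class x))^-1 * x).
Proof. by apply/quot_classP; rewrite quot_reprK. Qed.

Definition quot_mul (a b : quotient_group) := quot_class (repr a * repr b).
Definition quot_one := quot_class 1.
Definition quot_inv (a : quotient_group) := quot_class (repr a)^-1.

Lemma quot_mulE x y : quot_mul (quot_class x) (quot_class y) = quot_class (x * y).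
Proof.
apply/eqP/quot_classP.
set x' := repr _; set y' := repr _.
have -> : (x' * y')^-1 * (x * y) = (x'^-1 * x) ^ y' * (y'^-1 * y).
  by rewrite invgM conjgE !mulgA mulgK.
by apply: rel_closureM; [apply: rel_closureJ|]; exact: quot_repr.
Qed.

Lemma quot_invE x : quot_inv (quot_class x) = quot_class x^-1.
Proof.
apply/eqP/quot_classP; rewrite invgK.
set x' := repr _.
have -> : x' / x = ((x'^-1 * x) ^ x'^-1)^-1.
  by rewrite conjgE invgK !mulgA mulgV mul1g invgM invgK.
by apply: rel_closureV; apply: rel_closureJ; exact: quot_repr.
Qed.

Lemma quot_mulA : associative quot_mul.
Proof.
move=> a b c; rewrite -(quot_reprK a) -(quot_reprK b) -(quot_reprK c).
by rewrite !quot_mulE mulgA.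
Qed.
Lemma quot_mul1g : left_id quot_one quot_mul.
Proof. by move=> a; rewrite -(quot_reprK a) quot_mulE mul1g. Qed.
Lemma quot_mulg1 : right_id quot_one quot_mul.
Proof. by move=> a; rewrite -(quot_reprK a) quot_mulE mulg1. Qed.
Lemma quot_mulVg : left_inverse quot_one quot_inv quot_mul.
Proof. by move=> a; rewrite -(quot_reprK a) quot_invE quot_mulE mulVg. Qed.
Lemma quot_mulgV : right_inverse quot_one quot_inv quot_mul.
Proof. by move=> a; rewrite -(quot_reprK a) quot_invE quot_mulE mulgV. Qed.

HB.instance Definition _ := isGroup.Build quotient_group
  quot_mulA quot_mul1g quot_mulg1 quot_mulVg quot_mulgV.

Lemma quot_classM : {morph quot_class : x y / x * y}.
Proof. by move=> x y; rewrite -quot_mulE. Qed.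

HB.instance Definition _ :=
  isMultiplicative.Build G quotient_group quot_class quot_classM.
HB.instance Definition _ :=
  Multiplicative_isUMagmaMorphism.Build G quotient_group quot_class erefl.

Lemma quot_class_rel u v : R u v -> quot_class u = quot_class v.
Proof. by move=> Ruv; apply/eqP/quot_classP; apply: sub_gen_smallest; exists u, v. Qed.

Section Lift.
Variables (H : groupType) (f : group_hom G H).
Hypothesis fR : forall u v, R u v -> f u = f v.

Lemma quot_lift_subproof x : N x -> f x = 1.
Proof.
suff K : normal_closure relators `<=` [set y | f y = 1] by exact: K.
apply: smallest_sub => [|_ [u [v [/fR Ruv ->]]] /=]; last first.
  by rewrite gmulfM gmulfV Ruv mulVg.
split; first split=> [|y z]; rewrite /= ?gmulf1 //.
  by rewrite gmulfF => -> ->; rewrite mulgV.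
by move=> y z; rewrite gmulfJ => ->; rewrite conj1g.
Qed.

Definition quot_lift_fun (a : quotient_group) : H := f (repr a).

Lemma quot_lift_class x : quot_lift_fun (quot_class x) = f x.
Proof.
have := quot_lift_subproof (quot_repr x).
by rewrite gmulfM gmulfV => /mulg1_eq; rewrite invgK.
Qed.

Lemma quot_liftM : {morph quot_lift_fun : a b / a * b}.
Proof.
move=> a b; rewrite -[a in LHS]quot_reprK -[b in LHS]quot_reprK.
by rewrite -quot_classM quot_lift_class gmulfM.
Qed.

Lemma quot_lift1 : quot_lift_fun 1 = 1.
Proof. by rewrite -[1 in LHS]/(quot_class 1) quot_lift_class gmulf1. Qed.

HB.instance Definition _ :=
  isMultiplicative.Build quotient_group H quot_lift_fun quot_liftM.
HB.instance Definition _ :=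
  Multiplicative_isUMagmaMorphism.Build quotient_group H quot_lift_fun quot_lift1.

Definition quot_lift : group_hom quotient_group H := quot_lift_fun.

End Lift.
End QuotientGroup.

(* The presentation < X | u = v for R u v >. *)
Section Presentation.
Variables (X : choiceType) (R : free_group X -> free_group X -> Prop).

Definition presented : groupType := quotient_group R.

Definition pres_gen (x : X) : presented := quot_class R (free_gen x).

Section Lift.
Variables (G : groupType) (f : X -> G).
Hypothesis fR : forall u v, R u v -> free_lift f u = free_lift f v.

Definition pres_lift : group_hom presented G := quot_lift fR.

Lemma pres_lift_gen x : pres_lift (pres_gen x) = f x.
Proof. exact: etrans (quot_lift_class fR _) (free_lift_gen f x). Qed.

End Lift.

Lemma pres_hom_ext (G : groupType) (f g : group_hom presented G) :
  (forall x, f (pres_gen x) = g (pres_gen x)) -> f =1 g.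
Proof.
move=> fg a; rewrite -(quot_reprK a).
pose c : group_hom (free_group X) presented := quot_class R.
pose fc : group_hom (free_group X) G := f \o c.
pose gc : group_hom (free_group X) G := g \o c.
exact: (@free_hom_ext _ _ fc gc fg).
Qed.

End Presentation.

(* Indices start at 0: for n strands, i : 'I_n.-1 indexes the generator       *)
(* braiding the strands ord_lo i = i and ord_hi i = i + 1.                    *)

Lemma ord_lo_subproof n (i : 'I_n.-1) : (i < n)%N.
Proof. exact: leq_trans (ltn_ord i) (leq_pred n). Qed.

Lemma ord_hi_subproof n (i : 'I_n.-1) : (i.+1 < n)%N.
Proof. by case: n i => [|n] []. Qed.

Definition ord_lo n (i : 'I_n.-1) : 'I_n := Ordinal (ord_lo_subproof i).
Definition ord_hi n (i : 'I_n.-1) : 'I_n := Ordinal (ord_hi_subproof i).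

Inductive braid_rel n : free_group 'I_n.-1 -> free_group 'I_n.-1 -> Prop :=
| BraidFar (i j : 'I_n.-1) : (i.+1 < j)%N ->
    braid_rel (free_gen i * free_gen j) (free_gen j * free_gen i)
| BraidNear (i j : 'I_n.-1) : j = i.+1 :> nat ->
    braid_rel (free_gen i * free_gen j * free_gen i)
              (free_gen j * free_gen i * free_gen j).

Definition braid_group n : groupType := presented (@braid_rel n).

Definition sigma n (i : 'I_n.-1) : braid_group n := pres_gen (@braid_rel n) i.

Lemma ord_lo_hi n (i : 'I_n.-1) : (ord_lo i == ord_hi i) = false.
Proof. by rewrite -val_eqE /= ltn_eqF. Qed.

Lemma ord_hi_lo n (i : 'I_n.-1) : (ord_hi i == ord_lo i) = false.
Proof. by rewrite eq_sym ord_lo_hi. Qed.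

Lemma ord_far n (i j : 'I_n.-1) : (i.+1 < j)%N ->
  ((ord_lo i == ord_lo j) = false) * ((ord_lo j == ord_lo i) = false) *
  ((ord_lo i == ord_hi j) = false) * ((ord_hi j == ord_lo i) = false) *
  ((ord_hi i == ord_lo j) = false) * ((ord_lo j == ord_hi i) = false) *
  ((ord_hi i == ord_hi j) = false) * ((ord_hi j == ord_hi i) = false).
Proof.
move=> ij; have lt1 : (i < j)%N by apply: ltn_trans ij.
have lt2 : (i < j.+1)%N := leqW lt1.
do ![split]; rewrite -val_eqE /= ?eqSS.
all: by rewrite ?(ltn_eqF ij, ltn_eqF lt1, ltn_eqF lt2, gtn_eqF ij, gtn_eqF lt1, gtn_eqF lt2).
Qed.

Lemma ord_near n (i j : 'I_n.-1) : j = i.+1 :> nat ->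
  ((ord_lo i == ord_hi j) = false) * ((ord_hi j == ord_lo i) = false) *
  ((ord_hi i == ord_hi j) = false) * ((ord_hi j == ord_hi i) = false).
Proof.
move=> ji; have lt1 : (i < i.+2)%N by [].
have lt2 : (i.+1 < i.+2)%N by [].
do ![split]; rewrite -val_eqE /= ji.
all: by rewrite ?(ltn_eqF lt1, ltn_eqF lt2, gtn_eqF lt1, gtn_eqF lt2).
Qed.

Lemma ord_near_eq n (i j : 'I_n.-1) : j = i.+1 :> nat -> ord_lo j = ord_hi i.
Proof. by move=> ji; exact: val_inj. Qed.

Section HurwitzAction.
Variables (G : groupType) (n : nat).
Implicit Types (g : 'I_n -> G) (i : 'I_n.-1).

Definition hurwitz_step (a b : 'I_n) g : 'I_n -> G :=
  fun k => if k == a then g b else if k == b then (g b)^-1 * g a * g b else g k.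

Definition hurwitz_back (a b : 'I_n) g : 'I_n -> G :=
  fun k => if k == a then g a * g b * (g a)^-1 else if k == b then g a else g k.

Lemma hurwitz_stepK i :
  cancel (hurwitz_step (ord_lo i) (ord_hi i)) (hurwitz_back (ord_lo i) (ord_hi i)).
Proof.
move=> g; apply: funext => k; rewrite /hurwitz_back /hurwitz_step !eqxx ord_hi_lo.
case: (k =P _) => [->|_]; first by rewrite !mulgA mulgV mul1g mulgK.
by case: (k =P _) => [->|].
Qed.

Lemma hurwitz_backK i :
  cancel (hurwitz_back (ord_lo i) (ord_hi i)) (hurwitz_step (ord_lo i) (ord_hi i)).
Proof.
move=> g; apply: funext => k; rewrite /hurwitz_back /hurwitz_step !eqxx ord_hi_lo.
case: (k =P _) => [->|_] //.
by case: (k =P _) => [->|] //; rewrite !mulgA mulVg mul1g mulgVK.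
Qed.

Definition hurwitz_gen i : sym ('I_n -> G) := Sym (hurwitz_stepK i) (hurwitz_backK i).

Lemma hurwitz_gen_rel u v :
  braid_rel u v -> free_lift hurwitz_gen u = free_lift hurwitz_gen v.
Proof.
case=> [i j ij | i j ij]; rewrite !gmulfM !free_lift_gen;
  apply: sym_ext => g; apply: funext => k; rewrite !symM /= /hurwitz_step.
- have U := ord_far ij.
  case: (k =P ord_lo i) => [->|/eqP/negbTE k1]; first by rewrite !(U, eqxx, ord_lo_hi, ord_hi_lo).
  case: (k =P ord_hi i) => [->|/eqP/negbTE k2]; first by rewrite !(U, eqxx, ord_lo_hi, ord_hi_lo).
  by rewrite !(U, k1, k2).
- have U := ord_near ij; rewrite !(ord_near_eq ij).
  case: (k =P ord_lo i) => [e|/eqP/negbTE k1].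
    by rewrite ?e !(U, eqxx, ord_lo_hi, ord_hi_lo).
  case: (k =P ord_hi i) => [e|/eqP/negbTE k2].
    by rewrite ?e !(U, eqxx, ord_lo_hi, ord_hi_lo).
  case: (k =P ord_hi j) => [e|/eqP/negbTE k3].
    rewrite ?e !(U, eqxx, ord_lo_hi, ord_hi_lo) !invgM !invgK !mulgA.
    by rewrite !mulgK.
  by rewrite ?(U, k1, k2, k3).
Qed.

Definition hurwitz_action : group_hom (braid_group n) (sym ('I_n -> G)) :=
  pres_lift hurwitz_gen_rel.

Definition hurwitz_orbit g : set ('I_n -> G) :=
  [set r | exists b : braid_group n, r = hurwitz_action b g].

Definition hur g : set G := [set x | exists2 r, hurwitz_orbit g r & exists k, x = r k].

Lemma hurwitz_action_sigma i g :
  hurwitz_action (sigma i) g = hurwitz_step (ord_lo i) (ord_hi i) g.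
Proof. by rewrite /hurwitz_action pres_lift_gen. Qed.

Lemma hur_id g k : hur g (g k).
Proof. by exists g; [exists 1; rewrite gmulf1 | exists k]. Qed.

End HurwitzAction.

Section HurwitzGroup.
Variables (G : groupType) (n : nat) (g : 'I_n -> G).

(* k1 and k2 are the first two positions. The words use the generators [a],   *)
(* [b], [c] of elements a, b, c of Hur; hurwitz_rel_mem below shows that they *)
(* exist for every tuple of the orbit, so no relation is lost. There is no    *)
(* relation when n < 2.                                                       *)
Inductive hurwitz_rel : free_group (hur g) -> free_group (hur g) -> Prop :=
| HurwitzRel (r : 'I_n -> G) (k1 k2 : 'I_n) (a b c : hur g) :
    hurwitz_orbit g r -> k1 = 0%N :> nat -> k2 = 1%N :> nat ->
    val a = r k1 -> val b = r k2 -> val c = (r k2)^-1 * r k1 * r k2 ->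
    hurwitz_rel ((free_gen b)^-1 * free_gen a * free_gen b) (free_gen c).

Definition hurwitz_group : groupType := presented hurwitz_rel.

Definition hurwitz_pt x (hx : hur g x) : hurwitz_group :=
  pres_gen hurwitz_rel (exist _ x (mem_set hx)).

Lemma hurwitz_rel_mem (r : 'I_n -> G) (k1 k2 : 'I_n) :
    hurwitz_orbit g r -> k1 = 0%N :> nat -> k2 = 1%N :> nat ->
  [/\ hur g (r k1), hur g (r k2) & hur g ((r k2)^-1 * r k1 * r k2)].
Proof.
move=> rg k10 k21; split; [by exists r => //; exists k1 | by exists r => //; exists k2|].
have n2 : (0 < n.-1)%N by have := ltn_ord k2; rewrite k21; case: (n) => [|[|m]].
case: rg => b ->; pose i := Ordinal n2.
exists (hurwitz_action G n (sigma i * b) g); first by exists (sigma i * b).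
exists k2; rewrite gmulfM symM hurwitz_action_sigma /hurwitz_step.
have <- : k1 = ord_lo i by exact: val_inj.
have <- : k2 = ord_hi i by exact: val_inj.
by rewrite -val_eqE /= k10 k21 eqxx.
Qed.

End HurwitzGroup.

Section ArtinAction.
Variable n : nat.
Local Notation F := (free_group 'I_n).
Local Notation x := (@free_gen 'I_n).

Definition artin_aut (i : 'I_n.-1) : group_hom F F :=
  free_lift (fun j => if j == ord_lo i
                      then x (ord_lo i) * x (ord_hi i) * (x (ord_lo i))^-1
                      else if j == ord_hi i then x (ord_lo i) else x j).

Definition artin_aut_inv (i : 'I_n.-1) : group_hom F F :=
  free_lift (fun j => if j == ord_lo i then x (ord_hi i)
                      else if j == ord_hi i
                      then (x (ord_hi i))^-1 * x (ord_lo i) * x (ord_hi i)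
                      else x j).

Lemma artin_autK i : cancel (artin_aut i) (artin_aut_inv i).
Proof.
pose h : group_hom F F := artin_aut_inv i \o artin_aut i.
pose id' : group_hom F F := idfun.
apply: (@free_hom_ext _ _ h id') => j; rewrite /h /= free_lift_gen.
case: (j =P _) => [->|/eqP/negbTE j1].
  rewrite !gmulfM gmulfV !free_lift_gen !eqxx ord_hi_lo.
  by rewrite !mulgA mulgV mul1g mulgK.
case: (j =P _) => [->|/eqP/negbTE j2]; first by rewrite free_lift_gen eqxx.
by rewrite free_lift_gen j1 j2.
Qed.

Lemma artin_aut_invK i : cancel (artin_aut_inv i) (artin_aut i).
Proof.
pose h : group_hom F F := artin_aut i \o artin_aut_inv i.
pose id' : group_hom F F := idfun.
apply: (@free_hom_ext _ _ h id') => j; rewrite /h /= free_lift_gen.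
case: (j =P _) => [->|/eqP/negbTE j1].
  by rewrite free_lift_gen eqxx ord_hi_lo.
case: (j =P _) => [->|/eqP/negbTE j2].
  rewrite !gmulfM gmulfV !free_lift_gen !eqxx ord_hi_lo.
  by rewrite !mulgA mulVg mul1g mulgVK.
by rewrite free_lift_gen j1 j2.
Qed.

Definition artin_gen i : sym F := Sym (artin_autK i) (artin_aut_invK i).

Lemma artin_gen_rel u v :
  braid_rel u v -> free_lift artin_gen u = free_lift artin_gen v.
Proof.
case=> [i j ij | i j ij]; rewrite !gmulfM !free_lift_gen; apply: sym_ext.
- pose h1 : group_hom F F := artin_aut i \o artin_aut j.
  pose h2 : group_hom F F := artin_aut j \o artin_aut i.
  apply: (@free_hom_ext _ _ h1 h2) => k; rewrite /h1 /h2 /= !free_lift_gen.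
  have U := ord_far ij.
  case: (k =P ord_lo i) => [->|/eqP/negbTE k1].
    by rewrite !(U, eqxx, ord_lo_hi, ord_hi_lo, gmulfM, gmulfV, free_lift_gen).
  case: (k =P ord_hi i) => [->|/eqP/negbTE k2].
    by rewrite !(U, eqxx, ord_lo_hi, ord_hi_lo, gmulfM, gmulfV, free_lift_gen).
  case: (k =P ord_lo j) => [->|/eqP/negbTE k3].
    by rewrite !(U, eqxx, ord_lo_hi, ord_hi_lo, gmulfM, gmulfV, free_lift_gen).
  case: (k =P ord_hi j) => [->|/eqP/negbTE k4].
    by rewrite !(U, eqxx, ord_lo_hi, ord_hi_lo, gmulfM, gmulfV, free_lift_gen).
  by rewrite !free_lift_gen !(k1, k2, k3, k4).
- pose h1 : group_hom F F := artin_aut i \o (artin_aut j \o artin_aut i).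
  pose h2 : group_hom F F := artin_aut j \o (artin_aut i \o artin_aut j).
  apply: (@free_hom_ext _ _ h1 h2) => k; rewrite /h1 /h2 /= !free_lift_gen.
  have U := ord_near ij; rewrite !(ord_near_eq ij).
  case: (k =P ord_lo i) => [e|/eqP/negbTE k1].
    rewrite ?e !(U, eqxx, ord_lo_hi, ord_hi_lo, gmulfM, gmulfV, free_lift_gen, ord_near_eq ij).
    by rewrite !invgM !invgK !mulgA !mulgVK.
  case: (k =P ord_hi i) => [e|/eqP/negbTE k2].
    by rewrite ?e !(U, eqxx, ord_lo_hi, ord_hi_lo, gmulfM, gmulfV, free_lift_gen, ord_near_eq ij).
  case: (k =P ord_hi j) => [e|/eqP/negbTE k3].
    by rewrite ?e !(U, eqxx, ord_lo_hi, ord_hi_lo, gmulfM, gmulfV, free_lift_gen, ord_near_eq ij).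
  by rewrite ?(free_lift_gen, ord_near_eq ij, k1, k2, k3).
Qed.

Definition artin_action : group_hom (braid_group n) (sym F) :=
  pres_lift artin_gen_rel.

Lemma artin_action_sigma i : artin_action (sigma i) =1 artin_aut i.
Proof. by move=> q; rewrite /artin_action pres_lift_gen. Qed.

Lemma artin_actionM b p q :
  artin_action b (p * q) = artin_action b p * artin_action b q.
Proof.
elim/quotW: b => w; elim/free_group_ind: w p q => [|i w IH|i w IH] p q.
- by rewrite -[\pi _]/(1 : braid_group n) gmulf1.
- rewrite -[\pi _]/(quot_class _ _) quot_classM gmulfM !symM IH.
  by rewrite -[quot_class _ (free_gen i)]/(sigma i) !artin_action_sigma gmulfM.
- rewrite -[\pi _]/(quot_class _ _) quot_classM gmulfM !symM IH.
  have -> : quot_class (@braid_rel n) (free_gen i)^-1 = (sigma i)^-1.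
    by rewrite gmulfV.
  by rewrite gmulfV /artin_action pres_lift_gen /= gmulfM.
Qed.

End ArtinAction.

Notation "b ⋆ q" := (artin_action _ b q) (at level 40, left associativity)
  : group_scope.

Section BirmanKoLee.
Variables (n : nat) (i j : 'I_n) (ij : (i < j)%N).

Lemma bkl_subproof : (j.-1 < n.-1)%N.
Proof.
by case: n i j ij => [[]//|m] i' [[|j'] ltj] //=; rewrite -ltnS.
Qed.

(* The increasing product sigma_i ... sigma_(j-2). *)
Definition bkl_conj : braid_group n :=
  \prod_(k < n.-1 | (i <= k < j.-1)%N) sigma k.

Definition bkl : braid_group n :=
  bkl_conj * sigma (Ordinal bkl_subproof) * bkl_conj^-1.

End BirmanKoLee.

(* The label None stands for infinity.                                        *)

Definition label_ge (l : option nat) (k : nat) : bool :=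
  if l is Some m then (k <= m)%N else true.

Record coxeter_graph (n : nat) := CoxeterGraph {
  cox_edge : rel 'I_n;
  cox_label : 'I_n -> 'I_n -> option nat;
  cox_edge_sym : symmetric cox_edge;
  cox_edge_irr : irreflexive cox_edge;
  cox_label_sym : forall i j, cox_label i j = cox_label j i;
  cox_label_ge3 : forall i j, cox_edge i j -> label_ge (cox_label i j) 3 }.

(* On the diagonal the value is junk, and is never used.                      *)
Definition cox_m n (Gamma : coxeter_graph n) (i j : 'I_n) : option nat :=
  if cox_edge Gamma i j then cox_label Gamma i j else Some 2%N.

Fixpoint altprod (G : groupType) (g h : G) (k : nat) : G :=
  if k is k'.+1 then g * altprod h g k' else 1.

Section CoxeterGroups.
Variables (n : nat) (Gamma : coxeter_graph n).
Local Notation F := (free_group 'I_n).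
Local Notation x := (@free_gen 'I_n).
Local Notation m := (cox_m Gamma).

Inductive artin_rel : F -> F -> Prop :=
| ArtinBraid (i j : 'I_n) (k : nat) : i != j -> m i j = Some k ->
    artin_rel (altprod (x i) (x j) k) (altprod (x j) (x i) k).

Definition artin_group : groupType := presented artin_rel.
Definition artin_t (i : 'I_n) : artin_group := pres_gen artin_rel i.

Inductive coxeter_rel : F -> F -> Prop :=
| CoxeterBraid (i j : 'I_n) (k : nat) : i != j -> m i j = Some k ->
    coxeter_rel (altprod (x i) (x j) k) (altprod (x j) (x i) k)
| CoxeterInvol (i : 'I_n) : coxeter_rel (x i ^+ 2) 1.

Definition coxeter_group : groupType := presented coxeter_rel.
Definition coxeter_s (i : 'I_n) : coxeter_group := pres_gen coxeter_rel i.

Definition dual_artin_group : groupType := hurwitz_group coxeter_s.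
Definition dual_artin_s (i : 'I_n) : dual_artin_group :=
  hurwitz_pt (hur_id coxeter_s i).

Definition pi_A : group_hom F artin_group := free_lift artin_t.
Definition pi_W : group_hom F coxeter_group := free_lift coxeter_s.

Definition hurwitz_Q : set F := hur x.

Definition B_hat : set (braid_group n) :=
  generated_subgroup
    [set b | exists (i j : 'I_n) (ij : (i < j)%N) (k : nat),
             m i j = Some k /\ b = bkl ij ^+ k].

(* A morphism sending every t_i to [s_i] is unique by pres_hom_ext: it is the *)
(* canonical epimorphism.                                                     *)
Definition canonically_isomorphic : Prop :=
  exists phi : group_hom artin_group dual_artin_group,
    (forall i, phi (artin_t i) = dual_artin_s i) /\ bijective phi.

End CoxeterGroups.

(* Main.v *)
(* In the universal Coxeter group U an element q of Q becomes a palindrome     *)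
(* t, read as a geodesic between two leaves of a planar tree. Braids preserve  *)
(* the cyclic orders at the vertices, so this geodesic does not cross its      *)
(* translates; applied to the geodesic obtained by doubling every strand, this *)
(* also shows that t determines q. For a pair {i, j} it forces the maximal     *)
(* {i, j}-alternating blocks at which the geodesic separates i from j to turn  *)
(* to the same side and to have nearly equal lengths, once one of them has     *)
(* length at least 4; sigma_ij^m replaces each such block, of length L, by one *)
(* of length 2m - L. Hence the words of a B_hat-orbit can be shortened until   *)
(* all blocks have length at most m + 1. If two words t1 and t2 give the same  *)
(* element of W, the signs in the geometric representation (Mozes' numbers     *)
(* game) determine, as m >= 5, the next letter up to a long block: where t1    *)
(* and t2 diverge, t2 has a long block on the two diverging letters, and       *)
(* twisting t2 by this pair lengthens the common prefix. For the dual group,   *)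
(* [r] |-> pi_A q, where pi_W q = r, inverts the canonical map.                *)

From Stdlib Require Import Reals Lra.
Require Import Defs.
From HB Require Import structures.
From mathcomp Require Import all_boot.
From mathcomp Require Import zify.
From mathcomp Require Import boolp classical_sets.

Set Implicit Arguments.
Unset Strict Implicit.
Unset Printing Implicit Defensive.

Local Open Scope classical_set_scope.
Local Open Scope group_scope.
Local Open Scope quotient_scope.

(** * The universal Coxeter group *)

(** Equality in W is compared with the action of [B_hat] inside the universal Coxeter group, where
    elements of Q are rigid words. There [uw q] is a palindrome ([uw_Q]), and the braid generators
    act by automorphisms that keep the cyclic order of the leaves of a planar tree ([usig_ult]). The
    path of a single letter does not cross its translates, so no path coming from Q does, and two
    stretches of such a path along a common segment stay on their sides ([crossing]). Once a pair of
    letters has a block of length at least 4, all its essential blocks turn to the same side and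
    differ from that one in length by at most two ([window]). Because of this uniformity a power of
    a Birman-Ko-Lee generator, or its inverse, acts on the word by replacing each essential block of
    length L by one of length 2m - L ([shift_prod], [bkl_pow_uw]).

    A block longer than m + 1 makes every essential block of its pair at least m long, so a twist
    shortens the word ([twist_shorter]); every orbit thus contains a word with blocks of length at
    most m + 1. To compare words, W acts by the numbers game. If all blocks have length at most 2m -
    2, the descents of a suffix are those of its first block ([descents_alt]). Hence two words of
    the same element can part only where the second has a long block on the two diverging letters
    ([divergence]). Twisting that pair leaves the common prefix alone ([prefix_inert]) and brings
    the wanted letter next ([shift_word]), which gives [align] by induction. The word [uw q]
    determines q ([uw_inj_Q]), by the same noncrossing argument applied to doubled strands.

    The generators of [B_hat] do not change [pi_A], because the braid relation of their pair holds
    in the Artin group ([bkl_pow_hom]). So [r] can be sent to [pi_A q] for any q in Q above r, and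
    this inverts the canonical map; the latter exists because a braid relation says that an iterated
    Hurwitz move on two entries closes up ([altprod_dstep]). *)

Definition neqn : rel nat := fun c d => c != d.

(* The letter i.+1 stands for the generator of index i; 0 is kept to mark the *)
(* two ends of a word.                                                        *)
Definition reduced (w : seq nat) := (0 \notin w) && sorted neqn w.

Record uword := UWord { uval :> seq nat; uvalP : reduced uval }.
HB.instance Definition _ := [isSub for uval].
HB.instance Definition _ := [Choice of uword by <:].

Definition lact (c : nat) (w : seq nat) :=
  if w is d :: w' then if c == d then w' else c :: w else [:: c].

Lemma reduced_cons c w :
  reduced (c :: w) = [&& 0 < c, c != head 0 w & reduced w].
Proof.
rewrite /reduced inE negb_or; case: w => [|d w] /=; first by case: c.
by rewrite /neqn lt0n eq_sym; case: (c == 0) => //=; case: (c == d); rewrite /= ?andbF.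
Qed.

Lemma lact_reduced c w : 0 < c -> reduced w -> reduced (lact c w).
Proof.
move=> c0; case: w => [|d w]; first by rewrite /= reduced_cons c0 /= lt0n_neq0.
rewrite /=; case: eqP => [_|/eqP cd]; first by rewrite reduced_cons => /and3P[].
by move=> rw; rewrite reduced_cons c0 /= cd.
Qed.

Lemma lactK c w : reduced w -> lact c (lact c w) = w.
Proof.
case: w => [|d w] /=; first by rewrite eqxx.
case: eqP => [->|/eqP cd]; last by rewrite /= eqxx.
by rewrite reduced_cons => /and3P[_]; case: w => [|e w] //= /negbTE ->.
Qed.

Lemma foldr_lact_reduced u v : 0 \notin u -> reduced v -> reduced (foldr lact v u).
Proof.
elim: u => //= c u IH; rewrite inE negb_or eq_sym -lt0n => /andP[c0 u0] rv.
exact/lact_reduced/IH.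
Qed.

Lemma foldr_lact_cat u v : reduced (u ++ v) -> foldr lact v u = u ++ v.
Proof.
elim: u => //= c u IH; rewrite reduced_cons => /and3P[_ + r]; rewrite IH //.
by case: (u ++ v) => [|d w] //= /negbTE ->.
Qed.

Lemma uword0 (u : uword) : 0 \notin (u : seq nat).
Proof. by case: u => u /= /andP[]. Qed.

Lemma reduced_rev w : reduced (rev w) = reduced w.
Proof.
rewrite /reduced mem_rev rev_sorted; congr (_ && _).
by apply: eq_sorted => c d; rewrite /neqn eq_sym.
Qed.

(* Opaque, so that simplification does not expose the underlying words. *)
Lemma umul_ex (u v : uword) : {w : uword | w = foldr lact v u :> seq nat}.
Proof. by exists (UWord (foldr_lact_reduced (uword0 u) (uvalP v))). Qed.
Lemma uinv_ex (u : uword) : {w : uword | w = rev u :> seq nat}.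
Proof. by exists (UWord (etrans (reduced_rev u) (uvalP u))). Qed.

Definition umul u v := sval (umul_ex u v).
Definition uinv u := sval (uinv_ex u).
Lemma uval_umul u v : umul u v = foldr lact v u :> seq nat.
Proof. exact: svalP (umul_ex u v). Qed.
Lemma uval_uinv u : uinv u = rev u :> seq nat.
Proof. exact: svalP (uinv_ex u). Qed.
Definition uone : uword := @UWord [::] isT.
(** Prepending or cancelling a first letter is an involution on reduced words ([lactK]), so a
    cancellation between [u] and [v] is also one in the action on [w]. *)
Lemma foldr_lactA u v w : reduced v -> reduced w ->  0 \notin u ->
  foldr lact w (foldr lact v u) = foldr lact (foldr lact w v) u.
Proof.
move=> rv rw; elim: u => //= c u IH; rewrite inE negb_or => /andP[c0 u0].
rewrite -IH //; have := foldr_lact_reduced u0 rv.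
case: (foldr lact v u) => [|d x] //=; case: eqP => [<- rx|//].
rewrite lactK // foldr_lact_reduced //.
by move: rx => /andP[]; rewrite inE negb_or => /andP[].
Qed.

Lemma umulA : associative umul.
Proof.
move=> u v w; apply/val_inj/esym; rewrite /= !uval_umul.
by apply: foldr_lactA; rewrite ?uvalP ?uword0.
Qed.
Lemma umul1 : left_id uone umul.
Proof. by move=> u; apply: val_inj; rewrite /= uval_umul. Qed.
Lemma umulr1 : right_id uone umul.
Proof. by move=> u; apply: val_inj; rewrite /= uval_umul foldr_lact_cat ?cats0 ?uvalP. Qed.

Lemma foldr_lact_rev w v : reduced v -> 0 \notin w ->
  foldr lact (foldr lact v w) (rev w) = v.
Proof.
move=> rv; elim: w => //= c w IH; rewrite inE negb_or => /andP[c0 w0].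
by rewrite rev_cons -cats1 foldr_cat /= lactK ?IH // foldr_lact_reduced.
Qed.

Lemma umulV : left_inverse uone uinv umul.
Proof.
move=> u; apply: val_inj; have := @foldr_lact_rev u [::] isT (uword0 u).
rewrite /= uval_umul uval_uinv.
by rewrite (foldr_lact_cat (v := [::])) cats0 ?uvalP.
Qed.
Lemma umulrV : right_inverse uone uinv umul.
Proof.
move=> u; have e : uinv (uinv u) = u by apply: val_inj; rewrite /= !uval_uinv revK.
by rewrite -{1}e umulV.
Qed.

HB.instance Definition _ := isGroup.Build uword umulA umul1 umulr1 umulV umulrV.

Section UWordTheory.
Implicit Types (u v w : uword) (c d : nat).

Lemma uval_mul u v : (u * v : uword) = foldr lact v u :> seq nat.
Proof. exact: uval_umul. Qed.
Lemma uval1 : (1 : uword) = [::] :> seq nat. Proof. by []. Qed.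
Lemma uvalV u : u^-1 = rev u :> seq nat. Proof. exact: uval_uinv. Qed.

Lemma uval_inj u v : u = v :> seq nat -> u = v.
Proof. exact: val_inj. Qed.
Lemma uval_eqE u v : (u == v) = (uval u == uval v).
Proof. by apply/eqP/eqP => [->//|/uval_inj]. Qed.

Lemma uval_cat u v : reduced (u ++ v) -> (u * v : uword) = u ++ v :> seq nat.
Proof. by rewrite uval_mul; exact: foldr_lact_cat. Qed.

Lemma ugen_subproof c : reduced (if 0 < c then [:: c] else [::]).
Proof. by case: c. Qed.

(* The junk letter 0 stands for 1. *)
Definition ugen c : uword := UWord (ugen_subproof c).

Lemma uval_gen c : 0 < c -> ugen c = [:: c] :> seq nat.
Proof. by move=> /= ->. Qed.

Lemma ugenK c : ugen c * ugen c = 1.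
Proof. by apply: val_inj; rewrite /= uval_mul; case: c => //= c; rewrite eqxx. Qed.

Lemma ugenV c : (ugen c)^-1 = ugen c.
Proof. exact/mulg1_eq/ugenK. Qed.

Definition uprod (s : seq nat) : uword := \prod_(c <- s) ugen c.

Lemma uprod_cons c s : uprod (c :: s) = ugen c * uprod s.
Proof. exact: big_cons. Qed.
Lemma uprod_nil : uprod [::] = 1.
Proof. exact: big_nil. Qed.
Lemma uprod_cat s1 s2 : uprod (s1 ++ s2) = uprod s1 * uprod s2.
Proof. exact: big_cat. Qed.
Lemma uprod1 c : uprod [:: c] = ugen c.
Proof. exact: big_seq1. Qed.

Lemma uprod_rev s : uprod (rev s) = (uprod s)^-1.
Proof.
elim: s => [|c s IH]; first by rewrite uprod_nil invg1.
by rewrite rev_cons -cats1 uprod_cat IH uprod1 uprod_cons invgM ugenV.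
Qed.

Lemma uval_prod s : 0 \notin s -> uprod s = foldr lact [::] s :> seq nat.
Proof.
elim: s => [|c s IH]; first by rewrite uprod_nil.
rewrite inE negb_or eq_sym -lt0n uprod_cons uval_mul => /andP[c0 /IH ->] /=.
by rewrite c0.
Qed.

Lemma uprod_reduced s : reduced s -> uprod s = s :> seq nat.
Proof.
move=> rs; rewrite uval_prod; last by case/andP: rs.
by rewrite foldr_lact_cat ?cats0.
Qed.

Lemma uprod_val u : uprod u = u.
Proof. by apply: val_inj; rewrite /= uprod_reduced ?uvalP. Qed.

Lemma size_uprod s : size (uprod s) <= size s.
Proof.
elim: s => [|c s IH]; first by rewrite uprod_nil uval1.
rewrite uprod_cons uval_mul; apply: (@leq_trans (size (uprod s)).+1) => //.
case: c => [|c] /=; first exact: leqnSn.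
by case: (uval _) => //= d w; case: eqP => _ //=; do 2 apply: leqW.
Qed.

End UWordTheory.

Section ULift.
Variables (G : groupType) (f : nat -> G).
Hypotheses (fK : forall c, f c * f c = 1) (f0 : f 0 = 1).

Definition ulift_fun (u : uword) : G := \prod_(c <- u) f c.

Lemma ulift_lact (s r : seq nat) :
  \prod_(c <- foldr lact r s) f c = \prod_(c <- s) f c * \prod_(c <- r) f c.
Proof.
elim: s => [|c s IH] /=; first by rewrite big_nil mul1g.
rewrite big_cons -mulgA -IH; case: (foldr _ _ _) => [|d w] /=.
  by rewrite big_seq1 big_nil mulg1.
case: eqP => [<-|_]; last by rewrite big_cons.
by rewrite big_cons mulgA fK mul1g.
Qed.

Lemma uliftM : {morph ulift_fun : u v / u * v}.
Proof. by move=> u v; rewrite /ulift_fun uval_mul ulift_lact. Qed.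
Lemma ulift1 : ulift_fun 1 = 1.
Proof. exact: big_nil. Qed.

HB.instance Definition _ := isMultiplicative.Build uword G ulift_fun uliftM.
HB.instance Definition _ :=
  Multiplicative_isUMagmaMorphism.Build uword G ulift_fun ulift1.

Lemma ulift_ex :
  {g : group_hom uword G | forall c, g (ugen c) = f c}.
Proof.
exists ulift_fun => c.
by case: c => [|c]; rewrite /= /ulift_fun /= ?big_nil ?big_seq1 ?f0.
Qed.

Definition ulift : group_hom uword G := sval ulift_ex.

Lemma ulift_gen c : ulift (ugen c) = f c.
Proof. exact: (svalP ulift_ex). Qed.

End ULift.

Lemma uhom_ext (G : groupType) (f g : group_hom uword G) :
  (forall c, 0 < c -> f (ugen c) = g (ugen c)) -> f =1 g.
Proof.
move=> fg u; rewrite -(uprod_val u); have := uword0 u.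
elim: (val u) => [|c s IH]; first by rewrite uprod_nil !gmulf1.
rewrite inE negb_or eq_sym -lt0n uprod_cons => /andP[c0 s0].
by rewrite !gmulfM fg ?IH.
Qed.

(** * The planar order *)

Definition ccw (c d e : nat) := [|| c < d < e, d < e < c | e < c < d].

(* The universal group acts on a planar tree; around each vertex the edges    *)
(* come in the cyclic order 0, 1, 2, ..., the edge 0 carrying a leaf. ult c   *)
(* compares the leaves u and v seen from the edge c: they are ordered where   *)
(* the two paths part.                                                        *)
Fixpoint ult c (u v : seq nat) : bool :=
  match u, v with
  | d :: u', e :: v' => if d == e then ult d u' v' else ccw c d e
  | _, _ => ccw c (head 0 u) (head 0 v)
  end.

Lemma ult_cat c p u v : ult c (p ++ u) (p ++ v) = ult (last c p) u v.
Proof. by elim: p c => //= d p IH c; rewrite eqxx. Qed.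

Lemma ult_head c u v :
  head 0 u != head 0 v -> ult c u v = ccw c (head 0 u) (head 0 v).
Proof. by case: u v => [|d u] [|e v] //= /negbTE ->. Qed.

Lemma reduced_catP p u :
  reduced (p ++ u) = [&& reduced p, reduced u & (last 0 p != head 0 u) || nilp p || nilp u].
Proof.
elim: p => [|c p IH] //=; first by rewrite orbT andbT.
rewrite !reduced_cons IH; case: p {IH} => [|d p] /=; last by rewrite /nilp /= !andbA.
by case: c => [|c] //; case: u => [|d u] //=; rewrite /nilp /= orbT andbT !orbF andbC.
Qed.

Lemma reduced_catl p u : reduced (p ++ u) -> reduced p.
Proof. by rewrite reduced_catP => /and3P[]. Qed.
Lemma reduced_catr p u : reduced (p ++ u) -> reduced u.
Proof. by rewrite reduced_catP => /and3P[]. Qed.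

(** The default 0 of [head] is the edge of the leaf, so a word that is a prefix of the other also
    parts from it. *)
Lemma branching (u v : seq nat) : reduced u -> reduced v -> u <> v ->
  exists p g h, [/\ u = p ++ g, v = p ++ h & head 0 g != head 0 h].
Proof.
elim: u v => [|c u IH] [|d v] //=.
- by move=> _; rewrite reduced_cons => /andP[d0 _] _; exists [::], [::], (d :: v); rewrite /= eq_sym -lt0n.
- by rewrite reduced_cons => /andP[d0 _] _ _; exists [::], (c :: u), [::]; rewrite /= -lt0n.
case: (c =P d) => [<-|/eqP cd _ _ _]; last by exists [::], (c :: u), (d :: v).
rewrite !reduced_cons => /and3P[_ _ ru] /and3P[_ _ rv] uv.
case: (IH v ru rv) => [e|p [g [h [-> -> gh]]]]; first by rewrite e in uv.
by exists (c :: p), g, h.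
Qed.

Lemma uval_mulV (p y g : seq nat) :
    reduced (p ++ y) -> reduced (p ++ g) -> head 0 y != head 0 g ->
  (uprod (p ++ y))^-1 * uprod (p ++ g) = rev y ++ g :> seq nat.
Proof.
move=> ry rg yg; have {ry rg} [ry rg] := (reduced_catr ry, reduced_catr rg).
rewrite !uprod_cat invgM mulgA mulgVK -uprod_rev uval_cat !uprod_reduced ?reduced_rev //.
rewrite reduced_catP reduced_rev ry rg /=.
by case: y yg {ry} => [|c y]; rewrite ?orbT //= rev_cons last_rcons => ->.
Qed.

(** * Braid generators on the universal Coxeter group and the order of leaves *)

Section Sigma.
Variable a : nat.
Hypothesis a0 : 0 < a.
Let b := a.+1.
Let ab : (a == b) = false. Proof. by rewrite ltn_eqF. Qed.
Let ba : (b == a) = false. Proof. by rewrite gtn_eqF. Qed.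

Definition usig_img c : uword :=
  if c == a then ugen a * ugen b * ugen a else if c == b then ugen a else ugen c.
Definition usigV_img c : uword :=
  if c == a then ugen b else if c == b then ugen b * ugen a * ugen b else ugen c.

Lemma usig_imgK c : usig_img c * usig_img c = 1.
Proof.
rewrite /usig_img; case: eqP => _; last by case: eqP => _; rewrite ugenK.
by rewrite -!mulgA (mulgA (ugen a) (ugen a)) ugenK mul1g (mulgA (ugen b)) ugenK mul1g ugenK.
Qed.
Lemma usigV_imgK c : usigV_img c * usigV_img c = 1.
Proof.
rewrite /usigV_img; case: eqP => _; first by rewrite ugenK.
case: eqP => _; last by rewrite ugenK.
by rewrite -!mulgA (mulgA (ugen b) (ugen b)) ugenK mul1g (mulgA (ugen a)) ugenK mul1g ugenK.
Qed.
Lemma ugen0 : ugen 0 = 1. Proof. exact: val_inj. Qed.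
Lemma usig_img0 : usig_img 0 = 1.
Proof. by rewrite /usig_img ltn_eqF // ugen0. Qed.
Lemma usigV_img0 : usigV_img 0 = 1.
Proof. by rewrite /usigV_img ltn_eqF // ugen0. Qed.

Definition usig : group_hom uword uword := ulift usig_imgK usig_img0.
Definition usigV : group_hom uword uword := ulift usigV_imgK usigV_img0.

Lemma usig_gen c : usig (ugen c) = usig_img c.
Proof. exact: ulift_gen. Qed.
Lemma usigV_gen c : usigV (ugen c) = usigV_img c.
Proof. exact: ulift_gen. Qed.

Lemma usigVK : cancel usigV usig.
Proof.
pose h : group_hom uword uword := usig \o usigV.
pose id' : group_hom uword uword := idfun.
apply: (@uhom_ext _ h id') => c _; rewrite -[LHS]/(usig (usigV _)) -[RHS]/(ugen c) usigV_gen /usigV_img.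
case: eqP => [->|/eqP/negbTE ca]; first by rewrite usig_gen /usig_img ba eqxx.
case: eqP => [->|/eqP/negbTE cb]; last by rewrite usig_gen /usig_img ca cb.
rewrite !gmulfM !usig_gen /usig_img ba !eqxx !mulgA ugenK mul1g.
by rewrite -!mulgA ugenK mulg1.
Qed.

Definition ucls (w : seq nat) :=
  if (head 0 w == a) && (head 0 (behead w) != b) then b else head 0 w.

(** Ping-pong: the image of the letter [c] moves everything outside the class [c] into the class
    [c]. *)
Lemma ucls_mul c (x : uword) :
  0 < c -> ucls x != c -> ucls (usig_img c * x : uword) = c.
Proof.
move=> c0; have := uvalP x; rewrite /usig_img; case: (c =P a) => [->|/eqP ca]; last case: (c =P b) => [->|/eqP cb].
- rewrite -!mulgA !uval_mul /= a0 /=.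
  case: (uval x) => [|d w] /=; rewrite /ucls /=; first by rewrite ba /= ab /= !eqxx.
  rewrite reduced_cons; case: (a =P d) => [<-|/eqP ad] /and3P[_ dw _] /=; last by rewrite ba /= ab /= !eqxx.
  rewrite eqxx; case: w dw => [|f w] /=; first by rewrite ab !eqxx.
  by case: (b =P f) => [<-|/eqP bf]; rewrite ?eqxx /= ?eqxx ?ab /= ?eqxx /=.
- rewrite !uval_mul /= a0 /=.
  case: (uval x) => [|d w] /=; rewrite /ucls /=; first by rewrite eqxx.
  rewrite reduced_cons; case: (a =P d) => [<-|/eqP ad] /and3P[_ dw _] /=.
    by case: w dw => [|f w] /=; rewrite !eqxx //=; case: (f =P b) => [->|/eqP bf]; rewrite ?eqxx // ba.
  by rewrite eqxx (eq_sym d) (negbTE ad) /= => ->.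
- rewrite uval_mul /= c0 /=.
  case: (uval x) => [|d w] /=; rewrite /ucls /=; first by rewrite (negbTE ca).
  by case: (c =P d) => [<-|/eqP cd] /=; rewrite (negbTE ca) ?eqxx.
Qed.

(* sigma maps the branch at a into the branch ab, the branch at b into the    *)
(* rest of the branches a and b, and every other branch into itself.          *)
Lemma ucls_usig u : ucls (usig u) = head 0 u.
Proof.
rewrite -(uprod_val u); have := uvalP u; elim: (val u) => [|c s IH] r.
  by rewrite uprod_nil gmulf1 /ucls uval1 /= ltn_eqF.
move: (r); rewrite reduced_cons => /and3P[c0 cs rs].
rewrite [RHS](_ : _ = c); last by rewrite (uprod_reduced r).
rewrite uprod_cons gmulfM usig_gen; apply: ucls_mul => //.
by rewrite IH // uprod_reduced // eq_sym.
Qed.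

(** Each class of [ucls] is an arc of leaves: seen counterclockwise, the branch at [a] begins with
    its sub-branch at [b], and the rest of it is adjacent to the branch at [b]. Three leaves in
    distinct arcs are therefore ordered as the arcs are. Translating by [y^-1] makes [y] the leaf
    from which one looks. *)
Lemma ult_cls (y g h : uword) :
    ucls y != ucls g -> ucls y != ucls h -> ucls g != ucls h ->
  ult 0 (y^-1 * g : uword) (y^-1 * h : uword) = ccw (ucls y) (ucls g) (ucls h).
Proof.
rewrite -(uprod_val y) -(uprod_val g) -(uprod_val h).
have := (uvalP y, uvalP g, uvalP h).
move: (val y) (val g) (val h) => {}y {}g {}h [[ry rg] rh]; rewrite !uprod_reduced //.
have [yg|yg] := eqVneq (head 0 y) (head 0 g); have [yh|yh] := eqVneq (head 0 y) (head 0 h).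
- by rewrite /ucls -yg -yh; do 3 case: (_ && _); rewrite ?eqxx.
- case: y g yg ry rg yh => [|d y] [|e g] //= yg ry rg yh.
  + by rewrite eqxx.
  + by rewrite -yg in rg.
  + by rewrite yg in ry.
  rewrite -yg in rg *.
  have [yg'|yg'] := eqVneq (head 0 y) (head 0 g); first by rewrite /ucls /= yg' eqxx.
  rewrite (@uval_mulV [:: d] y g) // (@uval_mulV [::] (d :: y) h) //= rev_cons cat_rcons ult_cat.
  rewrite ult_head; last by move: rg; rewrite reduced_cons /= => /and3P[_]; rewrite eq_sym.
  move: ry rg; rewrite !reduced_cons => /and3P[d0 dy ry] /and3P[_ dg rg].
  have -> : last 0 (rev y) = head 0 y by rewrite -{1}[y]revK; case: y {ry dy yh yg'} => //= ? ?; rewrite revK rev_cons last_rcons.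
  rewrite /ucls /= /ccw /b; move: (head 0 (behead h)) (head 0 h) (head 0 g) (head 0 y) dy dg yg' yh.
  by move=> h1 h0 g0 y0 dy dg yg' yh; do !case: ifP; lia.
- case: y h yh ry rh yg => [|d y] [|e h] //= yh ry rh yg.
  + by rewrite eqxx.
  + by rewrite -yh in rh.
  + by rewrite yh in ry.
  rewrite -yh in rh *.
  have [yh'|yh'] := eqVneq (head 0 y) (head 0 h); first by rewrite /ucls /= yh' eqxx.
  rewrite (@uval_mulV [::] (d :: y) g) // (@uval_mulV [:: d] y h) //= rev_cons cat_rcons ult_cat.
  rewrite ult_head; last by move: rh; rewrite reduced_cons /= => /and3P[_].
  move: ry rh; rewrite !reduced_cons => /and3P[d0 dy ry] /and3P[_ dh rh].
  have -> : last 0 (rev y) = head 0 y by rewrite -{1}[y]revK; case: y {ry dy yg yh'} => //= ? ?; rewrite revK rev_cons last_rcons.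
  rewrite /ucls /= /ccw /b; move: (head 0 (behead g)) (head 0 g) (head 0 h) (head 0 y) dy dh yh' yg.
  by move=> g1 g0 h0 y0 dy dh yh' yg; do !case: ifP; lia.
rewrite (@uval_mulV [::] y g) // (@uval_mulV [::] y h) // ult_cat.
have -> : last 0 (rev y) = head 0 y by rewrite -{1}[y]revK; case: y {ry yg yh} => //= ? ?; rewrite revK rev_cons last_rcons.
have [gh|gh] := eqVneq (head 0 g) (head 0 h); last first.
  rewrite ult_head // /ucls /b; move: (head 0 (behead _)) (head 0 (behead _)) (head 0 (behead _)).
  by move: (head 0 y) (head 0 g) (head 0 h) yg yh gh => y0 g0 h0 yg yh gh y1 g1 h1; rewrite /ccw; do !case: ifP; lia.
case: g h gh rg rh yg yh => [|d g] [|e h] //= gh rg rh yg yh.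
- by rewrite !eqxx.
- by rewrite -gh in rh.
- by rewrite gh in rg.
rewrite gh eqxx; rewrite -gh in rh *.
have [gh'|gh'] := eqVneq (head 0 g) (head 0 h); first by rewrite /ucls /= gh' eqxx.
rewrite ult_head //.
move: rg rh; rewrite !reduced_cons => /and3P[d0 dg rg] /and3P[_ dh rh].
rewrite /ucls /= /ccw /b; move: (head 0 (behead y)) (head 0 g) (head 0 h) (head 0 y) dg dh gh' yg.
by move=> y1 g0 h0 y0 dg dh gh' yg; do !case: ifP; lia.
Qed.

(** Moving the point where [u] and [v] part to the root turns the leaves 1, [u], [v] into three
    leaves that leave the root by distinct edges. These edges are the classes of the images
    ([ucls_usig]), so [ult_cls] gives the same order before and after. *)
Lemma usig_ult (u v : uword) : u != 1 -> v != 1 -> u != v ->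
  ult 0 (usig u) (usig v) = ult 0 u v.
Proof.
move=> u1 v1 uv.
have uv' : uval u <> uval v by move=> e; move: uv; rewrite (uval_inj e) eqxx.
have [p [g [h [eu ev gh]]]] := branching (uvalP u) (uvalP v) uv'.
have ru : reduced (p ++ g) by rewrite -eu uvalP.
have rv : reduced (p ++ h) by rewrite -ev uvalP.
have u0 : 0 < head 0 u.
  move: u1; rewrite uval_eqE; case: (uval u) (uvalP u) => [|c s] //=; by rewrite reduced_cons => /andP[].
have v0 : 0 < head 0 v.
  move: v1; rewrite uval_eqE; case: (uval v) (uvalP v) => [|c s] //=; by rewrite reduced_cons => /andP[].
have Eu : usig u = (usig (uprod (rev p)))^-1 * usig (uprod g).
  by rewrite -gmulfV -gmulfM uprod_rev invgK -uprod_cat -eu uprod_val.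
have Ev : usig v = (usig (uprod (rev p)))^-1 * usig (uprod h).
  by rewrite -gmulfV -gmulfM uprod_rev invgK -uprod_cat -ev uprod_val.
have hp : head 0 (uprod (rev p)) = last 0 p.
  rewrite uprod_reduced ?reduced_rev ?(reduced_catl ru) //.
  by case/lastP: p {eu ev ru rv Eu Ev} => //= p c; rewrite rev_rcons last_rcons.
have hg : head 0 (uprod g) = head 0 g by rewrite uprod_reduced ?(reduced_catr ru).
have hh : head 0 (uprod h) = head 0 h by rewrite uprod_reduced ?(reduced_catr rv).
(* For empty [p] the default 0 is the edge of the leaf 1. *)
have pg : last 0 p != head 0 g.
  case/lastP: p eu {ev ru rv Eu Ev hp} (ru) => [/= <- _|p c _]; first by rewrite eq_sym -lt0n.
  rewrite last_rcons reduced_catP last_rcons => /and3P[rp _].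
  case: (g) => [|d s]; last by rewrite orbF => /orP[]//; rewrite /nilp size_rcons.
  by move=> _ /=; move: rp; rewrite -reduced_rev rev_rcons reduced_cons -lt0n => /andP[].
have ph : last 0 p != head 0 h.
  case/lastP: p ev {eu ru rv Eu Ev hp pg} (rv) => [/= <- _|p c _]; first by rewrite eq_sym -lt0n.
  rewrite last_rcons reduced_catP last_rcons => /and3P[rp _].
  case: (h) => [|d s]; last by rewrite orbF => /orP[]//; rewrite /nilp size_rcons.
  by move=> _ /=; move: rp; rewrite -reduced_rev rev_rcons reduced_cons -lt0n => /andP[].
rewrite Eu Ev ult_cls !ucls_usig ?hp ?hg ?hh //.
by rewrite eu ev ult_cat ult_head.
Qed.

End Sigma.

(* The geodesic from the leaf 1 to the leaf g does not cross its translates. *)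
Definition noncrossing (g : uword) := forall h : uword,
  h != 1 -> h != g -> h * g != 1 -> ult 0 h g = ult 0 (h * g : uword) g.

Lemma usig_inj a (a0 : 0 < a) (x y : uword) : (usig a0 x == usig a0 y) = (x == y).
Proof.
apply/eqP/eqP => [e|->//]; have := ucls_usig a0 (x^-1 * y).
rewrite gmulfM gmulfV e mulVg /ucls uval1 /= ltn_eqF //=.
case E : (uval _) (uvalP (x^-1 * y : uword)) => [|c s].
  by move=> _ _; rewrite -[x]mulg1 -(mulVKg x y); congr (_ * _); exact/esym/uval_inj.
by rewrite reduced_cons => /andP[c0 _] /= e'; rewrite -e' in c0.
Qed.

Lemma usig_eq1 a (a0 : 0 < a) (x : uword) : (usig a0 x == 1) = (x == 1).
Proof. by rewrite -(usig_inj a0 x 1) gmulf1. Qed.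

(** The automorphism keeps the order of leaves and permutes the elements [h] over which the
    definition ranges. *)
Lemma noncrossing_usig a (a0 : 0 < a) (g : uword) :
  g != 1 -> noncrossing (usig a0 g) <-> noncrossing g.
Proof.
move=> g1; have key h : h != 1 -> h != g -> h * g != 1 ->
    (ult 0 (usig a0 h) (usig a0 g) = ult 0 (usig a0 h * usig a0 g : uword) (usig a0 g)) <->
    (ult 0 h g = ult 0 (h * g : uword) g).
  move=> h1 hg hg1; rewrite -gmulfM !usig_ult //.
  by rewrite -[X in _ != X](mul1g g); apply: contra h1 => /eqP /mulIg ->.
split=> ncg h.
  by move=> h1 hg hg1; apply/key => //; apply: ncg; rewrite -?gmulfM ?usig_inj ?usig_eq1.
rewrite -(usigVK a0 h); move: (usigV a0 h) => {}h.
by rewrite -gmulfM !usig_eq1 usig_inj => h1 hg hg1; rewrite gmulfM; apply/key => //; apply: ncg.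
Qed.

Definition rmulc c (w : seq nat) :=
  if last 0 w == c then take (size w).-1 w else rcons w c.

Lemma uval_mul_gen (h : uword) c : 0 < c -> (h * ugen c : uword) = rmulc c h :> seq nat.
Proof.
move=> c0; rewrite -[h * ugen c]invgK invgM ugenV uvalV uval_mul uvalV /= c0 /=.
rewrite /rmulc; case/lastP: (uval h) => [|w d]; first by rewrite /= ltn_eqF.
rewrite rev_rcons /= last_rcons eq_sym size_rcons /= -cats1 take_size_cat //.
by case: eqP => _; rewrite ?revK // !rev_cons revK cats1.
Qed.

Lemma rmulc_cat c p s : s != [::] -> rmulc c (p ++ s) = p ++ rmulc c s.
Proof.
case: s => // d s _; rewrite /rmulc last_cat /=; case: ifP => _; last by rewrite rcons_cat.
by rewrite size_cat addnS /= take_cat ltnNge leq_addr addKn.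
Qed.

Lemma rmulc_nil c s : 1 < size s -> rmulc c s != [::].
Proof. by case: s => [|d [|e s]] // _; rewrite /rmulc; case: ifP. Qed.

(** A path to a leaf [[:: a; b]] has been left after three letters at the latest, which reduces the
    check below to short words. *)
Lemma ult_prefix3 a b (p s s' : seq nat) : 2 < size p ->
  ult 0 (p ++ s) [:: a; b] = ult 0 (p ++ s') [:: a; b].
Proof.
by case: p => [|d [|e [|f p]]] //= _; do !case: ifP.
Qed.

Lemma noncrossing_gen c : 0 < c -> noncrossing (ugen c).
Proof.
move=> c0 h; rewrite !uval_eqE uval_mul_gen // uval_gen // uval1.
case: (uval h) (uvalP h) => [|d [|e [|f s]]] // r; rewrite /rmulc /=.
- by rewrite eqseq_cons andbT => _ /negbTE dc _; rewrite dc /= dc.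
- move=> _ _ _; case: (e =P c) r => [->|_ _] //= r.
  by move: r; rewrite reduced_cons /= => /and3P[_ /negbTE -> _].
- by move=> _ _ _; case: (last f s == c).
Qed.

(** The base case for doubled strands, as [noncrossing_gen] is for simple ones. *)
Lemma noncrossing_gen2 a : 0 < a -> noncrossing (ugen a * ugen a.+1).
Proof.
move=> a0 h; have ab : (a.+1 == a) = false by apply: gtn_eqF.
have e2 : (ugen a * ugen a.+1 : uword) = [:: a; a.+1] :> seq nat.
  by rewrite uval_mul_gen // uval_gen // /rmulc /= ltn_eqF.
rewrite !uval_eqE mulgA e2 !uval_mul_gen // uval1.
case: (uval h) (uvalP h) => [|d [|e [|f [|g [|k s]]]]] r.
(* With at least five letters, right multiplication by two generators does not reach the first
   three. *)
6: {
  move=> _ _ _; rewrite -[[:: d, e, f, g, k & s]]/([:: d; e; f] ++ [:: g, k & s]).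
  by rewrite !rmulc_cat ?rmulc_nil //; apply: ult_prefix3. }
all: move: r; rewrite ?reduced_cons /rmulc /= ?eqseq_cons ?andbT /=; move: ab.
all: by do !(case: ifP => //=; rewrite ?last_rcons ?eqseq_cons /=); rewrite /ccw; lia.
Qed.

(* Two subpaths of the geodesic that run along a common path v and part at    *)
(* both of its ends stay on their sides.                                      *)
Lemma crossing (g : uword) (p v s p' s' : seq nat) : noncrossing g ->
    g = p ++ v ++ s :> seq nat -> g = p' ++ v ++ s' :> seq nat ->
    last 0 p != last 0 p' -> head 0 s != head 0 s' ->
    last 0 p' != head 0 (v ++ s) -> last 0 (p ++ v) != head 0 s' ->
  ccw (last 0 p) (last 0 p') (head 0 (v ++ s)) =
  ccw (last 0 (p ++ v)) (head 0 s') (head 0 s).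
Proof.
move=> ncg eg eg' px sy xv bv.
have rg : reduced (p ++ v ++ s) by rewrite -eg uvalP.
have rg' : reduced (p' ++ v ++ s') by rewrite -eg' uvalP.
have rh : reduced (p ++ rev p').
  rewrite reduced_catP (reduced_catl rg) reduced_rev (reduced_catl rg') /=.
  by case/lastP: (p') px => [|q c]; rewrite ?orbT // rev_rcons last_rcons /= => ->.
have rhg : reduced (p ++ v ++ s').
  rewrite catA reduced_catP (reduced_catr (reduced_catr rg')) bv !andbT.
  by rewrite catA in rg; rewrite (reduced_catl rg).
(* The translation by [uprod p * (uprod p')^-1] carries the occurrence of [v] after [p'] onto the
   one after [p]. *)
have eh : (uprod p * (uprod p')^-1 : uword) = p ++ rev p' :> seq nat.
  by rewrite -uprod_rev -uprod_cat uprod_reduced.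
have ehg : (uprod p * (uprod p')^-1 * g : uword) = p ++ v ++ s' :> seq nat.
  by rewrite -(uprod_val g) eg' uprod_cat mulgA mulgVK -uprod_cat uprod_reduced.
have hx : head 0 (rev p') = last 0 p'.
  by case/lastP: (p') => [|q c] //; rewrite rev_rcons last_rcons.
have := ncg (uprod p * (uprod p')^-1); rewrite !uval_eqE eh ehg eg uval1.
rewrite ult_cat ult_head ?hx // !catA ult_cat ult_head 1?eq_sym // => -> //.
- by case: (p) (p') px => [|c q] //; case/lastP => // q c; rewrite rev_rcons.
- rewrite -catA eqseq_cat // eqxx /=; apply: contra xv => /eqP e.
  by rewrite -hx e.
- by case: (p) bv => //; case: (v) => //; case: (s').
Qed.

(** * Alternating blocks *)

Fixpoint alt (c d n : nat) : seq nat := if n is n'.+1 then c :: alt d c n' else [::].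

Lemma size_alt c d n : size (alt c d n) = n.
Proof. by elim: n c d => //= n IH c d; rewrite IH. Qed.

Lemma alt_add c d m n :
  alt c d (m + n) = alt c d m ++ (if odd m then alt d c n else alt c d n).
Proof. by elim: m c d => //= m IH c d; rewrite IH; case: (odd m). Qed.

Lemma alt_rcons c d n : alt c d n.+1 = rcons (alt c d n) (if odd n then d else c).
Proof. by rewrite -addn1 alt_add; case: (odd n); rewrite cats1. Qed.

Lemma rev_alt c d n : rev (alt c d n) = if odd n then alt c d n else alt d c n.
Proof.
elim: n c d => // n IH c d; rewrite {1}[alt c d n.+1]/= rev_cons IH /=.
by rewrite -[c :: _]/(alt c d n.+1) -[d :: _]/(alt d c n.+1) !alt_rcons; case: (odd n).
Qed.

Lemma last_alt x c d n : last x (alt c d n.+1) = if odd n then d else c.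
Proof. by rewrite alt_rcons last_rcons. Qed.

Lemma mem_alt c d n : {subset alt c d n <= [:: c; d]}.
Proof.
elim: n c d => //= n IH c d x; rewrite inE => /orP[/eqP->|/IH]; first by rewrite inE eqxx.
by rewrite !inE orbC.
Qed.

Lemma alt_reduced c d n : 0 < c -> 0 < d -> c != d -> reduced (alt c d n).
Proof.
move=> + + +; elim: n c d => // n IH c d c0 d0 cd.
by rewrite [alt _ _ _]/= reduced_cons c0 IH ?(eq_sym d) // andbT; case: n {IH} => //=; rewrite -lt0n.
Qed.

Definition pairq (c d c' d' : nat) :=
  (c' == c) && (d' == d) || (c' == d) && (d' == c).

Lemma pairq_refl c d : pairq c d c d. Proof. by rewrite /pairq !eqxx. Qed.

Lemma pairqP c d c' d' :
  reflect ((c' = c /\ d' = d) \/ (c' = d /\ d' = c)) (pairq c d c' d').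
Proof.
apply: (iffP orP) => [[]/andP[/eqP-> /eqP->]|[][-> ->]]; rewrite ?eqxx; by [left|right].
Qed.

Definition block (t p : seq nat) (c d L : nat) (s : seq nat) :=
  [/\ t = p ++ alt c d L ++ s, last 0 p \notin [:: c; d] & head 0 s \notin [:: c; d]].

(* The sign of an end of a block is the side of the pair {c, d} on which the  *)
(* path leaves it, read off from the first (last) letter. A block is          *)
(* essential if both signs agree: then the path separates c from d.           *)
Definition rsign (c d L b : nat) := if odd L then ccw c d b else ccw d c b.
Definition essential (c d L a b : nat) := ccw c d a == rsign c d L b.

Lemma ccwN c d a : c != d -> a \notin [:: c; d] -> ccw d c a = ~~ ccw c d a.
Proof. by rewrite !inE /ccw; lia. Qed.

Lemma block_rev t p c d L s : block t p c d L s ->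
  block (rev t) (rev s) (if odd L then c else d) (if odd L then d else c) L (rev p).
Proof.
case=> -> ap bs; split; first by rewrite !rev_cat rev_alt -catA; case: (odd L).
  case: s bs => [|b s]; rewrite ?rev_cons ?last_rcons //=; case: (odd L) => //.
    by rewrite !inE orbC.
  by rewrite !inE orbC.
case/lastP: p ap => [|p a]; rewrite ?rev_rcons ?last_rcons //=; case: (odd L) => //.
  by rewrite !inE orbC.
by rewrite !inE orbC.
Qed.

Section Blocks.
Variable g : uword.
Hypothesis ncg : noncrossing g.
Variables c d : nat.
Hypothesis cd : c != d.

(** One passage enters [c] from outside and goes on to [d], the other comes from [d] and leaves
    after [c]; [crossing] is applied to the common path [[:: c]]. *)
Lemma end_signs p s L p' s' L' : 1 < L -> 1 < L' ->
    g = p ++ alt c d L ++ s :> seq nat -> g = p' ++ rev (alt c d L') ++ s' :> seq nat ->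
    last 0 p \notin [:: c; d] -> head 0 s' \notin [:: c; d] ->
  ccw c d (last 0 p) = ccw c d (head 0 s').
Proof.
case: L => [|[|L]] //; case: L' => [|[|L']] // _ _ e e' pcd scd.
have e1 : g = p ++ [:: c] ++ (alt d c L.+1 ++ s) :> seq nat by rewrite e.
have e2 : g = (p' ++ rev (alt d c L'.+1)) ++ [:: c] ++ s' :> seq nat.
  by rewrite e' [alt c d _]/= rev_cons -cats1 -!catA.
have := crossing ncg e1 e2; rewrite !last_cat [alt d c _]/= rev_cons last_rcons /=.
move: pcd scd cd; rewrite !inE; move: (last 0 p) (head 0 s') => a b acd bcd cd' H.
by have := H; rewrite /ccw; lia.
Qed.

(** As [end_signs], with common path [[:: c; d]]; length 3 provides one more letter of the pair on
    the inner side of each passage. *)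
Lemma end_signs' p s L p' s' L' : 2 < L -> 2 < L' ->
    g = p ++ alt c d L ++ s :> seq nat -> g = p' ++ rev (alt d c L') ++ s' :> seq nat ->
    last 0 p \notin [:: c; d] -> head 0 s' \notin [:: c; d] ->
  ccw c d (last 0 p) = ccw d c (head 0 s').
Proof.
case: L => [|[|[|L]]] //; case: L' => [|[|[|L']]] // _ _ e e' pcd scd.
have e1 : g = p ++ [:: c; d] ++ (alt c d L.+1 ++ s) :> seq nat by rewrite e.
have e2 : g = (p' ++ rev (alt d c L'.+1)) ++ [:: c; d] ++ s' :> seq nat.
  by rewrite e' [alt d c _]/= !rev_cons -!cats1 -!catA.
have := crossing ncg e1 e2; rewrite !last_cat [alt d c _]/= rev_cons last_rcons /=.
move: pcd scd cd; rewrite !inE; move: (last 0 p) (head 0 s') => a b acd bcd cd' H.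
by have := H; rewrite /ccw; lia.
Qed.

End Blocks.

Lemma rsignE c d L b : rsign c d L b =
  ccw (if odd L then c else d) (if odd L then d else c) b.
Proof. by rewrite /rsign; case: (odd L). Qed.

Section Window.
Variable g : uword.
Hypothesis ncg : noncrossing g.
Variables c d : nat.
Hypothesis cd : c != d.

Lemma lsign_rsign p s L p' c' d' s' L' : 2 < L -> 2 < L' ->
    block g p c d L s -> pairq c d c' d' -> block g p' c' d' L' s' ->
  ccw c d (last 0 p) = rsign c' d' L' (head 0 s').
Proof.
move=> L2 L2' [e a' _] cd' [e' _ b']; rewrite rsignE.
have e2 : g = p' ++ rev (alt (if odd L' then c' else d') (if odd L' then d' else c') L') ++ s' :> seq nat.
  by rewrite e' rev_alt; case: (odd L').
have {}b' : head 0 s' \notin [:: c; d].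
  by move: b'; rewrite !inE; move/pairqP: cd' => [][-> ->] //; rewrite orbC.
move/pairqP: cd' e2 => [][-> ->]; case: (odd L') => e2.
- by apply: (end_signs ncg cd _ _ e e2) => //; apply: ltnW.
- exact: (end_signs' ncg cd _ _ e e2).
- exact: (end_signs' ncg cd _ _ e e2).
- by apply: (end_signs ncg cd _ _ e e2) => //; apply: ltnW.
Qed.

(** The left end of the block is compared with its own right end. *)
Lemma long_essential p s L : 2 < L -> block g p c d L s ->
  essential c d L (last 0 p) (head 0 s).
Proof.
by move=> L2 B; apply/eqP/(lsign_rsign L2 L2 B (pairq_refl _ _) B).
Qed.

(** A block at least three letters longer contains a copy of the shorter one with a letter of the
    pair on either side. The shorter passage would then leave this copy on different sides, which
    [crossing] forbids if it is essential. *)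
Lemma essential_length p s L p' c' d' s' L' :
    g = p ++ alt c d L ++ s :> seq nat -> pairq c d c' d' ->
    block g p' c' d' L' s' -> essential c' d' L' (last 0 p') (head 0 s') ->
  L <= L'.+2.
Proof.
move=> e cd' [e' a' b'] ess; rewrite leqNgt; apply/negP => LL.
(* The copy starts at the second or third letter, whichever is [c']. *)
pose k := if c' == c then 2 else 1%N.
have kL : L = k + (L' + (L - L' - k)) by rewrite /k; case: ifP; lia.
have n0 : 0 < L - L' - k by rewrite /k; case: ifP; lia.
move: (L - L' - k) kL n0 => n eL n0.
have e1 : g = (p ++ alt c d k) ++ alt c' d' L' ++ ((if odd L' then alt d' c' n else alt c' d' n) ++ s) :> seq nat.
  rewrite e eL alt_add (_ : (if odd k then _ else _) = alt c' d' (L' + n)).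
    by rewrite alt_add -!catA.
  by rewrite /k; move/pairqP: cd' => [][-> ->]; rewrite ?eqxx //= eq_sym (negbTE cd).
have lk : last 0 (p ++ alt c d k) = d'.
  rewrite last_cat /k; move/pairqP: cd' => [][-> ->]; rewrite ?eqxx //= eq_sym (negbTE cd) //.
have hn : head 0 ((if odd L' then alt d' c' n else alt c' d' n) ++ s) = if odd L' then d' else c'.
  by case: n n0 {eL e1} => // n _; case: (odd L').
have := crossing ncg e' e1; rewrite lk hn.
have cd2 : c' != d' by move/pairqP: cd' => [][-> ->] //; rewrite eq_sym.
move: ess a' b' cd2; rewrite /essential /rsign.
case: (L') => [|m]; rewrite /= ?cats0.
  move: (last 0 p') (head 0 s') => a b; rewrite !inE => E ? ? ? H.
  by move: E; have := H; rewrite /ccw; lia.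
rewrite last_cat -/(alt c' d' m.+1) last_alt.
move: (last 0 p') (head 0 s') => a b; case: (odd m); rewrite !inE /= => E ? ? ? H.
  by move: E; have := H; rewrite /ccw; lia.
by move: E; have := H; rewrite /ccw; lia.
Qed.

End Window.

Lemma pairq_sym c d c' d' : pairq c d c' d' = pairq c' d' c d.
Proof. by apply/pairqP/pairqP => [][][-> ->]; [left|right|left|right]. Qed.

Lemma pairq_swap c d c' d' : pairq c d c' d' = pairq c d d' c'.
Proof. by apply/pairqP/pairqP => [][][-> ->]; [right|left|right|left]. Qed.

(** The constraint on which all twisting rests: one twist must treat all essential blocks of the
    pair alike, and it may shorten or lengthen them only together. *)
Lemma window (g : uword) c d p s L p' c' d' s' L' : noncrossing g -> rev g = g :> seq nat ->
    c != d -> 3 < L -> block g p c d L s -> pairq c d c' d' ->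
    block g p' c' d' L' s' -> essential c' d' L' (last 0 p') (head 0 s') ->
  [/\ L <= L'.+2, L' <= L.+2 & ccw c d (last 0 p) = ccw c' d' (last 0 p')].
Proof.
move=> ncg pal cd L3 B cd' B' ess'.
have cd2 : c' != d' by move/pairqP: cd' => [][-> ->] //; rewrite eq_sym.
have [e _ _] := B; have [e' a' b'] := B'.
have LL := essential_length ncg cd e cd' B' ess'.
split=> //.
  apply: (essential_length ncg cd2 e' _ B); first by rewrite pairq_sym.
  exact: long_essential (ltnW L3) B.
case: (ltnP 2 L') => L2; first by rewrite (lsign_rsign ncg cd (ltnW L3) L2 B cd' B') -(eqP ess').
(* Length 2 is too short for [lsign_rsign]; [end_signs] still applies, in one of the two cases after
   reversing the palindrome. *)
have {LL L2} L2 : L' = 2 by lia.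
rewrite {L'}L2 in e' B' ess'.
move/pairqP: cd' ess' e' a' b' => [][-> ->]; rewrite /essential /rsign => /eqP E e' a' b'.
  have er : g = rev s' ++ rev (alt c d 2) ++ rev p' :> seq nat by rewrite -pal e' !rev_cat catA.
  have hp : head 0 (rev p') = last 0 p' by case/lastP: (p') => // q x; rewrite rev_rcons last_rcons.
  by rewrite (end_signs ncg cd _ _ e er) ?hp //; case: (B) => //; lia.
rewrite E; apply: (end_signs ncg cd _ _ e (p' := p') (L' := 2)) => //; first lia.
  by case: B.
by move: b'; rewrite !inE orbC.
Qed.

(** * The numbers game *)

Delimit Scope R_scope with Rr.

Section Chebyshev.
Local Open Scope R_scope.

(* A shifted Chebyshev sequence: ch (2 cos t) k.+1 = sin (k t) / sin t. *)
Fixpoint ch2 (c : R) (k : nat) : R * R :=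
  if k is k'.+1 then let p := ch2 c k' in (p.2, c * p.2 - p.1) else (-1, 0).
Definition ch c k := (ch2 c k).1.

Lemma ch_0 c : ch c 0 = -1. Proof. by []. Qed.
Lemma ch_1 c : ch c 1 = 0. Proof. by []. Qed.
Lemma ch_SS c k : ch c k.+2 = c * ch c k.+1 - ch c k. Proof. by []. Qed.

Lemma ch_two k : ch 2 k.+1 = INR k.
Proof.
suff : ch 2 k.+1 = INR k /\ ch 2 k.+2 = INR k.+1 by case.
elim: k => [|k [IH1 IH2]]; first by rewrite ch_SS ch_1 ch_0 /=; split=> //; lra.
by split=> //; rewrite ch_SS IH1 IH2 !S_INR; lra.
Qed.

Variable m : nat.
Hypothesis m5 : (5 <= m)%N.
Let t := PI / INR m.
Let c := 2 * cos t.

Let m_pos : 5 <= INR m.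
Proof. by rewrite -[5]/(IZR (Z.of_nat 5)) -INR_IZR_INZ; apply: le_INR; lia. Qed.

Let mt : INR m * t = PI.
Proof. by rewrite /t; field; lra. Qed.

Let t_pos : 0 < t.
Proof. by apply: Rdiv_lt_0_compat; [exact: PI_RGT_0 | lra]. Qed.

Lemma sin_multiple_pos k : (0 < k < m)%N -> 0 < sin (INR k * t).
Proof.
move=> /andP[k0 km].
have k0' : 0 < INR k by apply: lt_0_INR; lia.
have km' : INR k < INR m by apply: lt_INR; lia.
by apply: sin_gt_0; [nra | rewrite -mt; nra].
Qed.

Let sin_t : 0 < sin t.
Proof. by have := @sin_multiple_pos 1 ltac:(lia); rewrite /= Rmult_1_l. Qed.

Lemma ch_sin k : ch c k * sin t = sin ((INR k - 1) * t).
Proof.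
suff : ch c k * sin t = sin ((INR k - 1) * t) /\ ch c k.+1 * sin t = sin (INR k * t) by case.
elim: k => [|k [IH1 IH2]].
  rewrite ch_0 ch_1 /= (_ : (0 - 1) * t = - t); last lra.
  by rewrite sin_neg !Rmult_0_l sin_0; lra.
split; first by rewrite IH2 S_INR; congr sin; lra.
rewrite ch_SS (_ : _ * sin t = c * (ch c k.+1 * sin t) - ch c k * sin t); last lra.
rewrite IH2 IH1 /c (_ : INR k.+1 * t = INR k * t + t); last by rewrite S_INR; lra.
rewrite (_ : (INR k - 1) * t = INR k * t - t); last lra.
by rewrite sin_plus sin_minus; lra.
Qed.

Lemma ch_pos k : (0 < k < m)%N -> 0 < ch c k.+1.
Proof.
move=> km; have := ch_sin k.+1; rewrite S_INR (_ : INR k + 1 - 1 = INR k); last lra.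
by have := sin_multiple_pos km; have := sin_t; nra.
Qed.

Lemma ch_m : ch c m.+1 = 0.
Proof.
have := ch_sin m.+1; rewrite S_INR (_ : (INR m + 1 - 1) * t = PI); last by rewrite -mt; lra.
by rewrite sin_PI; have := sin_t; nra.
Qed.

Lemma ch_mS : ch c m.+2 = -1.
Proof.
have := ch_sin m.+2; rewrite !S_INR (_ : (INR m + 1 + 1 - 1) * t = t + PI); last by rewrite -mt; lra.
by rewrite neg_sin; have := sin_t; nra.
Qed.

Lemma ch_mP : ch c m = 1.
Proof. by have := ch_SS c m; rewrite ch_m ch_mS; lra. Qed.

(** The angle is at most pi / 4. The bound on the square feeds [pos_step] and [pos_step2], the
    strict bound 2 makes the form in [fires_braid] well defined. *)
Lemma cos_bounds : 2 <= c * c /\ 0 <= c < 2.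
Proof.
have tle : t <= PI / 4.
  by have := mt; have := m_pos; have := PI_RGT_0; nra.
have c1 : cos (PI / 4) <= cos t.
  have := PI_RGT_0 => H; case: (Rle_lt_or_eq_dec _ _ tle) => [lt|->]; last lra.
  by apply/Rlt_le/cos_decreasing_1; lra.
have c2 : cos t < 1.
  by rewrite -cos_0; apply: cos_decreasing_1; have := PI_RGT_0; lra.
have q : cos (PI / 4) * cos (PI / 4) = 1 / 2.
  have := sin2_cos2 (PI / 4); rewrite /Rsqr sin_cos_PI4; lra.
have q0 : 0 < cos (PI / 4) by apply: cos_gt_0; have := PI_RGT_0; lra.
by rewrite /c; nra.
Qed.

End Chebyshev.

Section NumbersGame.
(* The exponent 0 stands for infinity. *)
Variable m : nat -> nat -> nat.
Hypothesis m_sym : forall i j, m i j = m j i.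
Hypothesis m_ge : forall i j, i != j -> (m i j == 0) || (5 <= m i j).

Definition within (a k : nat) := (k == 0) || (a <= k).

Definition coef (i j : nat) : R :=
  (if m i j == 0%N then 2 else 2 * cos (PI / INR (m i j)))%Rr.

Lemma coef_sym i j : coef i j = coef j i.
Proof. by rewrite /coef m_sym. Qed.

Lemma coef_bounds i j : i != j -> (2 <= coef i j * coef i j)%Rr /\ (0 <= coef i j)%Rr.
Proof.
move/m_ge; rewrite /coef; case: eqP => [_ _|_ /= m5]; first by lra.
by have [? []] := cos_bounds m5.
Qed.

Lemma coef_pos i j a : i != j -> 0 < a -> within a.+1 (m i j) ->
  (0 < ch (coef i j) a.+1)%Rr.
Proof.
move/m_ge; rewrite /coef /within; case: eqP => [_ _ a0 _|_ /= m5 a0 am].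
  by rewrite ch_two; apply: lt_0_INR; lia.
by apply: ch_pos => //; rewrite a0.
Qed.

Lemma coef_nneg i j a : i != j -> within a (m i j) -> (0 <= ch (coef i j) a.+1)%Rr.
Proof.
move=> ij; case: a => [|a] am; first by rewrite ch_1; lra.
have [w|] := boolP (within a.+2 (m i j)); first by have := coef_pos ij (ltn0Sn a) w; lra.
move: am (m_ge ij); rewrite /within /coef; case: eqP => //= _ am m5.
rewrite -ltnNge ltnS => ma; have -> : a.+1 = m i j by apply/eqP; rewrite eqn_leq am ma.
by rewrite ch_m //; lra.
Qed.

Definition position := nat -> R.
(** Mozes' move, the dual of the geometric representation: from a positive position, the negative
    entries of [fires w p] mark the left descents of [w]. *)
Definition fire (i : nat) (p : position) : position := fun l =>
  if l == i then (- p i)%Rr else (p l + coef i l * p i)%Rr.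

Lemma fireK i : involutive (fire i).
Proof.
move=> p; apply: funext => l; rewrite /fire eqxx; case: eqP => [->|_]; lra.
Qed.

Definition fires (w : seq nat) (p : position) : position := foldr fire p w.

Lemma fires_cat u v p : fires (u ++ v) p = fires u (fires v p).
Proof. exact: foldr_cat. Qed.

Lemma fires_inj w : injective (fires w).
Proof. by elim: w => //= i w IH p q /(can_inj (fireK i))/IH. Qed.

(** [P] is the entry at the letter fired first, which is the last letter of the word. *)
Lemma fires_alt_ends x y a p : x != y ->
  let P := if odd a then p x else p y in let Q := if odd a then p y else p x in
  fires (alt x y a) p x = (- (ch (coef x y) a.+1 * P + ch (coef x y) a * Q))%Rr /\
  fires (alt x y a) p y = (ch (coef x y) a.+2 * P + ch (coef x y) a.+1 * Q)%Rr.
Proof.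
elim: a x y => [|a IH] x y xy /=; first by rewrite ch_SS ch_1 ch_0; split; lra.
have yx : y != x by rewrite eq_sym.
have [] := IH y x yx; rewrite /fires => Ey Ex; rewrite /fire eqxx (negbTE yx) Ey Ex (coef_sym y x).
rewrite (ch_SS _ a.+1) (ch_SS _ a).
by case: (odd a) => /=; split; lra.
Qed.

(** As long as the alternating word is at most m long, every fired entry is nonnegative, so the
    later firings can only raise the entry at [l]. *)
Lemma fires_alt_other x y a p l : x != y -> l != x -> l != y ->
    (0 < p x)%Rr -> (0 < p y)%Rr -> within a.+1 (m x y) ->
  (fire (if odd a then y else x) p l <= fires (alt x y a.+1) p l)%Rr.
Proof.
elim: a x y => [|a IH] x y xy lx ly px py am; first by rewrite /=; lra.
have yx : y != x by rewrite eq_sym.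
have am' : within a.+1 (m y x) by move: am; rewrite m_sym /within; lia.
have {IH} := IH y x yx ly lx py px am'.
rewrite [odd _]/= if_neg => H; apply: Rle_trans H _.
have -> : fires (alt x y a.+2) p l =
    (fires (alt y x a.+1) p l + coef x l * fires (alt y x a.+1) p x)%Rr.
  by rewrite -[alt x y _]/(x :: alt y x a.+1) /fires /= {1}/fire (negbTE lx).
have [_ ->] := fires_alt_ends a.+1 p yx; rewrite -(coef_sym x y).
have c0 := (coef_bounds lx).2; have c1 : (0 <= coef x l)%Rr by rewrite coef_sym.
have h1 := coef_nneg xy am; have h2 := @coef_nneg x y a.+1 xy ltac:(move: am; rewrite /within; lia).
set v := (_ * _ + _)%Rr; have v0 : (0 <= v)%Rr.
  have px' := Rlt_le _ _ px; have py' := Rlt_le _ _ py.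
  by rewrite /v; case: (odd _); apply: Rplus_le_le_0_compat; apply: Rmult_le_pos.
have := Rmult_le_pos _ _ c1 v0; lra.
Qed.

Lemma fires_alt_signs x y a p : x != y -> (0 < p x)%Rr -> (0 < p y)%Rr ->
    0 < a -> within a (m x y) ->
  (fires (alt x y a) p x < 0)%Rr /\
  (if a == m x y then fires (alt x y a) p y < 0 else 0 < fires (alt x y a) p y)%Rr.
Proof.
move=> xy px py a0 am; have [-> ->] := fires_alt_ends a p xy.
set P := if odd a then p x else p y; set Q := if odd a then p y else p x.
have P0 : (0 < P)%Rr by rewrite /P; case: (odd a).
have Q0 : (0 < Q)%Rr by rewrite /Q; case: (odd a).
have [E|aE] := eqVneq a (m x y).
  have m5 : 5 <= m x y by have := m_ge xy; rewrite -E; case: (a) a0.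
  have cE : coef x y = (2 * cos (PI / INR (m x y)))%Rr.
    by rewrite /coef; case: eqP => // e; rewrite e in m5.
  by rewrite E cE ch_m // ch_mP // ch_mS //; lra.
have am' : within a.+1 (m x y) by move: am; rewrite /within ltn_neqAle aE.
have h1 := coef_pos xy a0 am'; have h2 := @coef_nneg x y a.-1 xy ltac:(move: am; rewrite /within; lia).
have h3 := coef_nneg xy am'; rewrite prednK // in h2.
by split; [have := Rmult_lt_0_compat _ _ h1 P0; have := Rmult_le_pos _ _ h2 (Rlt_le _ _ Q0); lra
          |have := Rmult_lt_0_compat _ _ h1 Q0; have := Rmult_le_pos _ _ h3 (Rlt_le _ _ P0); lra].
Qed.

(** At [i] and [j] both sides are known from [fires_alt_ends]; any other entry is recovered from
    these two by a linear form that both moves preserve. *)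
Lemma fires_braid i j p : i != j -> m i j != 0 ->
  fires (alt i j (m i j)) p = fires (alt j i (m i j)) p.
Proof.
move=> ij m0; have ji : j != i by rewrite eq_sym.
have m5 : 5 <= m i j by move: (m_ge ij); rewrite (negbTE m0).
have cE : coef i j = (2 * cos (PI / INR (m i j)))%Rr by rewrite /coef (negbTE m0).
have [Ei Ej] := fires_alt_ends (m i j) p ij.
have [Fj Fi] := fires_alt_ends (m i j) p ji.
rewrite -(coef_sym i j) cE ch_m // ch_mP // ch_mS // in Ei Ej Fj Fi.
have Xi : fires (alt i j (m i j)) p i = fires (alt j i (m i j)) p i.
  by rewrite Ei Fi; case: (odd _); lra.
have Xj : fires (alt i j (m i j)) p j = fires (alt j i (m i j)) p j.
  by rewrite Ej Fj; case: (odd _); lra.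
apply: funext => l; have [->//|li] := eqVneq l i; have [->//|lj] := eqVneq l j.
have [_ [_ c2]] := cos_bounds m5; rewrite -cE in c2; have c0 := (coef_bounds ij).2.
pose e := (4 - coef i j * coef i j)%Rr; have e0 : (0 < e)%Rr by rewrite /e; nra.
(* A combination with these coefficients is invariant under both moves. *)
pose A := ((2 * coef i l + coef i j * coef j l) / e)%Rr.
pose B := ((2 * coef j l + coef i j * coef i l) / e)%Rr.
have HA : (2 * A - coef i j * B = coef i l)%Rr by rewrite /A /B /e; field; rewrite -/e; lra.
have HB : (2 * B - coef i j * A = coef j l)%Rr by rewrite /A /B /e; field; rewrite -/e; lra.
pose I (q : position) := (q l + A * q i + B * q j)%Rr.
have Ii q : I (fire i q) = I q.
  by rewrite /I /fire (negbTE li) (negbTE ji) eqxx -HA; lra.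
have Ij q : I (fire j q) = I q.
  by rewrite /I /fire (negbTE lj) (negbTE ij) eqxx (coef_sym j i) -HB; lra.
have Ia k : I (fires (alt i j k) p) = I p /\ I (fires (alt j i k) p) = I p.
  by elim: k => [|k [H1 H2]] //=; rewrite Ii Ij.
have [] := Ia (m i j); rewrite /I Xi Xj; lra.
Qed.

Lemma fires_flip c d L p : c != d -> m c d != 0 -> m c d <= L <= (m c d).*2 ->
  fires (alt c d L) p = fires (alt d c ((m c d).*2 - L)) p.
Proof.
move=> cd m0 /andP[mL Lm]; rewrite -(subnKC mL) in Lm *; move: (L - m c d) Lm => r.
rewrite -addnn leq_add2l subnDl => {mL L}; elim: r p => [|r IH] p rm.
  by rewrite addn0 subn0 fires_braid.
rewrite addnS alt_rcons -cats1 fires_cat IH ?(ltnW rm) //.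
rewrite -(subnSK rm) alt_rcons -cats1 fires_cat /=; congr (fires _ _).
rewrite (_ : (if odd (m c d + r) then d else c) = (if odd (m c d - r.+1) then c else d)) ?fireK //.
by rewrite oddB // oddD /=; case: (odd _); case: (odd r).
Qed.

End NumbersGame.

(** * Long pairs *)

Lemma alt_run r c d : reduced r -> 0 < c -> 0 < d -> c != d -> head 0 r != d ->
  exists L r', r = alt c d L ++ r' /\ head 0 r' \notin [:: c; d].
Proof.
elim: r c d => [|x r IH] c d rr c0 d0 cd hd.
  by exists 0, [::]; rewrite /= !inE !(eq_sym 0%N) negb_or -!lt0n c0 d0.
move: rr; rewrite reduced_cons => /and3P[x0 xr rr].
have [xc|xc] := eqVneq x c; last by exists 0, (x :: r); rewrite /= !inE (negbTE xc).
have dc : d != c by rewrite eq_sym.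
have hr : head 0 r != c by rewrite eq_sym -xc.
have [L [r' [-> H]]] := IH d c rr d0 c0 dc hr.
by exists L.+1, r'; rewrite xc; split=> //; move: H; rewrite !inE orbC.
Qed.

(** The alternating stretch is extended to the right, then to the left by the same argument in the
    reversed word. *)
Lemma block_ext t p c d L s : reduced t -> 0 < c -> 0 < d -> c != d -> 0 < L ->
    t = p ++ alt c d L ++ s ->
  exists p' c' d' L' s', [/\ block t p' c' d' L' s', pairq c d c' d' & L <= L'].
Proof.
have key t' p' c' d' L' s' : reduced t' -> 0 < c' -> 0 < d' -> c' != d' -> 0 < L' ->
    t' = p' ++ alt c' d' L' ++ s' -> exists n s1,
    t' = p' ++ alt c' d' (L' + n) ++ s1 /\ head 0 s1 \notin [:: c'; d'].
  case: L' => // L' rt c0 d0 cd _ e.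
  have rs : reduced s' by move: rt; rewrite e => /reduced_catr/reduced_catr.
  pose x := if odd L' then d' else c'; pose y := if odd L' then c' else d'.
  have hs : head 0 s' != x.
    move: rt; rewrite e => /reduced_catr; rewrite reduced_catP last_alt => /and3P[_ _].
    rewrite -/x eq_sym => /orP[/orP[]//|].
    by case: (s') => // _; rewrite /x /=; case: (odd L'); rewrite eq_sym -lt0n.
  have [n [s1 [es H]]] : exists n s1, s' = alt y x n ++ s1 /\ head 0 s1 \notin [:: y; x].
    by apply: alt_run => //; rewrite /x /y; case: (odd L'); rewrite // eq_sym.
  exists n, s1; split.
    by rewrite e alt_add es !catA /= -/(alt c' d' L'.+1) /x /y; case: (odd L').
  by move: H; rewrite /x /y; case: (odd L'); rewrite !inE // orbC.
move=> rt c0 d0 cd L0 e.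
have [n [s1 [{}e hs]]] := key _ _ _ _ _ _ rt c0 d0 cd L0 e.
pose o := odd (L + n); pose x := if o then c else d; pose y := if o then d else c.
have er : rev t = rev s1 ++ alt x y (L + n) ++ rev p.
  by rewrite e !rev_cat rev_alt -catA /x /y /o; case: (odd _).
have rr : reduced (rev t) by rewrite reduced_rev.
have [x0 [y0 xy]] : 0 < x /\ 0 < y /\ x != y by rewrite /x /y; case: (o); rewrite // eq_sym.
have [n2 [p1 [{}er hp]]] := key _ _ _ _ _ _ rr x0 y0 xy (ltn_addr n L0) er.
have B : block (rev t) (rev s1) x y (L + n + n2) p1.
  split=> //; have -> : last 0 (rev s1) = head 0 s1 by case: (s1) => // ? ?; rewrite rev_cons last_rcons.
  by move: hs; rewrite /x /y; case: (o); rewrite !inE // orbC.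
have := block_rev B; rewrite !revK => {}B.
do 5 eexists; split; first exact: B; last by rewrite -addnA leq_addr.
by rewrite /x /y; case: (odd _); case: (o); rewrite /pairq !eqxx // orbT.
Qed.

(** Four letters is the length from which [window] applies. *)
Definition long (t : seq nat) (c d : nat) :=
  (c != d) && (infix [:: c; d; c; d] t || infix [:: d; c; d; c] t).

Lemma long_sym t c d : long t c d = long t d c.
Proof. by rewrite /long eq_sym orbC. Qed.

Lemma long_pairq t c d c' d' : pairq c d c' d' -> long t c' d' = long t c d.
Proof. by move/pairqP => [][-> ->] //; exact: long_sym. Qed.

Lemma long_neq t c d : long t c d -> c != d. Proof. by case/andP. Qed.

Lemma long_mem t c d : long t c d -> c \in t /\ d \in t.
Proof.
by case/andP => _ /orP[]/infixP[p [s ->]]; rewrite !mem_cat !inE !eqxx ?orbT.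
Qed.

Lemma long_alt t p c d L s : c != d -> 3 < L -> t = p ++ alt c d L ++ s -> long t c d.
Proof.
move=> cd; case: L => [|[|[|[|n]]]] // _ ->; apply/andP; split=> //.
by apply/orP; left; apply/infixP; exists p, (alt c d n ++ s).
Qed.

Lemma long_block t c d : reduced t -> long t c d ->
  exists p c' d' L s, [/\ block t p c' d' L s, pairq c d c' d' & 3 < L].
Proof.
move=> rt /[dup]/long_mem[ct dt] /andP[cd H].
have pos x : x \in t -> 0 < x by move: rt => /andP[t0 _] xt; rewrite lt0n; apply: contraNneq t0 => <-.
have [c0 d0] := (pos _ ct, pos _ dt).
case/orP: H => /infixP[p [s e]].
  exact: (@block_ext t p c d 4 s).
have dc : d != c by rewrite eq_sym.
have [p' [c' [d' [L [s' [B q L3]]]]]] := @block_ext t p d c 4 s rt d0 c0 dc isT e.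
by exists p', c', d', L, s'; split=> //; move/pairqP: q => [][-> ->]; apply/pairqP; [right|left].
Qed.

Section LongPairs.
Variable g : uword.
Hypotheses (ncg : noncrossing g) (pal : rev g = g :> seq nat).
Let t : seq nat := g.

(** Lengths differ by at most two from that of a block of length at least 4. So stretches of length
    0 or 1 are never essential for a long pair, which gives [long_adjacent] and [long_flank]. *)
Lemma long_window i j p' c' d' s' L' : long t i j -> pairq i j c' d' ->
    block t p' c' d' L' s' -> essential c' d' L' (last 0 p') (head 0 s') ->
  1 < L'.
Proof.
move=> /[dup]/long_neq ij /(long_block (uvalP g))[p [c [d [L [s [B q L3]]]]]] q' B' ess.
have cd : c != d by move/pairqP: q => [][-> ->]; rewrite // eq_sym.
have cc : pairq c d c' d'.
  by rewrite pairq_sym; move/pairqP: q' => [][-> ->] in q *; move/pairqP: q => [][-> ->]; apply/pairqP; [left|right|right|left].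
by have [LL _ _] := window ncg pal cd L3 B cc B' ess; lia.
Qed.

Lemma long_flank i j x y p s : long t i j -> t = p ++ [:: x; i; y] ++ s ->
  x \notin [:: i; j] -> y \notin [:: i; j] -> ccw i j x != ccw i j y.
Proof.
move=> l e xi yi; apply/eqP => E.
have B : block t (rcons p x) i j 1 (y :: s) by split; rewrite ?last_rcons // e -cats1 -!catA.
by have := long_window l (pairq_refl i j) B; rewrite last_rcons /essential /rsign /= E eqxx => /(_ isT).
Qed.

Lemma long_adjacent i j x y p s : long t i j -> t = p ++ [:: x; y] ++ s ->
  x \notin [:: i; j] -> y \notin [:: i; j] -> ccw i j x = ccw i j y.
Proof.
move=> /[dup] /long_neq ij l e xi yi; apply/eqP/negPn/negP => E.
have B : block t (rcons p x) i j 0 (y :: s) by split; rewrite ?last_rcons // e -cats1 -!catA.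
have := long_window l (pairq_refl i j) B; rewrite last_rcons /essential /rsign /=.
by rewrite (ccwN ij yi); move: E; case: (ccw _ _ _); case: (ccw _ _ _) => //= _ /(_ isT).
Qed.

(** A second partner [k] would give [k i k], a letter [i] with both neighbours on the same side of
    the pair [i], [j]. *)
Lemma long_inj i j k : long t i j -> long t i k -> j = k.
Proof.
move=> lj lk; apply/eqP/negPn/negP => jk.
have ik := long_neq lk; have ij := long_neq lj.
have [p [s e]] : exists p s, t = p ++ [:: k; i; k] ++ s.
  case/andP: lk => _ /orP[]/infixP[p [s ->]].
    by exists (p ++ [:: i]), s; rewrite -catA.
  by exists p, ([:: i] ++ s).
have ki : k \notin [:: i; j] by rewrite !inE negb_or eq_sym ik eq_sym.
by have := long_flank lj e ki ki; rewrite eqxx.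
Qed.

(** The word contains [k] next to [l], and adjacent letters outside a long pair lie on the same side
    of it. *)
Lemma long_same_side i j k l : long t i j -> long t k l -> k \notin [:: i; j] ->
  ccw i j k = ccw i j l.
Proof.
move=> lij lkl ki.
have li : l \notin [:: i; j].
  rewrite !inE; apply/norP; split; apply/eqP => e; move: lkl ki; rewrite e long_sym !inE.
    by move=> /(long_inj lij) ->; rewrite eqxx orbT.
  by rewrite long_sym in lij; move=> /(long_inj lij) ->; rewrite eqxx.
case/andP: (lkl) => _ /orP[]/infixP[p [s e]].
  exact: (long_adjacent lij (p := p) (s := [:: k; l] ++ s)).
by apply/esym/(long_adjacent lij (p := p) (s := [:: l; k] ++ s)).
Qed.

Lemma long_not_flanked k k' y y' p s : long t k k' -> t = p ++ [:: y; k; y'] ++ s ->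
    y \notin [:: k; k'] -> y' \notin [:: k; k'] -> (y == y') || long t y y' -> False.
Proof.
move=> l e yk yk' H; have /eqP := long_flank l e yk yk'; apply.
by case/orP: H => [/eqP->//|H]; apply: long_same_side.
Qed.

End LongPairs.

(** * Descents *)

Section Descents.
Variable m : nat -> nat -> nat.
Hypothesis m_sym : forall i j, m i j = m j i.
Hypothesis m_ge : forall i j, i != j -> (m i j == 0) || (5 <= m i j).
Local Notation fire := (fire m).
Local Notation fires := (fires m).

(** Two bounds occur: m + 1, which shortening achieves, and 2m - 2, which twisting preserves and
    which leaves at least two letters to a block flipped by [fires_flip]. *)
Definition tame (k : nat -> nat) (t : seq nat) := forall p c d L s,
  block t p c d L s -> c != d -> m c d != 0 -> L <= k (m c d).

Variable g : uword.
Hypotheses (ncg : noncrossing g) (pal : rev g = g :> seq nat).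
Let t : seq nat := g.
Hypothesis tame_t : tame (fun k => k.*2 - 2) t.

Definition single x := ~~ has (long t x) t.
(** By [long_inj] this pairs each letter with its only long partner, or with itself, so the letters
    fall into classes of one or two. *)
Definition linked x y := long t x y || (x == y) && single x.

Lemma singleP x y : long t x y -> single x = false.
Proof. by move=> l; apply/negbTE/negPn/hasP; exists y => //; case: (long_mem l). Qed.

Lemma linked_sym x y : linked x y = linked y x.
Proof. by rewrite /linked long_sym eq_sym; case: eqP => [->|]. Qed.

Lemma linked_exists x : exists y, linked x y.
Proof.
have [s|] := boolP (single x); first by exists x; rewrite /linked eqxx s orbT.
by move/negPn/hasP => [y _ l]; exists y; rewrite /linked l.
Qed.

Lemma linked_inj x y z : linked x y -> linked x z -> y = z.
Proof.
move=> /orP[l|/andP[/eqP<- s]] /orP[l'|/andP[/eqP<- s']] //.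
- exact: (long_inj ncg pal l l').
- by rewrite (singleP l) in s'.
- by rewrite (singleP l') in s.
Qed.

Lemma linked_share x y u v z : linked x y -> linked u v ->
  z \in [:: x; y] -> z \in [:: u; v] -> [:: u; v] =i [:: x; y].
Proof.
move=> xy uv; rewrite !inE => zx zu w; rewrite !inE.
have yx : linked y x by rewrite linked_sym.
have vu : linked v u by rewrite linked_sym.
case/orP: zx => /eqP zx; case/orP: zu => /eqP zu; subst z; subst.
- by rewrite (linked_inj xy uv).
- by rewrite (linked_inj xy vu) orbC.
- by rewrite (linked_inj yx uv) orbC.
- by rewrite (linked_inj yx vu).
Qed.

Lemma linked_mem x y z w : linked x y -> z \in [:: x; y] -> w \in [:: x; y] ->
  (z == w) || long t z w.
Proof.
rewrite !inE => /orP[l|/andP[/eqP<- _]]; last by rewrite !orbb => /eqP-> /eqP->; rewrite eqxx.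
by move=> /orP[]/eqP-> /orP[]/eqP->; rewrite ?eqxx // ?l ?orbT // long_sym l orbT.
Qed.

Definition bounded x y a := if x == y then a <= 1 else within a (m x y).
Definition descents x y a := [pred i | (i == x) || (i == y) && (a == m x y)].
Definition has_signs (p : position) (N : pred nat) :=
  forall i, if N i then (p i < 0)%Rr else (0 < p i)%Rr.

Lemma has_signs_eq p N N' : has_signs p N -> has_signs p N' -> N =1 N'.
Proof.
move=> H H' i; move: (H i) (H' i); case: (N i); case: (N' i) => //; lra.
Qed.

(* The word r starts with the maximal run alt c d L of the class of its first *)
(* letter; in the group this run is the geodesic alt x y a.                   *)
Record run (r : seq nat) (c d L : nat) (r' : seq nat) (x y a : nat) : Prop := Run {
  run_word : r = alt c d L ++ r';
  run_gt0 : 0 < L;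
  run_linked : linked c d;
  run_head : head 0 r' \notin [:: c; d];
  run_fires : forall q, fires r q = fires (alt x y a) (fires r' q);
  run_geo : 0 < a;
  run_bounded : bounded x y a;
  run_geo_linked : linked x y;
  run_pair : [:: x; y] =i [:: c; d];
  run_kind : [/\ x = c, y = d & a = L] \/
    [/\ x = d, y = c, (m c d != 0) && (m c d < L), a = (m c d).*2 - L & 1 < a] }.

(** A run longer than m is flipped to a geodesic of length 2m - L starting with the other letter;
    tameness keeps that length at least 2. *)
Lemma run_exists pre r : t = pre ++ r -> r != [::] ->
  exists c d L r' x y a, run r c d L r' x y a.
Proof.
case: r => // c r e _.
have rt : reduced (c :: r) by apply: (@reduced_catr pre); rewrite -e /t uvalP.
have c0 : 0 < c by move: rt; rewrite reduced_cons => /andP[].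
have [d cd] := linked_exists c.
have [l|/andP[/eqP dE s]] := orP cd; last first.
  have hr : head 0 r \notin [:: c; d].
    by move: rt; rewrite -dE reduced_cons !inE orbb eq_sym => /and3P[].
  exists c, d, 1%N, r, c, d, 1%N; split=> //; first by rewrite /bounded dE eqxx.
  by left.
have cnd := long_neq l.
have d0 : 0 < d.
  have [_ dt] := long_mem l; rewrite lt0n; apply: contraTneq dt => ->.
  by case/andP: (uvalP g).
have [L [r' [er hr]]] : exists L r', c :: r = alt c d L ++ r' /\ head 0 r' \notin [:: c; d].
  by apply: alt_run.
have L0 : 0 < L.
  by case: L er => // er; rewrite -[r']/(alt c d 0 ++ r') -er /= inE eqxx in hr.
have Lm : m c d != 0%N -> L <= (m c d).*2 - 2.
  move=> m0; have rt' : reduced t := uvalP g.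
  rewrite er in e; have [p' [c' [d' [L' [s' [B q' LL]]]]]] := block_ext rt' c0 d0 cnd L0 e.
  apply: leq_trans LL _; have cd' : c' != d' by move/pairqP: q' => [][-> ->]; rewrite // eq_sym.
  have mE : m c' d' = m c d by move/pairqP: q' => [][-> ->].
  by rewrite -mE; apply: tame_t B cd' _; rewrite mE.
exists c, d, L, r'.
have [w|w] := boolP (within L (m c d)).
  exists c, d, L; split=> //; first by move=> q; rewrite er fires_cat.
    by rewrite /bounded (negbTE cnd).
  by left.
move: w; rewrite /within negb_or -ltnNge => /andP[m0 mL].
have m5 : 5 <= m c d by move: (m_ge cnd); rewrite (negbTE m0).
have {}Lm := Lm m0.
exists d, c, ((m c d).*2 - L); split=> //.
- by move=> q; rewrite er fires_cat (fires_flip m_sym m_ge) // (ltnW mL) /=; lia.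
- lia.
- by rewrite /bounded eq_sym (negbTE cnd) /within m_sym; lia.
- by rewrite linked_sym.
- by move=> w; rewrite !inE orbC.
- by right; split=> //; [rewrite m0 | lia].
Qed.

Lemma run_one r c d L r' x y : run r c d L r' x y 1 -> r = x :: r'.
Proof.
by move=> R; rewrite (run_word R); case: (run_kind R) => [[<- _ <-]|[]].
Qed.

(** If both letters are descents, the run is the longest element of its dihedral group and the braid
    relation lets it start with either. *)
Lemma run_from r c d L r' x y a l : run r c d L r' x y a -> descents x y a l ->
  exists k, [/\ linked l k, [:: l; k] =i [:: c; d], bounded l k a,
     forall q, fires r q = fires (alt l k a) (fires r' q) & a = 1%N -> r = l :: r'].
Proof.
move=> R /orP[/eqP->|/andP[/eqP-> /eqP am]].
  exists y; split; [exact: run_geo_linked R|exact: run_pair R|exact: run_bounded R|exact: run_fires R|].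
  by move=> a1; move: R; rewrite a1 => /run_one.
have a0 := run_geo R; have b := run_bounded R.
have [xy|xy] := eqVneq x y.
  subst y; exists x; split; [exact: run_geo_linked R|exact: run_pair R|exact: b|exact: run_fires R|].
  by move=> a1; move: R; rewrite a1 => /run_one.
have m0 : m x y != 0%N by rewrite -am -lt0n.
exists x; split.
- by rewrite linked_sym (run_geo_linked R).
- by move=> w; rewrite -(run_pair R) !inE orbC.
- by move: b; rewrite /bounded eq_sym m_sym.
- by move=> q; rewrite (run_fires R) am (fires_braid m_sym m_ge) // m_sym.
- by move=> a1; have := m_ge xy; rewrite -am a1.
Qed.

Definition start : position := fun=> 1%Rr.

Lemma bounded_lt x y a : bounded x y a.+1 -> 0 < a ->
  [/\ x != y, bounded y x a & (a == m y x) = false].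
Proof.
rewrite /bounded; case: eqP => [_|/eqP xy]; first by case: a.
move=> w a0; rewrite eq_sym (negbTE xy) m_sym; by split=> //; move: w; rewrite /within; lia.
Qed.

Lemma fires_head_alt x y a q l : linked x y -> 0 < a -> bounded x y a ->
    (0 < q x)%Rr -> (0 < q y)%Rr -> l \notin [:: x; y] ->
  (fire (if odd a then x else y) q l <= fires (alt x y a) q l)%Rr.
Proof.
rewrite /bounded !inE negb_or => _; case: a => // a _; case: eqP => [_|/eqP xy].
  by case: a => //= _ _ _ _; lra.
move=> b qx qy /andP[lx ly]; rewrite [odd _]/= if_neg.
exact: fires_alt_other.
Qed.

Lemma pos_step C a b : (0 <= C)%Rr -> (2 <= C * C)%Rr -> (0 < a)%Rr -> (0 < b)%Rr ->
  (0 < - b + C * (a + C * b))%Rr.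
Proof.
move=> C0 C2 a0 b0; have := Rmult_le_pos _ _ C0 (Rlt_le _ _ a0).
have C3 : (0 <= C * C - 2)%Rr by lra.
have := Rmult_le_pos _ _ C3 (Rlt_le _ _ b0); lra.
Qed.

Lemma pos_step2 C a b : (0 <= C)%Rr -> (2 <= C * C)%Rr -> (0 < a)%Rr -> (0 < b)%Rr ->
  (0 < - (b + C * a) + C * (- a + C * (b + C * a)))%Rr.
Proof.
move=> C0 C2 a0 b0; have C2' : (0 <= C * C - 2)%Rr by lra.
have := Rmult_le_pos _ _ (Rmult_le_pos _ _ C0 C2') (Rlt_le _ _ a0).
have C3 : (0 <= C * C - 2)%Rr by lra.
have := Rmult_le_pos _ _ C3 (Rlt_le _ _ b0); lra.
Qed.

(** By induction on the suffix, [r] has positive entries at [x] and [y], because its descents lie in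
    the class of its first letter. Inside the class the signs are the dihedral ones. An entry
    outside could stay negative only through several short runs in succession, and the
    configurations needed for that are excluded for long pairs. The last letter of [pre] is recorded
    because these configurations extend to the left of [r]. *)
Lemma descents_alt n : forall r pre x y a, size r < n -> t = pre ++ r -> pre != [::] ->
    linked x y -> last 0 pre \in [:: x; y] -> head 0 r \notin [:: x; y] ->
    0 < a -> bounded x y a ->
  has_signs (fires (alt x y a) (fires r start)) (descents x y a).
Proof.
elim: n => [|n IH] r pre x y a // sr e pre0 xy lx hx a0 b.
have next r1 pre1 : size r1 <= n -> r1 != [::] -> t = pre1 ++ r1 ->
    exists c d L r2 u v w, [/\ run r1 c d L r2 u v w, size r2 <= n,
      head 0 r1 = c, has_signs (fires r1 start) (descents u v w) &
      forall k l i, linked k l -> [:: k; l] =i [:: c; d] -> 0 < i -> bounded k l i ->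
        has_signs (fires (alt k l i) (fires r2 start)) (descents k l i)].
  move=> s1 r10 e1; have [c [d [L [r2 [u [v [w R]]]]]]] := run_exists e1 r10.
  have e2 : t = (pre1 ++ alt c d L) ++ r2 by rewrite e1 (run_word R) catA.
  have E : size r1 = L + size r2 by rewrite (run_word R) size_cat size_alt.
  have s2 : size r2 < n by rewrite (leq_trans _ s1) // E -[X in X < _]add0n ltn_add2r (run_gt0 R).
  have gen k l i : linked k l -> [:: k; l] =i [:: c; d] -> 0 < i -> bounded k l i ->
      has_signs (fires (alt k l i) (fires r2 start)) (descents k l i).
    move=> kl K i0 bi; apply: (IH _ _ _ _ _ s2 e2 _ kl) => //; last by rewrite K (run_head R).
      by rewrite -size_eq0 size_cat size_alt -lt0n addn_gt0 (run_gt0 R) orbT.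
    have := run_gt0 R; case: (L) => // L' _; rewrite last_cat last_alt K.
    by case: (odd L'); rewrite !inE eqxx ?orbT.
  exists c, d, L, r2, u, v, w; split=> //; first exact: ltnW.
    by have := run_gt0 R; rewrite (run_word R); case: (L).
  move=> i; rewrite (run_fires R); apply: gen i.
  - exact: run_geo_linked R.
  - exact: run_pair R.
  - exact: run_geo R.
  - exact: run_bounded R.
have apart u v c d z : linked u v -> linked c d -> c \notin [:: u; v] ->
    z \in [:: u; v] -> z \notin [:: c; d].
  move=> uv cd cu zu; apply: contra cu => zc.
  by rewrite -(linked_share uv cd zu zc) !inE eqxx.
have out r1 pre1 u v z : size r1 <= n -> t = pre1 ++ r1 -> linked u v ->
    head 0 r1 \notin [:: u; v] -> z \in [:: u; v] -> (0 < fires r1 start z)%Rr.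
  move=> s1 e1 uv hu zu; have [r10|r10] := eqVneq r1 [::].
    by rewrite r10 /= /start; lra.
  have [c [d [L [r2 [u' [v' [w [R _ hc sg _]]]]]]]] := next _ _ s1 r10 e1.
  rewrite hc in hu; have := apart _ _ _ _ _ uv (run_linked R) hu zu.
  have := sg z; case: ifP => // /orP H _; rewrite -(run_pair R) !inE.
  by case: H => [->//|/andP[-> _]]; rewrite orbT.
have sr' : size r <= n by rewrite -ltnS.
have px := out _ _ _ _ x sr' e xy hx; rewrite !inE eqxx in px; have {}px := px isT.
have py := out _ _ _ _ y sr' e xy hx; rewrite !inE eqxx orbT in py; have {}py := py isT.
move=> i; have [ixy|ixy] := boolP (i \in [:: x; y]).
  have [E|xny] := eqVneq x y.
    move: b; rewrite /bounded E eqxx; case: (a) a0 => [|[|]] // _ _.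
    move: ixy; rewrite -E !inE orbb => /eqP ->; rewrite eqxx /=.
    by rewrite /fire eqxx; lra.
  move: b; rewrite /bounded (negbTE xny) => w.
  have [sx sy] := fires_alt_signs m_sym m_ge xny px py a0 w.
  move: ixy; rewrite !inE /= => /orP[]/eqP->; first by rewrite eqxx.
  by rewrite eq_sym (negbTE xny) eqxx /=; move: sy; case: (a == m x y).
have -> : descents x y a i = false by apply/negbTE; apply: contra ixy; rewrite !inE => /orP[->//|/andP[-> _]]; rewrite orbT.
(* Later firings only raise the entry at [i], so one firing, at the last letter [z] of the
   alternating word, suffices. *)
apply: Rlt_le_trans (fires_head_alt xy a0 b px py ixy).
pose z := if odd a then x else y; rewrite -/z.
have zxy : z \in [:: x; y] by rewrite /z; case: (odd a); rewrite !inE eqxx ?orbT.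
have pz : (0 < fires r start z)%Rr by rewrite /z; case: (odd a).
have iz : (i == z) = false by apply/negbTE; apply: contraNneq ixy => ->.
have zi : (z == i) = false by rewrite eq_sym.
have [C2 C0] := coef_bounds m_ge (negbT iz); move: (coef_sym m_sym z i) C2 C0.
rewrite /fire iz; set C := coef m i z => Cs C2 C0; rewrite Cs.
have done0 : (0 < fires r start i)%Rr -> (0 < fires r start i + C * fires r start z)%Rr.
  by have := Rmult_le_pos _ _ C0 (Rlt_le _ _ pz); lra.
have [r0|r0] := eqVneq r [::]; first by apply: done0; rewrite r0 /= /start; lra.
have [c [d [L [r2 [u [v [w [R s2 hc sg gen]]]]]]]] := next _ _ sr' r0 e.
have := sg i; case: ifP => [D _|_]; last exact: done0.
have [k [ik ikE bik fE one]] := run_from R D.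
have cxy : c \notin [:: x; y] by rewrite -hc.
have xy_ik q : q \in [:: x; y] -> q \notin [:: i; k].
  by move=> qxy; rewrite ikE; apply: apart xy (run_linked R) cxy qxy.
have hd2 := run_head R; rewrite !fE; have := run_geo R; case: w bik one {R sg D fE} => // w bik one _.
(* [zz] is the position before the first letter [i] of the rewritten run is fired; positive entries
   at [i] and [z] suffice by [pos_step]. *)
rewrite /= -/(fires _ _) /fire zi eqxx -/C; set zz := fires _ _.
have [ow|w0] := posnP w; last first.
  have [ik' bki wm] := bounded_lt bik w0; have ki : linked k i by rewrite linked_sym.
  have kiE : [:: k; i] =i [:: c; d] by move=> q; rewrite -ikE !inE orbC.
  have sz := gen _ _ _ ki kiE w0 bki.
  have := sz i; rewrite /= (negbTE ik') eqxx wm /= => zi0.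
  have := sz z; have := xy_ik _ zxy; rewrite !inE negb_or => /andP[/negbTE zi' /negbTE zk].
  by rewrite /= zi' zk /= => zz0; apply: pos_step.
have {one} rE := one (congr1 S ow); rewrite ow /= -/(fires _ _) in zz *.
have hr2 : head 0 r2 \notin [:: i; k] by rewrite ikE hd2.
have e2 : t = rcons pre i ++ r2 by rewrite cat_rcons -rE.
have zz_i : (0 < zz i)%Rr by apply: out s2 e2 ik hr2 _; rewrite !inE eqxx.
have done1 : (0 < zz z)%Rr -> (0 < - zz i + C * (zz z + C * zz i))%Rr by move=> ?; exact: pos_step.
have [r20|r20] := eqVneq r2 [::]; first by apply: done1; rewrite /zz r20 /= /start; lra.
have [c3 [d3 [L3 [r5 [u3 [v3 [w3 [R3 s5 hc3 sg3 gen3]]]]]]]] := next _ _ s2 r20 e2.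
have := sg3 z; case: ifP => [D _|_]; last exact: done1.
have [k3 [zk zkE bzk fE one]] := run_from R3 D.
have zk_xy : [:: z; k3] =i [:: x; y] by apply: linked_share xy zk zxy _; rewrite !inE eqxx.
have c3xy : c3 \in [:: x; y] by rewrite -zk_xy zkE !inE eqxx.
have [q [y0 pE]] : exists q y0, pre = rcons q y0 by case/lastP: (pre) pre0 => // q y0 _; exists q, y0.
have y0xy : y0 \in [:: x; y] by move: lx; rewrite pE last_rcons.
(* Here [i] stands between two letters of the class of [x] and [y], which a letter with a long
   partner cannot do. *)
have ikk : single i /\ k = i.
  case/orP: (ik) => [l|/andP[/eqP<- s]] //; exfalso.
  apply: (long_not_flanked ncg pal l (y := y0) (y' := c3) (p := q) (s := behead r2)).
  - rewrite -/t e2 pE -!cats1 -!catA /=; move: hc3; case: (r2) r20 => // h r2' _ /= ->.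
    by [].
  - exact: xy_ik.
  - exact: xy_ik.
  - exact: linked_mem xy y0xy c3xy.
have [si kE] := ikk; rewrite {}kE in ik ikE hr2 xy_ik bik *.
have hd3 := run_head R3; rewrite /zz !fE; have := run_geo R3; case: w3 bzk one {R3 sg3 D fE} => // w3 bzk one _.
rewrite /= -/(fires _ _) /fire iz eqxx Cs; set uu := fires _ _.
have [ow3|w30] := posnP w3; last first.
  have [zk' bkz wm] := bounded_lt bzk w30; have kz : linked k3 z by rewrite linked_sym.
  have kzE : [:: k3; z] =i [:: c3; d3] by move=> q'; rewrite -zkE !inE orbC.
  have sz := gen3 _ _ _ kz kzE w30 bkz.
  have := sz z; rewrite /= (negbTE zk') eqxx wm /= => uz0.
  have := sz i; have : i \notin [:: z; k3] by rewrite zk_xy.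
  rewrite !inE negb_or => /andP[/negbTE iz' /negbTE ik3].
  by rewrite /= iz' ik3 /= => ui0; apply: pos_step2.
have {one} r2E := one (congr1 S ow3); rewrite ow3 /= -/(fires _ _) in uu *.
have hr5 : head 0 r5 \notin [:: z; k3] by rewrite zkE hd3.
have e5 : t = rcons (rcons pre i) z ++ r5 by rewrite cat_rcons -r2E.
have uu_z : (0 < uu z)%Rr by apply: out s5 e5 zk hr5 _; rewrite !inE eqxx.
have done2 : (0 < uu i)%Rr ->
    (0 < - (uu i + C * uu z) + C * (- uu z + C * (uu i + C * uu z)))%Rr.
  by move=> ?; exact: pos_step2.
have [r50|r50] := eqVneq r5 [::]; first by apply: done2; rewrite /uu r50 /= /start; lra.
have [c4 [d4 [L4 [r6 [u4 [v4 [w4 [R4 s6 hc4 sg4 gen4]]]]]]]] := next _ _ s5 r50 e5.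
have := sg4 i; case: ifP => [D _|_]; last exact: done2.
have [k4 [ik4 ik4E _ _ _]] := run_from R4 D; exfalso.
have c4i : c4 = i.
  have : c4 \in [:: i; k4] by rewrite ik4E !inE eqxx.
  by rewrite -(linked_inj ik ik4) !inE orbb => /eqP.
(* Both cases are absurd: a paired [z] would be flanked by [i] twice, while a single [z] equals
   [y0], and [z i z i] makes a long pair although [i] is single. *)
have et : t = q ++ [:: y0; i; z; i] ++ behead r5.
  rewrite e5 pE -!cats1 -!catA /=; move: hc4; rewrite c4i.
  by case: (r5) r50 => // h r5' _ /= ->.
have izk : i \notin [:: z; k3] by rewrite zk_xy.
case/orP: (zk) => [l|/andP[/eqP zk3 sz]].
  apply: (long_not_flanked ncg pal l (y := i) (y' := i) (p := rcons q y0) (s := behead r5)) => //.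
    by rewrite -/t et -cats1 -catA.
  by rewrite eqxx.
have y0z : y0 = z by move: y0xy; rewrite -zk_xy -zk3 !inE orbb => /eqP.
have l : long t z i by apply: (@long_alt t q z i 4 (behead r5)); rewrite ?zi // et y0z.
by rewrite long_sym in l; rewrite (singleP l) in si.
Qed.

End Descents.

Section DescentsOfSuffixes.
Variable m : nat -> nat -> nat.
Hypothesis m_sym : forall i j, m i j = m j i.
Hypothesis m_ge : forall i j, i != j -> (m i j == 0) || (5 <= m i j).
Local Notation fire := (fire m).
Local Notation fires := (fires m).
Variable g : uword.
Hypotheses (ncg : noncrossing g) (pal : rev g = g :> seq nat).
Let t : seq nat := g.
Hypothesis tame_t : tame m (fun k => k.*2 - 2) t.
Local Notation run := (run m g).
Local Notation linked := (linked g).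

Lemma run_alt_signs pre r c d L r' x y a k l i : t = pre ++ r ->
    run r c d L r' x y a -> linked k l -> [:: k; l] =i [:: c; d] -> 0 < i ->
    bounded m k l i ->
  has_signs (fires (alt k l i) (fires r' start)) (descents m k l i).
Proof.
move=> e R kl K i0 bi.
have e2 : t = (pre ++ alt c d L) ++ r' by rewrite e (run_word R) catA.
apply: (descents_alt m_sym m_ge ncg pal tame_t (ltnSn _) e2 _ kl) => //.
- by rewrite -size_eq0 size_cat size_alt -lt0n addn_gt0 (run_gt0 R) orbT.
- have := run_gt0 R; case: (L) => // L' _; rewrite last_cat last_alt K.
  by case: (odd L'); rewrite !inE eqxx ?orbT.
- by rewrite K (run_head R).
Qed.

Lemma run_signs pre r c d L r' x y a : t = pre ++ r -> run r c d L r' x y a ->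
  has_signs (fires r start) (descents m x y a).
Proof.
move=> e R i; rewrite (run_fires R); apply: (run_alt_signs e R).
- exact: run_geo_linked R.
- exact: run_pair R.
- exact: run_geo R.
- exact: run_bounded R.
Qed.

Lemma run_hd r c d L r' x y a : run r c d L r' x y a -> head 0 r = c.
Proof. by move=> R; have := run_gt0 R; rewrite (run_word R); case: (L). Qed.

Lemma outside_pos pre r u v z : t = pre ++ r -> linked u v ->
  head 0 r \notin [:: u; v] -> z \in [:: u; v] -> (0 < fires r start z)%Rr.
Proof.
move=> e uv hu zu; have [->|r0] := eqVneq r [::]; first by rewrite /= /start; lra.
have [c [d [L [r' [x [y [a R]]]]]]] := run_exists m_sym m_ge tame_t e r0.
have := run_signs e R z; case: ifP => // H _; exfalso; move: hu; rewrite (run_hd R).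
have zc : z \in [:: c; d].
  by rewrite -(run_pair R) !inE; case/orP: H => [->//|/andP[-> _]]; rewrite orbT.
by rewrite -(linked_share ncg pal uv (run_linked R) zu zc) !inE eqxx.
Qed.

(** If the first run has a geodesic of two or more letters, firing [e] leaves its other letter as
    the only descent, so that letter is [c]. Otherwise the run is just [e]. *)
Lemma peel pre r e c : t = pre ++ r -> e != c ->
    has_signs (fires r start) (pred1 e) ->
    has_signs (fire e (fires r start)) (pred1 c) ->
  long t e c \/ exists y r', [/\ r = e :: r', linked e y & head 0 r' \notin [:: e; y]].
Proof.
move=> er ec H0 H1.
have r0 : r != [::].
  by apply: contraTneq isT => r0; have := H0 e; rewrite r0 /= eqxx /start; lra.
have [c' [d [L [r' [x [y [a R]]]]]]] := run_exists m_sym m_ge tame_t er r0.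
have N := has_signs_eq H0 (run_signs er R).
have xe : x = e by have := N x; rewrite /= eqxx /= => /eqP.
have a0 := run_geo R; have ey := run_geo_linked R; have K := run_pair R.
have b := run_bounded R; rewrite {}xe in R ey K b N.
case: a a0 b R N => // a _ b R N; case: (posnP a) => [a0|a0].
  right; exists y, r'; split=> //; last by rewrite K (run_head R).
  by move: R; rewrite a0 => /run_one.
left; have [ny bye ma] := bounded_lt m_sym b a0.
have sg := run_alt_signs er R (k := y) (l := e) (i := a).
have yK : [:: y; e] =i [:: c'; d] by move=> w; rewrite -K !inE orbC.
have {sg} := sg _ yK a0 bye; rewrite linked_sym => /(_ ey) sg.
have E : fire e (fires r start) = fires (alt y e a) (fires r' start).
  by rewrite (run_fires R) /=; exact: fireK.
have := has_signs_eq H1 (eq_ind_r (has_signs^~ _) sg E) y.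
rewrite /= eqxx /= => /eqP yc; move: ey; rewrite yc /linked (negbTE ec).
by rewrite orbF.
Qed.

(** Either two consecutive descents come from one run, or [peel] strips [e], [c], [e]. The next run
    then starts with a single [c], completing [e c e c], since a [c] paired with another letter may
    not be flanked by [e] twice. *)
Lemma long_of_descents pre r e c : t = pre ++ r -> e != c ->
    has_signs (fires r start) (pred1 e) ->
    has_signs (fires [:: e] (fires r start)) (pred1 c) ->
    has_signs (fires [:: c; e] (fires r start)) (pred1 e) ->
    has_signs (fires [:: e; c; e] (fires r start)) (pred1 c) ->
  long t e c.
Proof.
move=> er ec H0 H1 H2 H3; have ce : c != e by rewrite eq_sym.
have [//|[y [r1 [E1 _ _]]]] := peel er ec H0 H1.
move: H1 H2 H3; rewrite E1 /= !fireK => H1 H2 H3.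
have er1 : t = rcons pre e ++ r1 by rewrite cat_rcons -E1.
have [|[y1 [r2 [E2 l1 _]]]] := peel er1 ce H1 H2; first by rewrite long_sym.
move: H2 H3; rewrite E2 /= !fireK => H2 H3.
have er2 : t = rcons (rcons pre e) c ++ r2 by rewrite cat_rcons -E2.
have [//|[y2 [r3 [E3 l2 h3]]]] := peel er2 ec H2 H3.
move: H3; rewrite E3 /= !fireK => H3.
have er3 : t = rcons (rcons (rcons pre e) c) e ++ r3 by rewrite cat_rcons -E3.
have r30 : r3 != [::].
  by apply: contraTneq isT => r0; have := H3 c; rewrite r0 /= eqxx /start; lra.
have [c' [d [L [r' [x [y3 [a R]]]]]]] := run_exists m_sym m_ge tame_t er3 r30.
have N := has_signs_eq H3 (run_signs er3 R).
have xc : x = c by have := N x; rewrite /= eqxx /= => /eqP.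
have := run_geo_linked R; have := run_pair R; rewrite xc => K /orP[l|/andP[/eqP cy _]].
  have [->|ey3] := eqVneq e y3; first by rewrite long_sym.
  exfalso; apply: (long_not_flanked ncg pal l (y := e) (y' := e) (p := pre) (s := r3)).
  - by rewrite -/t er3 -!cats1 -!catA.
  - by rewrite !inE negb_or ec.
  - by rewrite !inE negb_or ec.
  - by rewrite eqxx.
have c'c : c' = c by have : c' \in [:: c'; d] by [rewrite !inE eqxx]; rewrite -K -cy !inE orbb => /eqP.
apply: (@long_alt t pre e c 4 (behead r3)) => //.
rewrite er3 -!cats1 -!catA /=; have := run_hd R; rewrite c'c.
by case: (r3) r30 => // h s _ /= ->.
Qed.

End DescentsOfSuffixes.

(** * Where two words of the same element part *)

Section Divergence.
Variable m : nat -> nat -> nat.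
Hypothesis m_sym : forall i j, m i j = m j i.
Hypothesis m_ge : forall i j, i != j -> (m i j == 0) || (5 <= m i j).
Local Notation fires := (fires m).

(** After cancelling the common letters, a surplus on one side would produce a negative entry at [x]
    or [y]. *)
Lemma alt_unique x y a b p q : x != y -> within a (m x y) -> within b (m x y) ->
    (0 < p x)%Rr -> (0 < p y)%Rr -> (0 < q x)%Rr -> (0 < q y)%Rr ->
    fires (alt x y a) p = fires (alt x y b) q ->
  a = b /\ p = q.
Proof.
move=> xy; have key a' b' p' q' : a' <= b' -> within b' (m x y) ->
    (0 < p' x)%Rr -> (0 < p' y)%Rr -> (0 < q' x)%Rr -> (0 < q' y)%Rr ->
    fires (alt x y a') p' = fires (alt x y b') q' -> a' = b' /\ p' = q'.
  move=> ab wb px py qx qy; rewrite -{1}(subnKC ab) alt_add fires_cat => /fires_inj E.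
  have [n0|n0] := posnP (b' - a'); first by split; [lia|move: E; rewrite n0; case: (odd a')].
  have yx : y != x by rewrite eq_sym.
  have w : within (b' - a') (m x y) by move: wb; rewrite /within; lia.
  have w' : within (b' - a') (m y x) by rewrite m_sym.
  move: px py; rewrite E; case: (odd a') => px py.
    by have [] := fires_alt_signs m_sym m_ge yx qy qx n0 w'; lra.
  by have [] := fires_alt_signs m_sym m_ge xy qx qy n0 w; lra.
move=> wa wb px py qx qy E; case: (leqP a b) => ab; first exact: (key a b).
by have [-> ->] := key b a q p (ltnW ab) wa qx qy px py (esym E).
Qed.

Variables g1 g2 : uword.
Hypotheses (nc1 : noncrossing g1) (pal1 : rev g1 = g1 :> seq nat).
Hypotheses (nc2 : noncrossing g2) (pal2 : rev g2 = g2 :> seq nat).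
Let t1 : seq nat := g1.
Let t2 : seq nat := g2.
Hypothesis tame1S : tame m S t1.
Hypothesis tame2 : tame m (fun k => k.*2 - 2) t2.

Lemma tame_leq (k k' : nat -> nat) t : (forall n, 5 <= n -> k n <= k' n) ->
  tame m k t -> tame m k' t.
Proof.
move=> kk T p c d L s B cd m0; apply: leq_trans (T _ _ _ _ _ B cd m0) _.
by apply: kk; move: (m_ge cd); rewrite (negbTE m0).
Qed.

Let tame1 : tame m (fun k => k.*2 - 2) t1.
Proof. by apply: tame_leq tame1S => n; lia. Qed.

(** Equal positions have equal descents, and these are read off from the first runs ([run_signs]).
    Different first letters then need one run to be flipped because it exceeds m, or both runs to be
    the longest element of the same dihedral group. *)
Lemma divergence pre1 r1 pre2 r2 c1 c2 : t1 = pre1 ++ r1 -> t2 = pre2 ++ r2 ->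
    r1 != [::] -> r2 != [::] -> head 0 r1 = c1 -> head 0 r2 = c2 -> c1 != c2 ->
    fires r1 start = fires r2 start ->
  [/\ long t2 c1 c2, m c1 c2 != 0 & exists L s, [/\ r2 = alt c2 c1 L ++ s,
    head 0 s \notin [:: c1; c2], 3 < L & long t1 c1 c2 \/ m c1 c2 < L]].
Proof.
move=> e1 e2 r10 r20 h1 h2 c12 E.
have [c [d1 [L1 [s1 [x1 [y1 [a1 R1]]]]]]] := run_exists m_sym m_ge tame1 e1 r10.
have [c' [d2 [L2 [s2 [x2 [y2 [a2 R2]]]]]]] := run_exists m_sym m_ge tame2 e2 r20.
have ec : c = c1 by rewrite -h1 (run_hd R1).
have ec' : c' = c2 by rewrite -h2 (run_hd R2).
rewrite {c}ec {c'}ec' in R1 R2.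
have S1 := run_signs m_sym m_ge nc1 pal1 tame1 e1 R1.
have S2 := run_signs m_sym m_ge nc2 pal2 tame2 e2 R2.
have N := has_signs_eq S1 (eq_ind_r (has_signs^~ _) S2 E).
have c21 : c2 != c1 by rewrite eq_sym.
have ge5 x y : x != y -> m x y != 0 -> 5 <= m x y.
  by move=> xy m0; move: (m_ge xy); rewrite (negbTE m0).
case: (run_kind R1) => [[xE yE aE]|[xE yE /andP[m0 mL] aE a11]].
  have := N c1; rewrite /= xE eqxx /= => /esym/orP[/eqP c1x|/andP[/eqP c1y /eqP am]].
    case: (run_kind R2) => [[x2E _ _]|[x2E y2E /andP[m0 mL] aE2 a21]].
      by move: c12; rewrite c1x x2E eqxx.
    have c1d : c1 = d2 by rewrite c1x.
    have l : long t2 c1 c2.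
      have := run_linked R2; rewrite -c1d /linked (negbTE c21) orbF.
      by rewrite long_sym.
    rewrite -c1d (m_sym c2) in m0 mL; split=> //; exists L2, s2; split=> //.
    - by rewrite (run_word R2) c1d.
    - by have := run_head R2; rewrite -c1d !inE orbC.
    - by have := ge5 _ _ c12 m0; lia.
    - by right.
  case: (run_kind R2) => [[x2E y2E aE2]|[x2E y2E _ _ _]]; last by move: c12; rewrite c1y y2E eqxx.
  have c1d : d2 = c1 by rewrite -y2E.
  have := N c2; rewrite /= x2E eqxx /= xE (negbTE c21) /= => /andP[/eqP c2y _].
  have d1E : d1 = c2 by rewrite -yE.
  have l1 : long t1 c1 c2 by have := run_linked R1; rewrite d1E /linked (negbTE c12) orbF.
  have l2 : long t2 c1 c2 by have := run_linked R2; rewrite c1d /linked (negbTE c21) orbF long_sym.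
  rewrite x2E -c1y m_sym in am.
  have m0 : m c1 c2 != 0 by rewrite -am aE2 -lt0n (run_gt0 R2).
  split=> //; exists L2, s2; split; [| |  |by left].
  - by rewrite (run_word R2) c1d.
  - by have := run_head R2; rewrite c1d !inE orbC.
  - by rewrite -aE2 am; have := ge5 _ _ c12 m0; lia.
have b1 := run_bounded R1; rewrite xE yE in b1.
have d1c1 : d1 != c1 by move: b1; rewrite /bounded; case: eqP => //; lia.
have c1d1 : c1 != d1 by rewrite eq_sym.
have l1 : long t1 c1 d1 by have := run_linked R1; rewrite /linked (negbTE c1d1) orbF.
have m5 := ge5 _ _ c1d1 m0.
(* Tameness of the first word leaves m + 1 as the only length above m, so the flipped geodesic has m
   - 1 letters. *)
have L1E : L1 = (m c1 d1).+1.
  have [c10 d10] : 0 < c1 /\ 0 < d1.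
    have [c1t d1t] := long_mem l1.
    by have := uword0 g1; split; rewrite lt0n; [apply: contraTneq c1t | apply: contraTneq d1t] => ->.
  have := e1; rewrite (run_word R1) => e1'.
  have [p' [c' [d' [L' [s' [B q' LL]]]]]] := block_ext (uvalP g1) c10 d10 c1d1 (run_gt0 R1) e1'.
  have cd' : c' != d' by move/pairqP: q' => [][-> ->].
  have mE : m c' d' = m c1 d1 by move/pairqP: q' => [][-> ->].
  by have := tame1S B cd'; rewrite mE => /(_ m0); lia.
have {}aE : a1 = (m c1 d1).-1 by rewrite aE L1E; lia.
have sg k l i : k != l -> [:: k; l] =i [:: c1; d1] -> 0 < i -> i < m c1 d1 ->
    has_signs (fires (alt k l i) (fires s1 start)) (pred1 k).
  move=> kl K i0 im.
  have kl2 : pairq c1 d1 k l.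
    have := K c1; have := K d1; have := K k; have := K l; rewrite !inE !eqxx ?orbT.
    by rewrite /pairq; move: kl; lia.
  have mE : m k l = m c1 d1 by move/pairqP: kl2 => [][-> ->].
  have lk : linked g1 k l by apply/orP; left; rewrite (long_pairq _ kl2).
  have b : bounded m k l i by rewrite /bounded (negbTE kl) mE /within (ltnW im) orbT.
  have := run_alt_signs m_sym m_ge nc1 pal1 tame1 e1 R1 lk K i0 b.
  by move=> H j; have := H j; rewrite /= mE (ltn_eqF im) andbF orbF.
have P1 := run_fires R1 start; rewrite xE yE aE E in P1.
have l2 : long t2 d1 c1.
  have K1 : [:: c1; d1] =i [:: c1; d1] by [].
  have K2 : [:: d1; c1] =i [:: c1; d1] by move=> w; rewrite !inE orbC.
  (* Since m is at least 5, the geodesic has the four letters whose successive descents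
     [long_of_descents] asks for. *)
  have [n nE] : exists n, (m c1 d1).-1 = n.+4 by exists ((m c1 d1).-1 - 4); lia.
  rewrite nE in P1.
  apply: (long_of_descents m_sym m_ge nc2 pal2 tame2 e2 d1c1); rewrite P1 /= ?fireK.
  - by apply: (sg d1 c1 n.+4) => //; lia.
  - by apply: (sg c1 d1 n.+3) => //; lia.
  - by apply: (sg d1 c1 n.+2) => //; lia.
  - by apply: (sg c1 d1 n.+1) => //; lia.
have x2E : x2 = d1.
  have := N x2; rewrite /= eqxx /= xE yE => /orP[/eqP//|/andP[_ /eqP am]].
  by move: am; rewrite aE (m_sym d1); lia.
have y2E : y2 = c1.
  apply: (linked_inj nc2 pal2 (x := d1)); first by rewrite -x2E (run_geo_linked R2).
  by rewrite /linked l2.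
have c2E : c2 = d1.
  have : c2 \in [:: c2; d2] by rewrite !inE eqxx.
  by rewrite -(run_pair R2) x2E y2E !inE (negbTE c21) orbF => /eqP.
case: (run_kind R2) => [[_ d2E a2E]|[_ y2E' _ _ _]]; last by move: c12; rewrite -y2E' y2E eqxx.
have d2E' : d2 = c1 by rewrite -d2E.
have P2 := run_fires R2 start; rewrite P1 x2E y2E in P2.
have e1' : t1 = (pre1 ++ alt c1 d1 L1) ++ s1 by rewrite e1 (run_word R1) catA.
have e2' : t2 = (pre2 ++ alt c2 d2 L2) ++ s2 by rewrite e2 (run_word R2) catA.
have o1 z := @outside_pos m m_sym m_ge g1 nc1 pal1 tame1 _ s1 c1 d1 z e1' (run_linked R1) (run_head R1).
have o2 z := @outside_pos m m_sym m_ge g2 nc2 pal2 tame2 _ s2 c2 d2 z e2' (run_linked R2) (run_head R2).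
have b2 := run_bounded R2; rewrite x2E y2E /bounded (negbTE d1c1) in b2.
rewrite /bounded (negbTE d1c1) aE in b1.
have [aa _] : (m c1 d1).-1 = a2 /\ fires s1 start = fires s2 start.
  apply: (alt_unique d1c1 b1 b2 _ _ _ _ P2); (apply: o1 || apply: o2);
    by rewrite ?c2E ?d2E' !inE eqxx ?orbT.
rewrite c2E; split; [by rewrite long_sym | by [] |].
exists L2, s2; split; [| | |by left].
- by rewrite (run_word R2) c2E d2E'.
- by have := run_head R2; rewrite c2E d2E' !inE orbC.
- by rewrite -a2E -aa; lia.
Qed.

End Divergence.

(** * Shifting the blocks of a pair *)

Lemma cat_split (P : pred nat) (u : seq nat) b r p y :
    all P u -> ~~ P b -> u ++ b :: r = p ++ y -> p != [::] -> ~~ P (last 0 p) ->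
  exists p1, p = u ++ b :: p1 /\ r = p1 ++ y.
Proof.
elim: u p => [|x u IH] [|z p] //= au Pb [<- e] _ Pl.
  by exists p; rewrite e.
have [Px {}au] := andP au.
case: p e Pl => [|w p] e Pl; first by rewrite /= Px in Pl.
by have [p1 [-> ->]] := IH (w :: p) au Pb e isT Pl; exists p1.
Qed.

Section Shift.
Variables c0 d0 : nat.
Hypotheses (c0_gt0 : 0 < c0) (d0_gt0 : 0 < d0) (cd0 : c0 != d0).
Local Notation inpair := (mem [:: c0; d0]).

(** The letters separated by the pair from the end mark 0. *)
Definition inside a := ccw c0 d0 a != ccw c0 d0 0.

Section Words.
Variables (m : nat) (bd : pred nat).

(** The product of (dc)^m with the block, by [new_block_prod]. The second branch serves words that
    have not yet been shortened. *)
Definition new_block c d L :=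
  if L <= m.*2 then alt d c (m.*2 - L) else alt c d (L - m.*2).

(** The condition on [ccw c d a] says that the twist cancels against the block instead of
    lengthening it by 2m. *)
Definition shift_block a u b u' := exists c d L, [/\ pairq c0 d0 c d, u = alt c d L &
  ~~ essential c d L a b /\ u' = u \/
  [/\ essential c d L a b, ccw c d a = ccw c0 d0 0, 0 < L, bd L & u' = new_block c d L]].

(* shift a r r': the word r, which follows the letter a, becomes r' when its  *)
(* essential blocks are twisted.                                              *)
Inductive shift : nat -> seq nat -> seq nat -> Prop :=
| ShiftEnd a u u' : shift_block a u 0 u' -> shift a u u'
| ShiftCons a u u' b r r' : shift_block a u b u' -> b \notin [:: c0; d0] ->
    shift b r r' -> shift a (u ++ b :: r) (u' ++ b :: r').

Lemma pairq_alt c d L : pairq c0 d0 c d -> all inpair (alt c d L).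
Proof.
move=> q; apply/allP => x /mem_alt; move/pairqP: q => [][-> ->] //.
by rewrite /= !inE orbC.
Qed.

Lemma notin_pairq c d a : pairq c0 d0 c d -> (a \in [:: c; d]) = (a \in [:: c0; d0]).
Proof. by move/pairqP => [][-> ->] //; rewrite !inE orbC. Qed.

Lemma pairq_neq c d : pairq c0 d0 c d -> c != d.
Proof. by move/pairqP => [][-> ->] //; rewrite eq_sym. Qed.

Lemma shift_block_pair a u b u' : shift_block a u b u' -> all inpair u /\ all inpair u'.
Proof.
case=> c [d [L [q -> [[_ ->]|[_ _ _ _ ->]]]]]; rewrite pairq_alt //; split=> //.
by rewrite /new_block; case: ifP => _; rewrite pairq_alt // -pairq_swap.
Qed.

Lemma shift_exists (t : seq nat) pre r : reduced t -> t = pre ++ r ->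
    last 0 pre \notin [:: c0; d0] ->
    (forall p c d L s, block t p c d L s -> pairq c0 d0 c d ->
       essential c d L (last 0 p) (head 0 s) ->
       [/\ ccw c d (last 0 p) = ccw c0 d0 0, 0 < L & bd L]) ->
  exists r', shift (last 0 pre) r r'.
Proof.
move=> rt; have [n] := ubnP (size r); elim: n r pre => // n IH r pre sr e lp H.
have rr : reduced r by move: rt; rewrite e => /reduced_catr.
have [c [d [q hr]]] : exists c d, pairq c0 d0 c d /\ head 0 r != d.
  have [h|h] := eqVneq (head 0 r) d0; last by exists c0, d0; rewrite pairq_refl.
  by exists d0, c0; rewrite h eq_sym; split=> //; apply/pairqP; right.
have cd := pairq_neq q.
have [c_gt0 d_gt0] : 0 < c /\ 0 < d by move/pairqP: q => [][-> ->].
have [L [s [er hs]]] := alt_run rr c_gt0 d_gt0 cd hr.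
have B : block t pre c d L s by split; rewrite -?er // notin_pairq.
have nb : exists u', shift_block (last 0 pre) (alt c d L) (head 0 s) u'.
  have [ess|ess] := boolP (essential c d L (last 0 pre) (head 0 s)).
    by have [? ? ?] := H _ _ _ _ _ B q ess; exists (new_block c d L), c, d, L; split=> //; right.
  by exists (alt c d L), c, d, L; split=> //; left.
case: nb => u' nb; case: s er hs nb {B} => [|b s] er hs nb.
  by exists u'; rewrite er cats0; constructor.
have [||||s' sh] := IH s (rcons (pre ++ alt c d L) b).
- by move: sr; rewrite er size_cat /=; lia.
- by rewrite cat_rcons -catA -er.
- by rewrite last_rcons -(notin_pairq _ q).
- exact: H.
rewrite last_rcons in sh; exists (u' ++ b :: s'); rewrite er; apply: ShiftCons => //.
by rewrite -(notin_pairq _ q).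
Qed.

Lemma shift_prefix a v r w : shift a (v ++ r) w ->
    (v == [::]) || (last 0 v \notin [:: c0; d0]) ->
    (forall p c d L s, v = p ++ alt c d L ++ s -> s != [::] -> pairq c0 d0 c d ->
       last a p \notin [:: c0; d0] -> head 0 s \notin [:: c0; d0] ->
       ~~ essential c d L (last a p) (head 0 s)) ->
    a \notin [:: c0; d0] ->
  exists2 r', w = v ++ r' & shift (last a v) r r'.
Proof.
move Ez : (v ++ r) => z sh; elim: sh v Ez => {a z w} [a u u' nb|a u u' b r1 r1' nb bP sh IH] v Ez hv H aP.
  have [v0|v0] := eqVneq v [::].
    by move: Ez; rewrite v0 /= => ->; exists u' => //; constructor.
  exfalso; have [/allP au _] := shift_block_pair nb.
  move: hv; rewrite (negbTE v0) /=; case/lastP: v v0 Ez {H} => // v x _ Ez.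
  by rewrite last_rcons => /negP[]; apply: au; rewrite -Ez mem_cat mem_rcons inE eqxx.
have [v0|v0] := eqVneq v [::].
  by move: Ez; rewrite v0 /= => ->; exists (u' ++ b :: r1') => //; apply: ShiftCons.
move: hv; rewrite (negbTE v0) /= => lv.
have [au _] := shift_block_pair nb.
have [v1 [vE r1E]] := cat_split au bP (esym Ez) v0 lv.
have uu : u' = u.
  case: nb => [c [d [L [q uE [[_ ->]//|[ess _ _ _ _]]]]]].
  have := H [::] c d L (b :: v1); rewrite vE uE => /(_ erefl isT q aP bP) /=.
  by rewrite ess.
have [||r' -> sh'] := IH v1 (esym r1E) _ _ bP.
- by case: (v1) vE lv => // y v2 ->; rewrite last_cat.
- move=> p c d L s v1E s0 q lp hs.
  have lp' : last a (u ++ b :: p) = last b p by rewrite last_cat.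
  by rewrite -lp'; apply: H; rewrite ?lp' // vE v1E -catA.
by exists r'; rewrite vE ?uu -?catA // last_cat.
Qed.

Lemma alt_inj_hd c d L c' d' L' : alt c d L = alt c' d' L' -> 0 < L -> c = c' /\ L = L'.
Proof.
move=> e; have := congr1 size e; rewrite !size_alt => LL; rewrite -LL in e *.
by case: L e {LL} => //= L [-> _].
Qed.

Lemma cat_block u b r c d L s : all inpair u -> b \notin [:: c0; d0] ->
    pairq c0 d0 c d -> head 0 s \notin [:: c0; d0] -> u ++ b :: r = alt c d L ++ s ->
  u = alt c d L /\ b :: r = s.
Proof.
move=> au bP q hs; have := pairq_alt L q; move: (alt c d L) => v av.
elim: u v au av => [|x u IH] [|y v] //=.
- by move=> _ /andP[yP _] [e]; rewrite -e /= in yP; rewrite yP in bP.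
- by move=> /andP[xP _] _ e; move: hs; rewrite -e /= xP.
- by move=> /andP[_ au] /andP[_ av] [-> /(IH _ au av)[-> ->]].
Qed.

Lemma cat_block_end u c d L s : all inpair u ->
    pairq c0 d0 c d -> head 0 s \notin [:: c0; d0] -> u = alt c d L ++ s ->
  u = alt c d L /\ s = [::].
Proof.
move=> au q; case: s => [|b s] hs e; first by rewrite e cats0.
by exfalso; move: au; rewrite e all_cat /= (negbTE hs) andbF.
Qed.

Lemma shift_block_alt a c d L b u' : 0 < L -> pairq c0 d0 c d ->
    shift_block a (alt c d L) b u' ->
  ~~ essential c d L a b /\ u' = alt c d L \/
  [/\ essential c d L a b, ccw c d a = ccw c0 d0 0, bd L & u' = new_block c d L].
Proof.
move=> L0 q [x [y [L' [q' e H]]]]; have [cx LL] := alt_inj_hd e L0.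
have dy : d = y.
  move/pairqP: q => [][ec ed]; move/pairqP: q' => [][ex ey]; rewrite ed ey //.
    by move: cx cd0; rewrite ec ex => ->; rewrite eqxx.
  by move: cx cd0; rewrite ec ex => ->; rewrite eqxx.
by rewrite -cx -dy -LL in H; case: H => [?|[]]; [left|right].
Qed.

Lemma shift_head a r r' c d L s : shift a r r' ->
    r = alt c d L ++ s -> pairq c0 d0 c d -> 0 < L -> head 0 s \notin [:: c0; d0] ->
    essential c d L a (head 0 s) -> L < m.*2 ->
  head 0 r' = d.
Proof.
have key a1 u' b x : 0 < L -> pairq c0 d0 c d -> L < m.*2 -> essential c d L a1 b ->
    shift_block a1 (alt c d L) b u' -> head 0 (u' ++ x) = d.
  move=> L0 q L2 ess /(shift_block_alt L0 q)[[/negP[]]//|[_ _ _ ->]].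
  by rewrite /new_block ltnW // -(subnSK L2).
move=> sh e q L0 hs ess L2; case: sh e hs ess => {a r r'} [a u u' nb|a u u' b r r' nb bP sh] e hs ess.
  have [uE sE] := cat_block_end (shift_block_pair nb).1 q hs e.
  by rewrite -[u']cats0; rewrite sE in ess; rewrite uE in nb; apply: key nb.
have [uE sE] := cat_block (shift_block_pair nb).1 bP q hs e.
by rewrite -sE in ess; rewrite uE in nb; apply: key nb.
Qed.

Lemma shift_blocks a r w p c d L s : shift a r w -> a \notin [:: c0; d0] ->
    w = p ++ alt c d L ++ s -> pairq c0 d0 c d -> last a p \notin [:: c0; d0] ->
    head 0 s \notin [:: c0; d0] ->
  exists p0 u s0, [/\ r = p0 ++ u ++ s0, last a p0 = last a p, head 0 s0 = head 0 s &
    shift_block (last a p) u (head 0 s) (alt c d L)].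
Proof.
move=> sh + + q + hs; elim: sh p => {a r w} [a u u' nb|a u u' b r1 r1' nb bP sh IH] p aP e lp.
  have [_ au] := shift_block_pair nb.
  have p0 : p = [::].
    case/lastP: p e lp => // p x e; rewrite last_rcons => /negP[].
    by move/allP: au; apply; rewrite e mem_cat mem_rcons inE eqxx.
  rewrite p0 in e *; have [uE sE] := cat_block_end au q hs e.
  by exists [::], u, [::]; rewrite cats0 sE -uE.
have [_ au] := shift_block_pair nb.
have [p0|p0] := eqVneq p [::].
  rewrite p0 in e *; have [uE sE] := cat_block au bP q hs e.
  by exists [::], u, (b :: r1); rewrite -sE -uE.
have lp0 : last 0 p \notin [:: c0; d0] by case: (p) p0 lp.
have [p1 [pE r1E]] := cat_split au bP e p0 lp0.
have lpE : last a p = last b p1 by rewrite pE last_cat.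
rewrite lpE in lp *; have [q0 [v [s0 [-> E1 E2 nb']]]] := IH p1 bP r1E lp.
by exists (u ++ b :: q0), v, s0; rewrite -catA last_cat.
Qed.

Lemma shift_block_size a u b u' : (forall L, bd L -> m <= L) ->
  shift_block a u b u' -> size u' <= size u.
Proof.
move=> mL [c [d [L [_ -> [[_ ->]//|[_ _ L0 /mL bL ->]]]]]].
by rewrite /new_block; case: ifP => _; rewrite !size_alt; lia.
Qed.

Lemma shift_size a r w : shift a r w -> (forall L, bd L -> m <= L) -> size w <= size r.
Proof.
move=> sh mL.
elim: sh => {a r w} [a u u' /(shift_block_size mL) //|a u u' b r1 r1' /(shift_block_size mL) nb _ _ IH].
by rewrite !size_cat leq_add.
Qed.

Lemma shift_size_lt a r w p c d L s : shift a r w -> (forall L, bd L -> m <= L) ->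
    0 < m -> a \notin [:: c0; d0] -> r = p ++ alt c d L ++ s -> pairq c0 d0 c d ->
    last a p \notin [:: c0; d0] -> head 0 s \notin [:: c0; d0] ->
    essential c d L (last a p) (head 0 s) -> m < L ->
  size w < size r.
Proof.
move=> sh mL m0 + + q + hs ess Lm.
have L0 : 0 < L by exact: leq_ltn_trans Lm.
have key a1 b u' : essential c d L a1 b -> shift_block a1 (alt c d L) b u' -> size u' < L.
  move=> es /(shift_block_alt L0 q)[[/negP[]]//|[_ _ _ ->]].
  by rewrite /new_block; case: ifP => _; rewrite !size_alt; lia.
elim: sh p ess => {a r w} [a u u' nb|a u u' b r1 r1' nb bP sh IH] p ess aP e lp.
  have [au _] := shift_block_pair nb.
  have p0 : p = [::].
    case/lastP: p e lp {ess} => // p x e; rewrite last_rcons => /negP[].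
    by move/allP: au; apply; rewrite e mem_cat mem_rcons inE eqxx.
  rewrite p0 in e ess *; have [uE sE] := cat_block_end au q hs e.
  by rewrite sE in ess; rewrite uE in nb *; rewrite size_alt; apply: key nb.
have [au _] := shift_block_pair nb.
have [p0|p0] := eqVneq p [::].
  rewrite p0 in e ess *; have [uE sE] := cat_block au bP q hs e.
  rewrite -sE in ess; rewrite uE in nb *; rewrite !size_cat size_alt /=.
  by have := key _ _ _ ess nb; have := shift_size sh mL; lia.
have lp0 : last 0 p \notin [:: c0; d0] by case: (p) p0 lp.
have [p1 [pE r1E]] := cat_split au bP e p0 lp0.
have lpE : last a p = last b p1 by rewrite pE last_cat.
rewrite lpE in lp ess *; have lt1 := IH p1 ess bP r1E lp.
have := shift_block_size mL nb.
by rewrite !size_cat /=; lia.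
Qed.

Lemma shift_block_nil a b u : (forall L, bd L -> L < m.*2) -> shift_block a u b [::] -> u = [::].
Proof.
move=> bm [c [d [L [_ -> [[_ <-]//|[_ _ L0 /bm Lm]]]]]].
by rewrite /new_block ltnW // => /(congr1 size); rewrite size_alt /=; lia.
Qed.

Lemma shift_free_prefix a r w x s : (forall L, bd L -> L < m.*2) -> shift a r w ->
    w = x ++ s -> ~~ has inpair x -> exists s0, r = x ++ s0.
Proof.
move=> bm; elim: x a r w => [|y x IH] a r w sh e; first by exists r.
rewrite /= negb_or => /andP[yP xP].
case: sh e => {a r w} [a u u' nb|a u u' b r r' nb bP sh] e.
  by have [_] := shift_block_pair nb; rewrite e /= (negbTE yP).
have [_ au] := shift_block_pair nb.
case: u' au nb e => [_ /(shift_block_nil bm) -> /= [<- e]|z u' /= /andP[zP _] _ [zy _]].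
  by have [s0 ->] := IH _ _ _ sh e xP; exists s0.
by move: yP; rewrite -zy zP.
Qed.

(** A block of length below 2m never becomes empty ([shift_block_nil]), so letters outside the pair
    do not become adjacent by shifting. *)
Lemma shift_free a r w p x s : (forall L, bd L -> L < m.*2) -> shift a r w ->
    w = p ++ x ++ s -> x != [::] -> ~~ has inpair x ->
  exists p0 s0, r = p0 ++ x ++ s0.
Proof.
move=> bm; case: x => // h x sh + _ xP; elim: sh p => {a r w} [a u u' nb|a u u' b r1 r1' nb bP sh IH] p e.
  have [_] := shift_block_pair nb; rewrite e !all_cat /=.
  by move: xP; rewrite /= negb_or => /andP[/negbTE -> _]; rewrite !andbF.
have [_ au] := shift_block_pair nb.
have hP : h \notin [:: c0; d0] by move: xP; rewrite /= negb_or => /andP[].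
have e' : u' ++ b :: r1' = rcons p h ++ (x ++ s) by rewrite cat_rcons.
have [||p1 [pE r1E]] := cat_split au bP e'; rewrite ?last_rcons //; first by case: (p).
case/lastP: p1 pE r1E => [|p1 h'] pE r1E.
  have /eqP := pE; rewrite -cat_rcons cats0 eqseq_rcons => /andP[_ /eqP hb].
  have xP' : ~~ has inpair x by move: xP; rewrite /= negb_or => /andP[].
  have [s0 ->] := shift_free_prefix (x := x) (s := s) bm sh r1E xP'.
  by exists u, s0; rewrite hb.
have /eqP := pE; rewrite -rcons_cons -rcons_cat eqseq_rcons => /andP[_ /eqP hh].
rewrite -hh cat_rcons in r1E; have [p0 [s0 ->]] := IH p1 r1E.
by exists (u ++ b :: p0), s0; rewrite -catA.
Qed.

Lemma shift_reduced a r w : (forall L, bd L -> L < m.*2) -> shift a r w -> reduced r ->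
  reduced w /\ (head 0 w = head 0 r \/ head 0 w \in [:: c0; d0]).
Proof.
move=> bm sh; have key a1 u b u' : shift_block a1 u b u' ->
    reduced u' /\ (u' = [::] /\ u = [::] \/ u' != [::] /\ head 0 u' \in [:: c0; d0]).
  move=> nb; have [_ au] := shift_block_pair nb; split.
    case: nb => [c [d [L [q -> H]]]]; have [c_gt0 d_gt0] : 0 < c /\ 0 < d by move/pairqP: q => [][-> ->].
    have cd := pairq_neq q; have dc : d != c by rewrite eq_sym.
    case: H => [[_ ->]|[_ _ _ _ ->]]; first exact: alt_reduced.
    by rewrite /new_block; case: ifP => _; apply: alt_reduced.
  case: u' au nb => [_ /(shift_block_nil bm) ->|x u' /= /andP[xP _] _]; first by left.
  by right.
elim: sh => {a r w} [a u u' nb|a u u' b r1 r1' nb bP sh IH] rr.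
  have [ru [[-> ->]|[_ h]]] := key _ _ _ _ nb; first by split=> //; left.
  by split=> //; right.
have := reduced_catr rr; rewrite reduced_cons => /and3P[b0 bh rr1].
have [rr1' h1] := IH rr1.
have rb : reduced (b :: r1').
  rewrite reduced_cons b0 rr1' andbT /=; case: h1 => [->//|h1].
  by apply: contraNneq bP => ->.
have [ru [[-> ->]|[u0 h]]] := key _ _ _ _ nb; first by split=> //; left.
split; last by right; case: (u') u0 h.
rewrite reduced_catP ru rb /=.
have [_ /allP au] := shift_block_pair nb.
case/lastP: (u') u0 au => // v x _ au; rewrite last_rcons.
have := au x; rewrite mem_rcons inE eqxx => /(_ isT) xP.
by apply/orP; left; apply/orP; left; apply: contraNneq bP => <-.
Qed.

End Words.
End Shift.

(** * The automorphism of the universal group that realises a shift *)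

Section Twist.
Variables c0 d0 m : nat.
Hypotheses (c0_gt0 : 0 < c0) (d0_gt0 : 0 < d0) (cd0 : c0 != d0).
Local Notation inpair := (mem [:: c0; d0]).
Let H := uprod (alt d0 c0 m.*2).

Let HV : H^-1 = uprod (alt c0 d0 m.*2).
Proof. by rewrite /H -uprod_rev rev_alt odd_double. Qed.

(** [H] is a rotation in the infinite dihedral group of the pair, and the letters of the pair are
    reflections. *)
Lemma ugen_twist x : x \in [:: c0; d0] -> ugen x * H = H^-1 * ugen x.
Proof.
rewrite !inE => /orP[]/eqP->.
  rewrite HV -uprod_cons -uprod1 -uprod_cat cats1.
  by rewrite -[c0 :: _]/(alt c0 d0 _.+1) alt_rcons odd_double.
have E : H * ugen d0 = ugen d0 * H^-1.
  rewrite HV -uprod_cons -uprod1 -uprod_cat cats1.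
  by rewrite -[d0 :: _]/(alt d0 c0 _.+1) alt_rcons odd_double.
by rewrite -{1}[H](mulgK (ugen d0)) E ugenV !mulgA ugenK mul1g.
Qed.

(** The effect on letters of a power of a Birman-Ko-Lee generator or of its inverse, according to
    the order of the pair ([bkl_pow_uw], [twistK]). *)
Definition twist_img c : uword :=
  if c \in [:: c0; d0] then H * ugen c
  else if inside c0 d0 c then H * ugen c * H^-1 else ugen c.

Lemma twist_imgK c : twist_img c * twist_img c = 1.
Proof.
rewrite /twist_img; case: ifP => [cP|_].
  by rewrite -mulgA (mulgA (ugen c)) ugen_twist // -mulgA ugenK mulg1 mulgV.
case: ifP => _; last exact: ugenK.
by rewrite !mulgA mulgVK -(mulgA H) ugenK mulg1 mulgV.
Qed.

Lemma zero_notin : 0 \notin [:: c0; d0].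
Proof. by rewrite !inE !(eq_sym 0%N) negb_or -!lt0n c0_gt0. Qed.

Lemma twist_img0 : twist_img 0 = 1.
Proof.
rewrite /twist_img (negbTE zero_notin) /inside eqxx.
exact: uval_inj.
Qed.

Definition twist : group_hom uword uword := ulift twist_imgK twist_img0.

Lemma twist_gen c : twist (ugen c) = twist_img c.
Proof. exact: ulift_gen. Qed.

Lemma twist_alt c d L : pairq c0 d0 c d ->
  twist (uprod (alt c d L)) = (if odd L then H else 1) * uprod (alt c d L).
Proof.
elim: L c d => [|L IH] c d q; first by rewrite uprod_nil gmulf1 mulg1.
have cP : c \in [:: c0; d0] by move/pairqP: q => [][-> _]; rewrite !inE eqxx ?orbT.
rewrite [alt _ _ _]/= uprod_cons gmulfM twist_gen /twist_img cP IH; last by rewrite -pairq_swap.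
rewrite /=; case: (odd L); rewrite /= ?mul1g ?mulgA //.
by rewrite -(mulgA H) ugen_twist // mulgA mulgV mul1g.
Qed.

Lemma alt_twist c d L : pairq c0 d0 c d ->
  uprod (alt c d L) * H = (if odd L then H^-1 else H) * uprod (alt c d L).
Proof.
elim: L c d => [|L IH] c d q; first by rewrite uprod_nil mulg1 mul1g.
have cP : c \in [:: c0; d0] by move/pairqP: q => [][-> _]; rewrite !inE eqxx ?orbT.
rewrite [alt _ _ _]/= uprod_cons -mulgA IH /=; last by rewrite -pairq_swap.
case: (odd L); rewrite /= !mulgA ?ugen_twist //; congr (_ * _).
by apply: (mulIg H); rewrite mulgVK -mulgA ugen_twist // mulVKg.
Qed.

Lemma new_block_prod c d L :
  uprod (new_block m c d L) = uprod (alt d c m.*2) * uprod (alt c d L).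
Proof.
rewrite /new_block; case: (leqP L m.*2) => Lm.
  have -> : uprod (alt c d L) = (uprod (rev (alt c d L)))^-1 by rewrite -uprod_rev revK.
  rewrite -{2}(subnK Lm) alt_add uprod_cat rev_alt oddB // odd_double /=.
  by case: (odd L); rewrite mulgK.
rewrite -{2}(subnKC (ltnW Lm)) alt_add odd_double uprod_cat mulgA -[alt d c m.*2]revK.
by rewrite uprod_rev rev_alt odd_double mulVg mul1g.
Qed.

(** Correction at the boundary of a block: an inside letter is conjugated by [H], and the two
    factors of the conjugation are handed to the neighbouring blocks, so that the product telescopes
    in [shift_prod]. *)
Definition Hs a : uword := if inside c0 d0 a then H^-1 else 1.

Lemma shift_block_prod bd a u b u' : shift_block c0 d0 m bd a u b u' ->
    a \notin [:: c0; d0] -> b \notin [:: c0; d0] ->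
  uprod u' = Hs a * twist (uprod u) * (Hs b)^-1.
Proof.
case=> c [d [L [q -> K]]] aP bP; have cd := pairq_neq cd0 q.
have aP' : a \notin [:: c; d] by rewrite (notin_pairq _ q).
have bP' : b \notin [:: c; d] by rewrite (notin_pairq _ q).
rewrite twist_alt // /Hs.
have comm := alt_twist L q.
have comm' : uprod (alt c d L) = (if odd L then H^-1 else H) * uprod (alt c d L) * H^-1.
  by rewrite -comm mulgK.
have ess : essential c d L a b = if odd L then (inside c0 d0 a == inside c0 d0 b) else (inside c0 d0 a != inside c0 d0 b).
  rewrite /essential /rsign /inside (ccwN cd bP').
  move/pairqP: q => [][-> ->]; rewrite ?(ccwN cd0 aP) ?(ccwN cd0 bP);
  by case: (odd L); case: (ccw c0 d0 a); case: (ccw c0 d0 b); case: (ccw c0 d0 0).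
rewrite ess in K; case: K => [[ne ->]|[es sg _ _ ->]].
  move: ne comm comm'; case: (odd L); case: (inside c0 d0 a); case: (inside c0 d0 b) => //= _ cm cm';
    rewrite ?invgK ?invg1 ?mulg1 ?mul1g ?mulVKg ?mulKg //.
  - by rewrite -mulgA cm mulVKg.
  - by rewrite -mulgA cm mulKg.
rewrite new_block_prod; have -> : uprod (alt d c m.*2) = if inside c0 d0 a then H^-1 else H.
  move: sg; rewrite /inside HV; move/pairqP: q => [][-> ->] sg; first by rewrite sg eqxx.
  by rewrite -sg (ccwN cd0 aP); case: (ccw _ _ _).
move: es comm; case: (odd L); case: (inside c0 d0 a); case: (inside c0 d0 b) => //= _ cm;
  rewrite ?invgK ?invg1 ?mulg1 ?mul1g ?mulKg //.
Qed.

Lemma shift_prod bd a r w : shift c0 d0 m bd a r w -> a \notin [:: c0; d0] ->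
  uprod w = Hs a * twist (uprod r).
Proof.
have H0 : Hs 0 = 1 by rewrite /Hs /inside eqxx.
elim=> {a r w} [a u u' nb aP|a u u' b r r' nb bP _ IH aP].
  by rewrite (shift_block_prod nb aP zero_notin) H0 invg1 mulg1.
rewrite !uprod_cat !uprod_cons (shift_block_prod nb aP bP) IH // !gmulfM twist_gen.
rewrite /twist_img (negbTE bP) /Hs; case: (inside c0 d0 b).
  by rewrite invgK !mulgA.
by rewrite invg1 mulg1 mul1g !mulgA.
Qed.

End Twist.

Lemma twistK c d m (c_gt0 : 0 < c) (d_gt0 : 0 < d) (cd : c != d) :
  cancel (twist m d_gt0 c_gt0) (twist m c_gt0 d_gt0).
Proof.
pose h : group_hom uword uword := twist m c_gt0 d_gt0 \o twist m d_gt0 c_gt0.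
pose id' : group_hom uword uword := idfun.
apply: (@uhom_ext _ h id') => x x0.
rewrite -[LHS]/(twist m c_gt0 d_gt0 (twist m d_gt0 c_gt0 _)) -[RHS]/(ugen x) twist_gen.
have HV : uprod (alt c d m.*2) = (uprod (alt d c m.*2))^-1.
  by rewrite -uprod_rev rev_alt odd_double.
have tH : twist m c_gt0 d_gt0 (uprod (alt c d m.*2)) = uprod (alt c d m.*2).
  by rewrite twist_alt ?pairq_refl // odd_double mul1g.
have xE : (x \in [:: d; c]) = (x \in [:: c; d]) by rewrite !inE orbC.
rewrite /twist_img xE; case: ifP => [xP|/negbT xP].
  by rewrite gmulfM tH twist_gen /twist_img xP HV mulKg.
have iE : inside d c x = inside c d x.
  by rewrite /inside (ccwN cd xP) (ccwN cd (zero_notin c_gt0 d_gt0)); case: (ccw _ _ _); case: (ccw _ _ _).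
rewrite iE; case: ifP => ix; last by rewrite twist_gen /twist_img (negbTE xP) ix.
have tV : twist m c_gt0 d_gt0 (uprod (alt c d m.*2))^-1 = (uprod (alt c d m.*2))^-1.
  by rewrite gmulfV tH.
rewrite !gmulfM tH tV twist_gen /twist_img (negbTE xP) ix HV.
by move: (uprod _) (ugen _) => K y; rewrite invgK !mulgA mulVg mul1g mulgVK.
Qed.

(** * Braids acting on the free group *)

Section Braids.
Variable n : nat.
Local Notation F := (free_group 'I_n).
Local Notation x := (@free_gen 'I_n).
Local Notation B := (braid_group n).

Lemma braid_ind (P : B -> Prop) : P 1 -> (forall i b, P b -> P (sigma i * b)) ->
  (forall i b, P b -> P ((sigma i)^-1 * b)) -> forall b, P b.
Proof.
move=> P1 PM PV; elim/quotW; elim/free_group_ind => [|i w IH|i w IH]; first exact: P1.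
- rewrite -[\pi _]/(quot_class _ _) quot_classM; exact: PM.
- rewrite -[\pi _]/(quot_class _ _) quot_classM.
  rewrite (_ : quot_class (@braid_rel n) (free_gen i)^-1 = (sigma i)^-1); last by rewrite gmulfV.
  exact: PV.
Qed.

Lemma braid_act1 (q : F) : (1 : B) ⋆ q = q.
Proof. by rewrite gmulf1. Qed.
Lemma braid_actM (b1 b2 : B) (q : F) : (b1 * b2) ⋆ q = b1 ⋆ (b2 ⋆ q).
Proof. by rewrite gmulfM. Qed.
Lemma braid_actK (b : B) (q : F) : b^-1 ⋆ (b ⋆ q) = q.
Proof. by rewrite -braid_actM mulVg braid_act1. Qed.
Lemma braid_actKV (b : B) (q : F) : b ⋆ (b^-1 ⋆ q) = q.
Proof. by rewrite -braid_actM mulgV braid_act1. Qed.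

Definition braid_fun (b : B) : F -> F := artin_action n b.
Lemma braid_fun1 b : braid_fun b 1 = 1.
Proof. by apply: (mulgI (braid_fun b 1)); rewrite /braid_fun -artin_actionM !mulg1. Qed.
HB.instance Definition _ b :=
  isMultiplicative.Build F F (braid_fun b) (artin_actionM b).
HB.instance Definition _ b :=
  Multiplicative_isUMagmaMorphism.Build F F (braid_fun b) (braid_fun1 b).

Lemma braid_hom (b : B) : {h : group_hom F F | forall q, h q = b ⋆ q}.
Proof. by exists (braid_fun b). Qed.

Lemma sigma_act (i : 'I_n.-1) (q : F) : sigma i ⋆ q = artin_aut i q.
Proof. exact: artin_action_sigma. Qed.

Lemma sigmaV_act (i : 'I_n.-1) (q : F) : (sigma i)^-1 ⋆ q = artin_aut_inv i q.
Proof. by rewrite gmulfV /artin_action pres_lift_gen. Qed.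

Lemma hurwitz_sigmaV (G : groupType) (i : 'I_n.-1) (g : 'I_n -> G) :
  hurwitz_action G n (sigma i)^-1 g = hurwitz_back (ord_lo i) (ord_hi i) g.
Proof. by rewrite gmulfV /hurwitz_action pres_lift_gen. Qed.

(** The Hurwitz action rearranges positions and the Artin action substitutes letters, so the two
    compose in opposite orders; this is the source of the inverse. *)
Lemma hurwitz_braid b k : hurwitz_action F n b x k = b^-1 ⋆ x k.
Proof.
elim/braid_ind: b k => [|i b IH|i b IH] k; first by rewrite invg1 !gmulf1.
- rewrite gmulfM symM hurwitz_action_sigma invgM braid_actM sigmaV_act /= free_lift_gen.
  rewrite /hurwitz_step !IH; case: eqP => // _; case: eqP => // _.
  by case: (braid_hom b^-1) => h hE; rewrite -!hE !gmulfM gmulfV.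
- rewrite gmulfM symM hurwitz_sigmaV invgM invgK braid_actM sigma_act /= free_lift_gen /hurwitz_back !IH.
  case: eqP => // _; last by case: eqP.
  by case: (braid_hom b^-1) => h hE; rewrite -!hE !gmulfM gmulfV.
Qed.

Lemma hurwitz_QP (q : F) : hurwitz_Q q <-> exists b k, q = b ⋆ x k.
Proof.
split=> [[r [b ->] [k ->]]|[b [k ->]]]; first by exists b^-1, k; exact: hurwitz_braid.
exists (hurwitz_action F n b^-1 x); first by exists b^-1.
by exists k; rewrite hurwitz_braid invgK.
Qed.

Lemma hurwitz_Q_act b (q : F) : hurwitz_Q q -> hurwitz_Q (b ⋆ q).
Proof.
by move=> /hurwitz_QP[b' [k ->]]; apply/hurwitz_QP; exists (b * b'), k; rewrite braid_actM.
Qed.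

Definition uw : group_hom F uword := free_lift (fun i : 'I_n => ugen i.+1).

Lemma uw_gen i : uw (x i) = ugen i.+1.
Proof. exact: free_lift_gen. Qed.

Lemma uw_sigma (i : 'I_n.-1) (q : F) : uw (sigma i ⋆ q) = usig (ltn0Sn i) (uw q).
Proof.
rewrite sigma_act.
pose h1 : group_hom F uword := uw \o artin_aut i.
pose h2 : group_hom F uword := usig (ltn0Sn i) \o uw.
apply: (@free_hom_ext _ _ h1 h2) => j.
rewrite -[LHS]/(uw (artin_aut i (x j))) -[RHS]/(usig (ltn0Sn i) (uw (x j))).
rewrite uw_gen usig_gen /usig_img [artin_aut i _]free_lift_gen !eqSS.
rewrite -[j == i :> nat]/(j == ord_lo i) -[j == i.+1 :> nat]/(j == ord_hi i).
case: eqP => _; first by rewrite !gmulfM gmulfV !uw_gen ugenV.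
by case: eqP => _; rewrite uw_gen.
Qed.

(** All three properties hold for a letter and pass through [usig] in both directions. Being a
    palindrome is transported as being an involution. *)
Lemma uw_Q (q : F) : hurwitz_Q q ->
  [/\ uw q != 1, noncrossing (uw q) & rev (uw q) = uw q :> seq nat].
Proof.
suff H : hurwitz_Q q -> [/\ uw q != 1, noncrossing (uw q) & uw q * uw q = 1].
  by move=> /H[? ? /mulg1_eq E]; split=> //; rewrite -uvalV E.
move=> /hurwitz_QP[b [k ->]]; elim/braid_ind: b => [|i b|i b].
- rewrite braid_act1 uw_gen; split; [|exact: noncrossing_gen|exact: ugenK].
  by rewrite uval_eqE uval_gen.
- case=> q1 ncq qq; rewrite braid_actM uw_sigma usig_eq1.
  by split=> //; [exact/noncrossing_usig|rewrite -gmulfM qq gmulf1].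
- have -> : uw (b ⋆ x k) = usig (ltn0Sn i) (uw (((sigma i)^-1 * b) ⋆ x k)).
    by rewrite -uw_sigma braid_actM braid_actKV.
  move: (uw _) => u; rewrite usig_eq1 -gmulfM => -[u1 nc /eqP].
  by rewrite usig_eq1 => /eqP uu; split=> //; apply/(noncrossing_usig (ltn0Sn i) u1).
Qed.

End Braids.
Arguments uw {n}.

(** * The Birman-Ko-Lee generators *)

Lemma altprod_conj (G : groupType) (y z : G) k :
  altprod (y * z * y^-1) y k * y = altprod y z k.+1.
Proof.
have key : altprod (y * z * y^-1) y k * y = y * altprod z y k /\
           altprod y (y * z * y^-1) k * y = y * altprod y z k.
  elim: k => [|k [IH1 IH2]] /=; first by rewrite mul1g mulg1.
  by split; rewrite -mulgA ?IH2 ?IH1 // !mulgA mulgVK.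
by case: key.
Qed.

Section BKL.
Variable n : nat.
Local Notation F := (free_group 'I_n).
Local Notation x := (@free_gen 'I_n).
Local Notation B := (braid_group n).

Lemma braid_act_mul (b : B) (p q : F) : b ⋆ (p * q) = (b ⋆ p) * (b ⋆ q).
Proof. exact: artin_actionM. Qed.
Lemma braid_act_inv (b : B) (p : F) : b ⋆ p^-1 = (b ⋆ p)^-1.
Proof. by case: (braid_hom b) => h hE; rewrite -!hE gmulfV. Qed.

Definition sigma_prod (i r : nat) : B := \prod_(k < n.-1 | i <= k < r) sigma k.

Lemma sigma_prodS (i r : nat) (rn : r < n.-1) : i <= r ->
  sigma_prod i r.+1 = sigma_prod i r * sigma (Ordinal rn).
Proof.
move=> ir; pose S k : B := if insub k is Some o then sigma (o : 'I_n.-1) else 1.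
have E r' : r' <= n.-1 -> sigma_prod i r' = \prod_(i <= k < r') S k.
  move=> rn'; rewrite (big_nat_widenl i 0) // (big_nat_widen 0 r' n.-1) //.
  rewrite big_mkord /sigma_prod; apply: eq_big => // k _; rewrite /S.
  by rewrite valK.
by rewrite !E ?(ltnW rn) // big_nat_recr //= /S insubT.
Qed.

Lemma sigma_prod0 (i : nat) : sigma_prod i i = 1.
Proof.
by rewrite /sigma_prod big1 // => k /andP[ik]; rewrite ltnNge ik.
Qed.

Lemma sigma_prod_act (i k : 'I_n) (r : nat) : i <= r <= n.-1 ->
  [/\ k = r :> nat -> sigma_prod i r ⋆ x k = x i,
      (forall k' : 'I_n, k' = k.+1 :> nat -> i <= k < r ->
          sigma_prod i r ⋆ x k = x i * x k' * (x i)^-1) &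
      (k < i) || (r < k) -> sigma_prod i r ⋆ x k = x k].
Proof.
move=> /andP[]; elim: r k => [|r IH] k.
  rewrite leqn0 => /eqP i0 _; rewrite !i0 sigma_prod0 !braid_act1.
  by split=> // k0; congr x; apply: val_inj; rewrite /= k0 i0.
rewrite leq_eqVlt => /orP[/eqP ir _|].
  rewrite -ir sigma_prod0 !braid_act1.
  split=> // [k0|k' _]; first by congr x; apply: val_inj.
  by rewrite leqNgt andNb.
rewrite ltnS => ir rn; rewrite (sigma_prodS rn ir) !braid_actM !sigma_act.
have act k' := IH k' ir (ltnW rn); rewrite /= !free_lift_gen.
have lo : ord_lo (Ordinal rn) = r :> nat by [].
have hi : ord_hi (Ordinal rn) = r.+1 :> nat by [].
have eqlo : (k == ord_lo (Ordinal rn)) = (k == r :> nat) by [].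
have eqhi : (k == ord_hi (Ordinal rn)) = (k == r.+1 :> nat) by [].
rewrite eqlo eqhi; split.
- move=> ->; rewrite gtn_eqF // eqxx.
  by have [H _ _] := act (ord_lo (Ordinal rn)); apply: H.
- move=> k' kk' /andP[ik kr]; case: eqP => [kE|/eqP kr'].
    rewrite !braid_act_mul braid_act_inv.
    have [-> // _ _] := act (ord_lo (Ordinal rn)).
    have [_ _ ->] := act (ord_hi (Ordinal rn)); last by rewrite hi ltnSn orbT.
    by congr (_ * x _ * _); apply: val_inj; rewrite /= kk' kE.
  rewrite ltn_eqF //; have [_ H _] := act k; apply: H => //.
  by rewrite ik ltn_neqAle kr' -ltnS.
- move=> kr; have [_ _ H] := act k.
  have -> : (k == r :> nat) = false by lia.
  have -> : (k == r.+1 :> nat) = false by lia.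
  by apply: H; lia.
Qed.

Section Pair.
Variables (i j : 'I_n) (ij : i < j).
Local Notation b := (bkl ij).

Lemma bkl_act :
  [/\ b ⋆ x i = x i * x j * (x i)^-1, b ⋆ x j = x i,
      (forall k : 'I_n, i < k < j -> b ⋆ x k = (x i * (x j)^-1) * x k * (x i * (x j)^-1)^-1) &
      (forall k : 'I_n, (k < i) || (j < k) -> b ⋆ x k = x k)].
Proof.
pose C := sigma_prod i j.-1; pose s : 'I_n.-1 := Ordinal (bkl_subproof ij).
have bC q : b ⋆ (C ⋆ q) = C ⋆ (artin_aut s q).
  by rewrite -sigma_act -!braid_actM /bkl -/C mulgVK.
have sv : s = j.-1 :> nat by [].
have j0 : 0 < j by apply: leq_ltn_trans ij.
have ir : i <= j.-1 <= n.-1 by have := ltn_ord j; lia.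
have act k := sigma_prod_act k ir; rewrite -/C in act.
have lo : ord_lo s = j.-1 :> nat by [].
have hiE : ord_hi s = j by apply: val_inj; rewrite /= prednK.
have Clo : C ⋆ x (ord_lo s) = x i by have [-> // _ _] := act (ord_lo s).
have Cj : C ⋆ x j = x j by have [_ _ H] := act j; apply: H; lia.
have bi : b ⋆ x i = x i * x j * (x i)^-1.
  by rewrite -{1}Clo bC /= free_lift_gen eqxx hiE !braid_act_mul braid_act_inv Clo Cj.
have bj : b ⋆ x j = x i.
  rewrite -{1}Cj bC /= free_lift_gen -{1}hiE ord_hi_lo -{1}hiE eqxx.
  exact: Clo.
split=> // k H.
  have kn : k.-1 < n by have := ltn_ord k; lia.
  pose k0 := Ordinal kn; have k0v : k0 = k.-1 :> nat by [].
  (* The middle crossing of [b] fixes the generator of index k - 1, so [b] fixes its image under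
     [C], which is a conjugate of [x k]. *)
  have Ck : C ⋆ x k0 = x i * x k * (x i)^-1.
    by have [_ h _] := act k0; apply: h; rewrite k0v; lia.
  have bk : b ⋆ (x i * x k * (x i)^-1) = x i * x k * (x i)^-1.
    rewrite -{1}Ck bC /= free_lift_gen -Ck.
    have -> : (k0 == ord_lo s) = false by apply/negP => /eqP/(congr1 val) /=; lia.
    have -> : (k0 == ord_hi s) = false by apply/negP => /eqP/(congr1 val) /=; lia.
    by [].
  move: bk; rewrite !braid_act_mul braid_act_inv bi => E.
  rewrite -[b ⋆ x k](mulKg (x i * x j * (x i)^-1)) -[_ * (b ⋆ x k)](mulgK ((x i * x j * (x i)^-1)^-1)) E.
  by rewrite !invgM !invgK !mulgA !mulgVK.
have Ck : C ⋆ x k = x k by have [_ _ h] := act k; apply: h; lia.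
rewrite -{1}Ck bC /= free_lift_gen.
have -> : (k == ord_lo s) = false by apply/negP => /eqP/(congr1 val) /=; lia.
have -> : (k == ord_hi s) = false by apply/negP => /eqP/(congr1 val) /=; lia.
exact: Ck.
Qed.

Let a r := b ^+ r ⋆ x i.

(** Applying [b] to the last identity and moving the conjugating [x i] to the right ([altprod_conj])
    gives the next one; it presents [a r] as a quotient of two alternating products. *)
Lemma bkl_pow r : [/\ b ^+ r.+1 ⋆ x j = a r,
  (forall k : 'I_n, i < k < j -> b ^+ r.+1 ⋆ x k = (a r * (x j)^-1) * x k * (a r * (x j)^-1)^-1),
  (forall k : 'I_n, (k < i) || (j < k) -> b ^+ r ⋆ x k = x k) &
  a r * altprod (x i) (x j) r = altprod (x i) (x j) r.+1].
Proof.
have [bi bj bk bo] := bkl_act; split.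
- by rewrite expgSr braid_actM bj.
- elim: r => [|r IH] k H; first by rewrite expg1 bk // /a expg0 braid_act1.
  rewrite expgSr braid_actM bk // !braid_act_mul !braid_act_inv !braid_act_mul !braid_act_inv.
  have bjr : b ^+ r.+1 ⋆ x j = a r by rewrite expgSr braid_actM bj.
  rewrite (IH k H) bjr -/(a r.+1).
  by rewrite !invgM !invgK !mulgA !mulgVK.
- by elim: r => [|r IH] k H; rewrite ?expg0 ?braid_act1 // expgSr braid_actM bo // IH.
- elim: r => [|r IH]; first by rewrite /a expg0 braid_act1 /= !mulg1.
  have alt_act (p q : F) m : b ⋆ altprod p q m = altprod (b ⋆ p) (b ⋆ q) m.
    elim: m p q => [|m IHm] p q /=; last by rewrite braid_act_mul IHm.
    by case: (braid_hom b) => h hE; rewrite -hE gmulf1.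
  have aS : a r.+1 = b ⋆ a r by rewrite /a expgS braid_actM.
  have := congr1 (fun q => (b ⋆ q) * x i) IH.
  by rewrite braid_act_mul !alt_act bi bj -mulgA !altprod_conj aS.
Qed.

(** Under the relation [f] identifies [a k] with [x j] and [a k.+1] with [x i], and the elements
    that conjugate the letters in between become trivial. *)
Lemma bkl_pow_hom (G : groupType) (f : group_hom F G) k :
    altprod (f (x i)) (f (x j)) k.+1 = altprod (f (x j)) (f (x i)) k.+1 ->
  forall q, f (b ^+ k.+1 ⋆ q) = f q.
Proof.
move=> rel; have falt m : f (altprod (x i) (x j) m) = altprod (f (x i)) (f (x j)) m.
  have : f (altprod (x i) (x j) m) = altprod (f (x i)) (f (x j)) m /\
         f (altprod (x j) (x i) m) = altprod (f (x j)) (f (x i)) m.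
    by elim: m => [|m [IH1 IH2]] /=; rewrite ?gmulf1 // !gmulfM IH1 IH2.
  by case.
have [bj bk _ aE] := bkl_pow k; have [_ _ bo aE'] := bkl_pow k.+1.
have fak : f (a k) = f (x j).
  have := congr1 f aE; rewrite gmulfM !falt rel /= => /mulIg; apply.
have fak1 : f (a k.+1) = f (x i).
  have : f (a k.+1) * altprod (f (x i)) (f (x j)) k.+1 =
         f (x i) * altprod (f (x j)) (f (x i)) k.+1.
    by rewrite -falt -gmulfM aE' falt.
  by rewrite -rel => /mulIg.
case: (braid_hom (b ^+ k.+1)) => h hE q; rewrite -hE.
pose fh : group_hom F G := f \o h.
apply: (@free_hom_ext _ _ fh f) => l; rewrite -[LHS]/(f (h (x l))) hE.
have [->|li] := eqVneq l i; first exact: fak1.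
have [->|lj] := eqVneq l j; first by rewrite bj.
have [H|H] := boolP (i < l < j); first by rewrite bk // !gmulfM !gmulfV !gmulfM !gmulfV fak mulgV invg1 mul1g mulg1.
by rewrite bo //; move: li lj H; rewrite -!val_eqE /=; lia.
Qed.

Lemma bkl_pow_uw k q : uw (b ^+ k.+1 ⋆ q) = twist k.+1 (ltn0Sn j) (ltn0Sn i) (uw q).
Proof.
have falt m : uw (altprod (x i) (x j) m) = uprod (alt i.+1 j.+1 m).
  have : uw (altprod (x i) (x j) m) = uprod (alt i.+1 j.+1 m) /\
         uw (altprod (x j) (x i) m) = uprod (alt j.+1 i.+1 m).
    elim: m => [|m [IH1 IH2]] /=; rewrite ?gmulf1 ?uprod_nil //.
    by rewrite !gmulfM IH1 IH2 !uw_gen !uprod_cons.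
  by case.
have ua r : uw (a r) = uprod (alt i.+1 j.+1 (r.+1 + r)).
  have [_ _ _ /(congr1 (@uw n))] := bkl_pow r; rewrite gmulfM !falt => E.
  apply: (mulIg (uprod (alt i.+1 j.+1 r))); rewrite E alt_add uprod_cat -mulgA.
  rewrite -[alt i.+1 j.+1 r in X in _ * (_ * X)]revK rev_alt uprod_rev /=.
  by case: (odd r); rewrite mulgV mulg1.
have [bj bk _ _] := bkl_pow k; have [_ _ bo _] := bkl_pow k.+1.
have gE : uw (a k * (x j)^-1) = uprod (alt i.+1 j.+1 k.+1.*2).
  rewrite gmulfM gmulfV ua uw_gen ugenV; have -> : k.+1.*2 = (k.+1 + k).+1 by lia.
  rewrite alt_rcons -cats1 uprod_cat uprod1.
  by have -> : odd (k.+1 + k) by rewrite addSn /= addnn odd_double.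
case: (braid_hom (b ^+ k.+1)) => h hE; rewrite -hE.
pose f1 : group_hom F uword := @uw n \o h.
pose f2 : group_hom F uword := twist k.+1 (ltn0Sn j) (ltn0Sn i) \o @uw n.
apply: (@free_hom_ext _ _ f1 f2) => l.
rewrite -[LHS]/(uw (h (x l))) hE -[RHS]/(twist k.+1 (ltn0Sn j) (ltn0Sn i) (uw (x l))).
rewrite uw_gen twist_gen /twist_img !inE !eqSS !val_eqE.
have [->|lj] := eqVneq l j; first by rewrite bj -(mulgVK (x j) (a k)) gmulfM gE uw_gen.
have [->|li] := eqVneq l i => /=.
  rewrite -/(a k.+1) ua; have -> : k.+2 + k.+1 = (k.+1.*2).+1 by lia.
  by rewrite alt_rcons odd_double -cats1 uprod_cat uprod1.
have insE : inside j.+1 i.+1 l.+1 = (i < l < j).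
  by rewrite /inside /ccw; move: lj li ij; rewrite -!val_eqE /=; lia.
rewrite insE; have [H|H] := boolP (i < l < j); last first.
  by rewrite bo ?uw_gen //; move: li lj H; rewrite -!val_eqE /=; lia.
rewrite bk //; move: (a k * _) gE => w gE.
have gV : uw w^-1 = (uprod (alt i.+1 j.+1 k.+1.*2))^-1 by rewrite gmulfV gE.
by rewrite !gmulfM gV gE uw_gen.
Qed.

End Pair.
End BKL.

(** * Twisting a word towards another one *)

Section Twisting.
Variable m : nat -> nat -> nat.
Hypothesis m_sym : forall i j, m i j = m j i.
Hypothesis m_ge : forall i j, i != j -> (m i j == 0) || (5 <= m i j).
Local Notation fires := (fires m).
Local Notation tame2 := (tame m (fun k => k.*2 - 2)).

Let ge5 x y : x != y -> m x y != 0%N -> 5 <= m x y.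
Proof. by move=> xy m0; move: (m_ge xy); rewrite (negbTE m0). Qed.

Lemma start_nil (g : uword) pre r : noncrossing g -> rev g = g :> seq nat ->
    tame2 g -> g = pre ++ r :> seq nat -> fires r start = start -> r = [::].
Proof.
move=> nc pal tm e E; apply/eqP/negPn/negP => r0.
have [c [d [L [r' [x [y [a R]]]]]]] := run_exists m_sym m_ge tm e r0.
have := run_signs m_sym m_ge nc pal tm e R x; rewrite /= eqxx /= E /start; lra.
Qed.

(** After flipping the sides longer than m, both are geodesics, and their signs at [x] and [y]
    reveal the first letter. So they start alike and [alt_unique] applies. *)
Lemma alt_complement x y a b p q : x != y -> m x y != 0%N ->
    0 < a < (m x y).*2 -> 0 < b < (m x y).*2 ->
    (0 < p x)%Rr -> (0 < p y)%Rr -> (0 < q x)%Rr -> (0 < q y)%Rr ->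
    fires (alt x y a) p = fires (alt y x b) q ->
  a + b = (m x y).*2 /\ p = q.
Proof.
move=> xy m0 /andP[a0 a2] /andP[b0 b2] px py qx qy E.
have yx : y != x by rewrite eq_sym.
have mE := m_sym x y.
have w k : k <= m x y -> within k (m x y) by move=> km; rewrite /within km orbT.
have w' k : k <= m x y -> within k (m y x) by rewrite -mE; exact: w.
have [am|am] := leqP a (m x y); have [bm|bm] := leqP b (m x y).
- have [s1 _] := fires_alt_signs m_sym m_ge xy px py a0 (w _ am).
  have [s2 s3] := fires_alt_signs m_sym m_ge yx qy qx b0 (w' _ bm).
  have [_ s4] := fires_alt_signs m_sym m_ge xy px py a0 (w _ am).
  have bE : b = m x y.
    by move: s3; rewrite -E -mE; case: eqP => // _; lra.
  have aE : a = m x y.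
    by move: s4; rewrite E; case: eqP => // _; lra.
  rewrite aE bE mE in E; rewrite -(fires_braid m_sym m_ge) -?mE // in E.
  by split; [rewrite aE bE addnn | exact: fires_inj E].
- rewrite (fires_flip m_sym m_ge _ yx) -?mE // in E; last by rewrite ltnW // ltnW.
  have b2' : (m x y).*2 - b <= m x y by lia.
  by have [aE ->] := alt_unique m_sym m_ge xy (w _ am) (w _ b2') px py qx qy E; split=> //; lia.
- rewrite (fires_flip m_sym m_ge _ xy) // in E; last by rewrite ltnW // ltnW.
  have a2' : (m x y).*2 - a <= m x y by lia.
  by have [aE ->] := alt_unique m_sym m_ge yx (w' _ a2') (w' _ bm) py px qy qx E; split=> //; lia.
rewrite (fires_flip m_sym m_ge _ xy) // in E; last by rewrite ltnW // ltnW.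
rewrite (fires_flip m_sym m_ge q yx) -?mE // in E; last by rewrite ltnW // ltnW.
have a3 : 0 < (m x y).*2 - a by lia.
have b3 : 0 < (m x y).*2 - b by lia.
have a4 : (m x y).*2 - a <= m x y by lia.
have b4 : (m x y).*2 - b <= m x y by lia.
have [s1 _] := fires_alt_signs m_sym m_ge yx py px a3 (w' _ a4).
have [_] := fires_alt_signs m_sym m_ge xy qx qy b3 (w _ b4).
by rewrite -E; case: eqP => [|_]; [lia|lra].
Qed.

Lemma pos_in (g : uword) x : x \in (g : seq nat) -> 0 < x.
Proof. by move=> xg; rewrite lt0n; apply: contraTneq xg => ->; exact: uword0. Qed.

Lemma leq_double2 k a : 5 <= k -> a <= k.*2 - 2 -> a < k.*2.
Proof. by lia. Qed.

Lemma tame_double t : tame m S t -> tame2 t.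
Proof. by apply: (tame_leq m_ge) => k; lia. Qed.

Section Inert.
Variables g1 g2 : uword.
Hypotheses (nc1 : noncrossing g1) (pal1 : rev g1 = g1 :> seq nat).
Hypotheses (nc2 : noncrossing g2) (pal2 : rev g2 = g2 :> seq nat).
Hypotheses (tm1 : tame m S g1) (tm2 : tame2 g2).
Variables (v r1 : seq nat) (c1 c2 L : nat) (s : seq nat).
Hypotheses (e1 : g1 = v ++ r1 :> seq nat) (e2 : g2 = v ++ alt c2 c1 L ++ s :> seq nat).
Hypotheses (h1 : head 0 r1 = c1) (c12 : c1 != c2) (m0 : m c1 c2 != 0%N).
Hypotheses (L3 : 3 < L) (hs : head 0 s \notin [:: c1; c2]) (vP : last 0 v \notin [:: c1; c2]).
Hypothesis E : fires r1 start = fires (alt c2 c1 L ++ s) start.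
Hypotheses (l2 : long g2 c1 c2) (lL : long g1 c1 c2 \/ m c1 c2 < L).

(** An essential block of the pair in the common prefix has the same sign in both words. In [g2] it
    agrees by [window] with the block after [v], which starts with [c2]; in [g1] with a block at the
    same place that starts with [c1]. Exchanging the letters reverses the sign, a contradiction. *)
Lemma prefix_inert p c d L' s' : v = p ++ alt c d L' ++ s' -> s' != [::] ->
    pairq c2 c1 c d -> last 0 p \notin [:: c2; c1] -> head 0 s' \notin [:: c2; c1] ->
  ~~ essential c d L' (last 0 p) (head 0 s').
Proof.
move=> ve s'0 q lp hs'; apply/negP => ess.
have c21 : c2 != c1 by rewrite eq_sym.
have tm1' := tame_double tm1.
have inP x : (x \in [:: c2; c1]) = (x \in [:: c1; c2]) by rewrite !inE orbC.
have hE r : head 0 (s' ++ r) = head 0 s' by case: (s') s'0.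
have qP x : (x \in [:: c; d]) = (x \in [:: c2; c1]).
  by move/pairqP: q => [][-> ->] //; rewrite !inE orbC.
have B2 : block g2 v c2 c1 L s by split; rewrite ?inP.
have B1' : block g1 p c d L' (s' ++ r1) by split; rewrite ?qP ?hE // e1 ve !catA.
have B2' : block g2 p c d L' (s' ++ (alt c2 c1 L ++ s)) by split; rewrite ?qP ?hE // e2 ve !catA.
have ess2 : essential c d L' (last 0 p) (head 0 (s' ++ (alt c2 c1 L ++ s))) by rewrite hE.
have ess1 : essential c d L' (last 0 p) (head 0 (s' ++ r1)) by rewrite hE.
have [w1 _ w3] := window nc2 pal2 c21 L3 B2 q B2' ess2.
have m5 := ge5 c12 m0.
(* If only [m c1 c2 < L] is known, the essential block is itself at least four letters long by
   [window], and it lies in [g1] as well. *)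
have l1 : long g1 c1 c2.
  case: lL => // Lm; have e : (g1 : seq nat) = p ++ alt c d L' ++ (s' ++ r1) by case: B1'.
  have cd : c != d by move/pairqP: q => [][-> ->].
  have L'3 : 3 < L' by have := leq_trans (leq_ltn_trans m5 Lm) w1.
  have := long_alt cd L'3 e.
  by move/pairqP: q => [][-> ->] //; rewrite long_sym.
have [c1p c2p] : 0 < c1 /\ 0 < c2 by case: (long_mem l1) => /pos_in ? /pos_in ?.
have rr1 : reduced r1 by have := uvalP g1; rewrite e1 => /reduced_catr.
have hr1 : head 0 r1 != c2 by rewrite h1.
have [L1 [s1 [r1E hs1]]] := alt_run rr1 c1p c2p c12 hr1.
have L10 : 0 < L1.
  case: L1 r1E => // r1E; move: hs1; rewrite -[s1]/(alt c1 c2 0 ++ s1) -r1E h1 !inE eqxx.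
  by [].
have B1 : block g1 v c1 c2 L1 s1 by split; rewrite // e1 r1E.
have L1m : L1 <= (m c1 c2).*2 - 2 := tm1' _ _ _ _ _ B1 c12 m0.
have m0' : m c2 c1 != 0%N by rewrite m_sym.
have Lm : L <= (m c1 c2).*2 - 2 by rewrite m_sym; exact: tm2 B2 c21 m0'.
have es1 : g1 = (v ++ alt c1 c2 L1) ++ s1 :> seq nat by rewrite e1 r1E catA.
have es2 : g2 = (v ++ alt c2 c1 L) ++ s :> seq nat by rewrite e2 catA.
have lk1 : linked g1 c1 c2 by rewrite /linked l1.
have lk2 : linked g2 c1 c2 by rewrite /linked l2.
have o1 z := outside_pos m_sym m_ge nc1 pal1 tm1' (z := z) es1 lk1 hs1.
have o2 z := outside_pos m_sym m_ge nc2 pal2 tm2 (z := z) es2 lk2 hs.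
have E' : fires (alt c1 c2 L1) (fires s1 start) = fires (alt c2 c1 L) (fires s start).
  by rewrite -!fires_cat -r1E.
have [LL ss] : L1 + L = (m c1 c2).*2 /\ fires s1 start = fires s start.
  apply: alt_complement E' => //.
  - by rewrite L10 leq_double2.
  - by rewrite (leq_ltn_trans _ L3) ?leq_double2 // m_sym // -m_sym.
  - by apply: o1; rewrite !inE eqxx.
  - by apply: o1; rewrite !inE eqxx orbT.
  - by apply: o2; rewrite !inE eqxx.
  - by apply: o2; rewrite !inE eqxx orbT.
(* If the remainders part at once, their first letters form a long pair of [g2], hence lie on the
   same side of [c1], [c2]. *)
have side : ccw c1 c2 (head 0 s1) = ccw c1 c2 (head 0 s).
  have [s10|s10] := eqVneq s1 [::].
    by rewrite s10 (start_nil nc2 pal2 tm2 es2) // -ss s10.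
  have [s0|s0] := eqVneq s [::].
    by have := start_nil nc1 pal1 tm1' es1; rewrite ss s0 => /(_ erefl) ->.
  have [->//|hh] := eqVneq (head 0 s1) (head 0 s).
  have [l _ _] := divergence m_sym m_ge nc1 pal1 nc2 pal2 tm1 tm2 es1 es2 s10 s0 erefl erefl hh ss.
  exact: (long_same_side nc2 pal2 l2 l hs1).
have oL : odd L1 = odd L by have := congr1 odd LL; rewrite oddD odd_double; case: (odd L1); case: (odd L).
have essB2 := long_essential nc2 c21 (ltnW L3) B2.
have essB1 : essential c1 c2 L1 (last 0 v) (head 0 s1).
  move: essB2; rewrite /essential /rsign oL (ccwN c12 vP) (ccwN c12 hs) (ccwN c12 hs1) side.
  by case: (odd L); case: (ccw _ _ _); case: (ccw _ _ _).
have [p0 [x [y [L0 [s0 [B0 q0 L03]]]]]] := long_block (uvalP g1) l1.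
have xy : x != y by move/pairqP: q0 => [][-> ->].
have q1 : pairq x y c1 c2 by rewrite pairq_sym.
have q2 : pairq x y c d.
  move/pairqP: q => [][-> ->] //; apply/pairqP; move/pairqP: q0 => [][-> ->]; by [left|right].
have [_ _ sg1] := window nc1 pal1 xy L03 B0 q1 B1 essB1.
have [_ _ sg2] := window nc1 pal1 xy L03 B0 q2 B1' ess1.
by move: w3; rewrite -sg2 sg1 (ccwN c12 vP); case: (ccw _ _ _).
Qed.

End Inert.

Lemma pairq_trans a b c d c' d' : pairq a b c d -> pairq a b c' d' -> pairq c d c' d'.
Proof. by move=> /pairqP[][-> ->] /pairqP[][-> ->]; rewrite /pairq !eqxx ?orbT. Qed.

(** This chooses between a twist and its inverse, so that the blocks with the sign of [a] are
    twisted in the cancelling direction. *)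
Lemma orientation c d a : c != d -> a \notin [:: c; d] -> 0 \notin [:: c; d] ->
  exists c0 d0, pairq c0 d0 c d /\ ccw c0 d0 0 = ccw c d a.
Proof.
move=> cd aP zP; have [e|e] := eqVneq (ccw c d 0) (ccw c d a).
  by exists c, d; rewrite pairq_refl.
exists d, c; split; first by apply/pairqP; right.
by rewrite (ccwN cd zP); move: e; case: (ccw _ _ _); case: (ccw _ _ _).
Qed.

Section ShiftedWords.
Variables c0 d0 M : nat.
Hypotheses (c0_gt0 : 0 < c0) (d0_gt0 : 0 < d0) (cd0 : c0 != d0).
Hypotheses (ME : m c0 d0 = M) (M0 : M != 0%N).
Let bd L := 2 <= L <= M.*2 - 2.

Let M5 : 5 <= M.
Proof. by rewrite -ME ge5 ?ME. Qed.

Let bd_lt L : bd L -> L < M.*2.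
Proof. by case/andP=> _; exact: leq_double2. Qed.

(** A letter flanked twice by the same letter is an essential block of length 1. Unchanged blocks
    are not essential, and twisted ones keep at least two letters. *)
Lemma shift_no_flank (g : uword) w p s i k : shift c0 d0 M bd 0 g w ->
    i \in [:: c0; d0] -> k \notin [:: c0; d0] -> w = p ++ [:: k; i; k] ++ s -> False.
Proof.
move=> sh iP kP E; have zP := zero_notin c0_gt0 d0_gt0.
have [j q] : exists j, pairq c0 d0 i j.
  by move: iP; rewrite !inE => /orP[]/eqP->; [exists d0|exists c0]; rewrite /pairq !eqxx ?orbT.
have E' : w = rcons p k ++ alt i j 1 ++ (k :: s) by rewrite E -cats1 -!catA.
have lk : last 0 (rcons p k) = k by rewrite last_rcons.
have := shift_blocks sh zP E' q; rewrite lk => /(_ kP kP).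
case=> p0 [u [s0 [_ _ _ [c' [d' [L' [q' uE]]]]]]].
case=> [[nes uE']|[es _ _ bL /(congr1 size)]].
  have L1 : L' = 1%N by rewrite -(size_alt c' d' L') -uE -uE'.
  by move: nes; rewrite /essential /rsign L1 /= eqxx.
have Lm : L' <= M.*2 by rewrite ltnW // bd_lt.
by rewrite /new_block Lm !size_alt => /esym; case/andP: bL => _; lia.
Qed.

(** A twisted block has length at most 2M - 2 because it had at least 2. A longer block sharing
    exactly one letter with the pair would contain a flanked letter, and one disjoint from the pair
    already occurs in [g]. *)
Lemma shift_tame (g : uword) w : tame2 g -> shift c0 d0 M bd 0 g w -> reduced w -> tame2 w.
Proof.
move=> tm sh rw p c d K s B cd m0; have m5 := ge5 cd m0.
have zP := zero_notin c0_gt0 d0_gt0.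
have [K3|K3] := leqP K 3; first by lia.
have [E lp hs] := B; rewrite leqNgt; apply/negP => Kbig.
have [cP|cP] := boolP (c \in [:: c0; d0]); have [dP|dP] := boolP (d \in [:: c0; d0]).
- have q : pairq c0 d0 c d.
    by move: cP dP cd; rewrite !inE /pairq => /orP[]/eqP-> /orP[]/eqP->; rewrite !eqxx ?orbT.
  have mE : m c d = M by rewrite -ME; move/pairqP: q => [][-> ->] //.
  rewrite !(notin_pairq _ q) in lp hs.
  have [p0 [u [s0 [gE e1 e2]]]] := shift_blocks sh zP E q lp hs.
  case=> c' [d' [L' [q' uE]]] [[_ uE']|[_ _ _ bL /(congr1 size)]].
    have : block g p0 c d K s0 by split; rewrite ?e1 ?e2 ?(notin_pairq _ q) // uE'.
    by move/tm => /(_ cd m0); rewrite leqNgt Kbig.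
  have Lm : L' <= M.*2 by rewrite ltnW // bd_lt.
  by rewrite /new_block Lm !size_alt; move: Kbig; rewrite mE; case/andP: bL; lia.
- case: K K3 E {B Kbig} => [|[|[|[|K]]]] // _ E.
  by apply: (shift_no_flank (p := p ++ [:: c]) sh cP dP (s := alt c d K ++ s)); rewrite E -!catA.
- case: K K3 E {B Kbig} => [|[|[|[|K]]]] // _ E.
  by apply: (shift_no_flank (p := p) sh dP cP (s := alt d c K.+1 ++ s)); rewrite E.
have nin : ~~ has (mem [:: c0; d0]) (alt c d K).
  apply/hasPn => x /mem_alt; rewrite inE => /orP[]; first by move/eqP->.
  by rewrite inE => /eqP->.
have x0 : alt c d K != [::] by case: (K) K3.
have [p0 [s0 gE]] := shift_free c0_gt0 d0_gt0 cd0 bd_lt sh E x0 nin.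
have cg : 0 < c by apply: (@pos_in g); rewrite gE mem_cat mem_cat; case: (K) K3 => //= ? _; rewrite inE eqxx !orbT.
have dg : 0 < d.
  apply: (@pos_in g); rewrite gE mem_cat mem_cat; case: (K) K3 => [|[|?]] //= _.
  by rewrite !inE eqxx !orbT.
have [p' [c' [d' [L' [s' [B' q' KL]]]]]] := block_ext (uvalP g) cg dg cd (ltnW (ltnW (ltnW K3))) gE.
have cd' : c' != d' by rewrite (pairq_neq cd q').
have mE : m c' d' = m c d by move/pairqP: q' => [][-> ->].
have := tm _ _ _ _ _ B' cd'; rewrite mE => /(_ m0) L'm.
by have := leq_ltn_trans (leq_trans KL L'm) Kbig; rewrite ltnn.
Qed.

End ShiftedWords.

(** By [window] all essential blocks of the pair have the sign of the given one, so a single twist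
    shifts them all. None lies inside [v], so the first change is that the block after [v] now
    starts with its other letter. *)
Lemma shift_word (g : uword) v c1 c2 L s :
    noncrossing g -> rev g = g :> seq nat -> tame2 g ->
    c1 != c2 -> m c1 c2 != 0%N -> block g v c2 c1 L s -> 3 < L ->
    (forall p c d L' s', v = p ++ alt c d L' ++ s' -> s' != [::] ->
       pairq c2 c1 c d -> last 0 p \notin [:: c2; c1] -> head 0 s' \notin [:: c2; c1] ->
       ~~ essential c d L' (last 0 p) (head 0 s')) ->
  exists c0 d0 (c0_gt0 : 0 < c0) (d0_gt0 : 0 < d0), [/\ pairq c0 d0 c2 c1,
    tame2 (twist (m c1 c2) c0_gt0 d0_gt0 g) &
    exists2 r, twist (m c1 c2) c0_gt0 d0_gt0 g = v ++ r :> seq nat & head 0 r = c1].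
Proof.
move=> nc pal tm c12 m0 B L3 inert; have c21 : c2 != c1 by rewrite eq_sym.
have [E lv hs] := B.
have [c1g c2g] : 0 < c1 /\ 0 < c2.
  have := long_alt c21 L3 E => /long_mem[/pos_in ? /pos_in ?] //.
have zP : 0 \notin [:: c2; c1] := zero_notin c2g c1g.
have [c0 [d0 [q o]]] := orientation c21 lv zP.
have [c0g d0g] : 0 < c0 /\ 0 < d0 by move/pairqP: q => [][<- <-].
have cd0 : c0 != d0 by move: c21; move/pairqP: q => [][-> ->]; rewrite // eq_sym.
have inP x : (x \in [:: c2; c1]) = (x \in [:: c0; d0]) by rewrite (notin_pairq _ q).
have mE : m c0 d0 = m c1 c2 by move/pairqP: q => [][-> ->].
set M := m c1 c2 in m0 mE *.
pose bd L := 2 <= L <= M.*2 - 2.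
have M5 : 5 <= M := ge5 c12 m0.
have trans c d : pairq c0 d0 c d -> pairq c2 c1 c d.
  exact: pairq_trans q.
have cond p c d L' s' : block g p c d L' s' -> pairq c0 d0 c d ->
    essential c d L' (last 0 p) (head 0 s') ->
    [/\ ccw c d (last 0 p) = ccw c0 d0 0, 0 < L' & bd L'].
  move=> B' q' ess; have [w1 w2 w3] := window nc pal c21 L3 B (trans _ _ q') B' ess.
  have L2 : 1 < L' by have := leq_trans L3 w1.
  have cd' : c != d by rewrite (pairq_neq cd0 q').
  have mE' : m c d = M by rewrite -mE; move/pairqP: q' => [][-> ->].
  split; [by rewrite -w3 o | exact: ltnW |].
  by rewrite /bd L2 -mE' (tm _ _ _ _ _ B') ?mE'.
have [w sh] : exists w, shift c0 d0 M bd 0 g w.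
  by have [w sh] := shift_exists c0g d0g cd0 M (uvalP g) (erefl : g = [::] ++ g :> seq nat) (zero_notin c0g d0g) cond; exists w; exact: sh.
have bd_lt L' : bd L' -> L' < M.*2 by case/andP=> _; exact: leq_double2.
have [rw _] := shift_reduced c0g d0g cd0 bd_lt sh (uvalP g).
have wE : uprod w = twist M c0g d0g g.
  by rewrite (shift_prod c0g d0g cd0 sh) ?zero_notin // uprod_val /Hs /inside eqxx mul1g.
exists c0, d0, c0g, d0g; rewrite -wE uprod_reduced //.
split=> //; first by apply: shift_tame tm sh rw.
move: sh; rewrite E => sh.
have [|p c d L' s' ve s'0 q' lp hs'||r' -> sh'] := shift_prefix sh.
- by rewrite -inP lv orbT.
- by apply: inert ve s'0 (trans _ _ q') _ _; rewrite inP.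
- exact: zero_notin.
exists r' => //; apply: shift_head sh' erefl _ _ _ _ _ => //.
- exact: leq_trans L3.
- by rewrite -inP.
- exact (long_essential nc c21 (ltnW L3) B).
have m0' : m c2 c1 != 0%N by rewrite m_sym.
by have := leq_double2 (leq_trans (isT : 5 <= 5) _) (tm _ _ _ _ _ B c21 m0'); rewrite m_sym => ->.
Qed.

(** By [window] every essential block has length at least L - 2, hence at least m: none grows, and
    the given one shrinks. *)
Lemma twist_shorter (g : uword) p c d L s :
    noncrossing g -> rev g = g :> seq nat -> c != d -> m c d != 0%N ->
    block g p c d L s -> (m c d).+1 < L ->
  exists c0 d0 (c0_gt0 : 0 < c0) (d0_gt0 : 0 < d0), pairq c0 d0 c d /\
    size (twist (m c d) c0_gt0 d0_gt0 g) < size g.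
Proof.
move=> nc pal cd m0 B mL; have [E lp hs] := B.
have M5 : 5 <= m c d := ge5 cd m0.
have L3 : 3 < L by rewrite ltnW // ltnW // (leq_ltn_trans M5) // ltnW.
have [cg dg] : 0 < c /\ 0 < d.
  by have := long_alt cd L3 E => /long_mem[/pos_in ? /pos_in ?].
have [c0 [d0 [q o]]] := orientation cd lp (zero_notin cg dg).
have [c0g d0g] : 0 < c0 /\ 0 < d0 by move/pairqP: q => [][<- <-].
have cd0 : c0 != d0 by move: cd; move/pairqP: q => [][-> ->]; rewrite // eq_sym.
have inP x : (x \in [:: c; d]) = (x \in [:: c0; d0]) by rewrite (notin_pairq _ q).
set M := m c d in m0 M5 mL *.
pose bd L := M <= L.
have trans x y : pairq c0 d0 x y -> pairq c d x y.
  exact: pairq_trans q.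
have cond p' c' d' L' s' : block g p' c' d' L' s' -> pairq c0 d0 c' d' ->
    essential c' d' L' (last 0 p') (head 0 s') ->
    [/\ ccw c' d' (last 0 p') = ccw c0 d0 0, 0 < L' & bd L'].
  move=> B' q' ess; have [w1 w2 w3] := window nc pal cd L3 B (trans _ _ q') B' ess.
  have ML' : M <= L' by have := leq_trans mL w1; rewrite !ltnS.
  by split; [rewrite -w3 o | rewrite (leq_trans _ ML') // (leq_trans _ M5) | ].
have [w sh] : exists w, shift c0 d0 M bd 0 g w.
  by have [w sh] := shift_exists c0g d0g cd0 M (uvalP g) (erefl : g = [::] ++ g :> seq nat) (zero_notin c0g d0g) cond; exists w; exact: sh.
exists c0, d0, c0g, d0g; split=> //.
have wE : uprod w = twist M c0g d0g g.
  by rewrite (shift_prod c0g d0g cd0 sh) ?zero_notin // uprod_val /Hs /inside eqxx mul1g.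
rewrite -wE; apply: leq_ltn_trans (size_uprod w) _.
apply: (shift_size_lt c0g d0g cd0 sh (fun _ => id) _ _ E q).
- by rewrite lt0n.
- exact: zero_notin.
- by rewrite -inP.
- by rewrite -inP.
- exact (long_essential nc cd (ltnW L3) B).
exact: ltnW.
Qed.

End Twisting.

(** * The subgroup B_hat *)

Section Subgroup.
Variables (n : nat) (Gamma : coxeter_graph n).
Local Notation Bh := (B_hat Gamma).

Lemma B_hat_subgroup : is_subgroup Bh.
Proof.
split=> [H [[H1 _] _] //|b1 b2 h1 h2 H [HG sub]].
by apply: (HG.2); [apply: h1 | apply: h2]; split.
Qed.

Lemma B_hat1 : Bh 1. Proof. exact: B_hat_subgroup.1. Qed.

Lemma B_hatV b : Bh b -> Bh b^-1.
Proof. by move=> bB; rewrite -[_^-1]mul1g; apply: B_hat_subgroup.2 => //; exact: B_hat1. Qed.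

Lemma B_hatM b1 b2 : Bh b1 -> Bh b2 -> Bh (b1 * b2).
Proof. by move=> h1 /B_hatV h2; rewrite -[b2]invgK; exact: B_hat_subgroup.2. Qed.

Lemma B_hat_bkl (i j : 'I_n) (ij : i < j) k : cox_m Gamma i j = Some k -> Bh (bkl ij ^+ k).
Proof. by move=> mk H [_ sub]; apply: sub; exists i, j, ij, k. Qed.

Lemma B_hat_ind (P : braid_group n -> Prop) :
    (forall b, P b -> P b^-1) -> P 1 -> (forall b1 b2, P b1 -> P b2 -> P (b1 * b2)) ->
    (forall (i j : 'I_n) (ij : i < j) k, cox_m Gamma i j = Some k -> P (bkl ij ^+ k)) ->
  forall b, Bh b -> P b.
Proof.
move=> PV P1 PM Pg b; apply; split; first by split=> // b1 b2 h1 h2; apply: PM => //; exact: PV.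
by move=> _ [i [j [ij [k [mk ->]]]]]; exact: Pg.
Qed.

Lemma B_hat_hom (G : groupType) (f : group_hom (free_group 'I_n) G) :
    (forall i j k, i != j -> cox_m Gamma i j = Some k ->
      altprod (f (free_gen i)) (f (free_gen j)) k = altprod (f (free_gen j)) (f (free_gen i)) k) ->
  forall b, Bh b -> forall q, f (b ⋆ q) = f q.
Proof.
move=> rel; apply: B_hat_ind => [b IH q||b1 b2 IH1 IH2 q|i j ij k mk q].
- by rewrite -[in RHS](braid_actKV b q) IH.
- by move=> q; rewrite braid_act1.
- by rewrite braid_actM IH1 IH2.
case: k mk => [|k] mk; first by rewrite expg0 braid_act1.
by apply: bkl_pow_hom; apply: rel mk; rewrite neq_ltn ij.
Qed.

Lemma altprod_hom (G H : groupType) (f : group_hom G H) g h k :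
  f (altprod g h k) = altprod (f g) (f h) k.
Proof. by elim: k g h => [|k IH] g h /=; rewrite ?gmulf1 // gmulfM IH. Qed.

Lemma pi_A_B_hat b : Bh b -> forall q, pi_A Gamma (b ⋆ q) = pi_A Gamma q.
Proof.
apply: B_hat_hom => i j k ij mk; rewrite !free_lift_gen.
have r : artin_rel Gamma (altprod (free_gen i) (free_gen j) k) (altprod (free_gen j) (free_gen i) k).
  exact: ArtinBraid.
by have := quot_class_rel r; rewrite !altprod_hom.
Qed.

Lemma pi_W_B_hat b : Bh b -> forall q, pi_W Gamma (b ⋆ q) = pi_W Gamma q.
Proof.
apply: B_hat_hom => i j k ij mk; rewrite !free_lift_gen.
have r : coxeter_rel Gamma (altprod (free_gen i) (free_gen j) k) (altprod (free_gen j) (free_gen i) k).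
  exact: CoxeterBraid.
by have := quot_class_rel r; rewrite !altprod_hom.
Qed.

End Subgroup.

(** * Labels of letters and the action of the Coxeter group on positions *)

Section Labels.
Variables (n : nat) (Gamma : coxeter_graph n).
Hypothesis m_ge5 : forall i j : 'I_n, i != j -> label_ge (cox_m Gamma i j) 5.

(* The label of letters: 0 stands for infinity, and for letters out of range. *)
Definition label (c d : nat) : nat :=
  if [pick p : 'I_n * 'I_n | (p.1.+1 == c) && (p.2.+1 == d)] is Some p
  then odflt 0%N (cox_m Gamma p.1 p.2) else 0%N.

Lemma label_ord (i j : 'I_n) : label i.+1 j.+1 = odflt 0%N (cox_m Gamma i j).
Proof.
rewrite /label; case: pickP => [[i' j'] /= /andP[]|/(_ (i, j))]; last by rewrite /= !eqxx.
by rewrite !eqSS !val_eqE => /eqP-> /eqP->.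
Qed.

Lemma label_out c d : label c d != 0%N -> exists i j : 'I_n, c = i.+1 /\ d = j.+1.
Proof.
by rewrite /label; case: pickP => [[i j] /= /andP[/eqP<- /eqP<-] _|]; [exists i, j|].
Qed.

Lemma cox_m_sym (i j : 'I_n) : cox_m Gamma i j = cox_m Gamma j i.
Proof. by rewrite /cox_m cox_edge_sym cox_label_sym. Qed.

Lemma label_sym c d : label c d = label d c.
Proof.
have [|n0] := eqVneq (label c d) 0%N; last first.
  by have [i [j [-> ->]]] := label_out n0; rewrite !label_ord cox_m_sym.
have [->//|n0] := eqVneq (label d c) 0%N.
by have [i [j [-> ->]]] := label_out n0; rewrite !label_ord cox_m_sym.
Qed.

Lemma label_ge5 c d : c != d -> (label c d == 0%N) || (5 <= label c d).
Proof.
move=> cd; have [//|n0] := eqVneq (label c d) 0%N.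
have [i [j [ci dj]]] := label_out n0; move: cd n0; rewrite ci dj eqSS val_eqE label_ord.
by move/m_ge5; case: cox_m.
Qed.

Lemma label_some (i j : 'I_n) : label i.+1 j.+1 != 0%N ->
  cox_m Gamma i j = Some (label i.+1 j.+1).
Proof. by rewrite label_ord; case: cox_m. Qed.

Local Notation F := (free_group 'I_n).

(** In one order of the letters the power itself serves; in the other its inverse does, by
    [twistK]. *)
Lemma twist_B_hat c d (c_gt0 : 0 < c) (d_gt0 : 0 < d) : c != d -> label c d != 0%N ->
  exists2 b, B_hat Gamma b & forall q : F, uw (b ⋆ q) = twist (label c d) c_gt0 d_gt0 (uw q).
Proof.
move=> cd m0; have [i [j [ci dj]]] := label_out m0; subst c d.
have [k mE] : exists k, label i.+1 j.+1 = k.+1 by case: (label _ _) m0 => // k; exists k.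
have mk := label_some m0; rewrite mE in mk *.
rewrite (eq_irrelevance c_gt0 (ltn0Sn i)) (eq_irrelevance d_gt0 (ltn0Sn j)).
move: cd; rewrite eqSS neq_ltn => /orP[ij|ji].
  have tw := bkl_pow_uw ij k; exists (bkl ij ^+ k.+1)^-1.
    by apply: B_hatV; exact: B_hat_bkl.
  move=> q; have := tw ((bkl ij ^+ k.+1)^-1 ⋆ q); rewrite braid_actKV => ->.
  by rewrite twistK // eqSS ltn_eqF.
exists (bkl ji ^+ k.+1); first by apply: B_hat_bkl; rewrite cox_m_sym.
by move=> q; exact: bkl_pow_uw.
Qed.

Definition fire_sym c : sym position := Sym (@fireK label c) (@fireK label c).

Lemma fire_symK c : fire_sym c * fire_sym c = 1.
Proof. by apply: sym_ext => p; rewrite symM /= fireK. Qed.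

Lemma altprod_fire c d k p : altprod (fire_sym c) (fire_sym d) k p = fires label (alt c d k) p.
Proof. by elim: k c d => [|k IH] c d //=; rewrite IH. Qed.

Lemma fires_rep : {rho : group_hom (coxeter_group Gamma) (sym position) |
  forall q : F, rho (pi_W Gamma q) =1 fires label (uw q)}.
Proof.
have rel u v : coxeter_rel Gamma u v ->
    free_lift (fun i : 'I_n => fire_sym i.+1) u = free_lift (fun i : 'I_n => fire_sym i.+1) v.
  case=> [i j k ij mk|i]; last by rewrite expgS expg1 gmulfM free_lift_gen fire_symK gmulf1.
  rewrite !altprod_hom !free_lift_gen; apply: sym_ext => p; rewrite !altprod_fire.
  have ne : i.+1 != j.+1 by rewrite eqSS.
  have m0 : label i.+1 j.+1 = k by rewrite label_ord mk.
  have [k0|k0] := eqVneq k 0%N; first by rewrite k0.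
  by rewrite -m0 fires_braid ?m0 //; [exact: label_sym | exact: label_ge5].
exists (pres_lift rel) => q.
pose f c : sym position := if c is c'.+1 then fire_sym c else 1.
have fK c : f c * f c = 1 by case: c => [|c]; rewrite ?mulg1 ?fire_symK.
pose h := ulift fK erefl.
have hE (u : uword) : h u =1 fires label u.
  move=> p; rewrite -{1}(uprod_val u) /uprod; move: (uword0 u).
  elim: (u : seq nat) => [|c s IH]; first by rewrite big_nil gmulf1.
  rewrite inE negb_or eq_sym -lt0n big_cons gmulfM symM ulift_gen => /andP[c0 /IH ->].
  by case: c c0.
move=> p; rewrite -hE.
pose r1 : group_hom F (sym position) := pres_lift rel \o pi_W Gamma.
pose r2 : group_hom F (sym position) := h \o uw (n := n).
suff r12 : r1 q = r2 q by exact: (congr1 (fun s : sym position => s p) r12).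
apply: free_hom_ext => i.
rewrite /r1 /r2 /comp -[LHS]/(pres_lift rel (pi_W Gamma (free_gen i))).
by rewrite -[RHS]/(h (uw (free_gen i))) uw_gen ulift_gen free_lift_gen pres_lift_gen.
Qed.

Lemma pi_W_fires (q1 q2 : F) : pi_W Gamma q1 = pi_W Gamma q2 ->
  fires label (uw q1) start = fires label (uw q2) start.
Proof. by case: fires_rep => rho rhoE e; rewrite -!rhoE e. Qed.

End Labels.

Section Align.
Variables (n : nat) (Gamma : coxeter_graph n).
Hypothesis m_ge5 : forall i j : 'I_n, i != j -> label_ge (cox_m Gamma i j) 5.
Local Notation F := (free_group 'I_n).
Local Notation m := (label Gamma).
Let m_sym := label_sym Gamma.
Let m_ge := label_ge5 m_ge5.

Lemma Q_shorten (q : F) : hurwitz_Q q -> exists2 b, B_hat Gamma b & tame m S (uw (b ⋆ q)).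
Proof.
have [N] := ubnP (size (uw q)); elim: N q => // N IH q; rewrite ltnS => qN qQ.
have [tm|ntm] := pselect (tame m S (uw q)).
  by exists 1; [exact: B_hat1 | rewrite braid_act1].
have [p [c [d [L [s [B cd m0 Lm]]]]]] : exists p c d L s,
    [/\ block (uw q) p c d L s, c != d, m c d != 0%N & (m c d).+1 < L].
  apply: contra_notP ntm => nex p c d L s B cd m0; rewrite leqNgt; apply/negP => Lm.
  by apply: nex; exists p, c, d, L, s.
have [_ nc pal] := uw_Q qQ.
have [c0 [d0 [c0g [d0g [qq lt]]]]] := twist_shorter m_ge nc pal cd m0 B Lm.
have mE : m c0 d0 = m c d by move/pairqP: qq => [][-> ->]; rewrite // m_sym.
have cd0 : c0 != d0 by move: cd; move/pairqP: qq => [][-> ->]; rewrite // eq_sym.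
rewrite -mE in m0 lt.
have [b bB bq] := twist_B_hat c0g d0g cd0 m0.
rewrite -bq in lt.
have [b' b'B tm] := IH (b ⋆ q) (leq_trans lt qN) (hurwitz_Q_act b qQ).
by exists (b' * b); [exact: B_hatM | rewrite braid_actM].
Qed.

(** [q1] stays fixed, and the induction is on the part of its word not yet matched: a divergence is
    repaired by one twist of [q2], which extends the common prefix by a letter. The twisted word is
    only known to satisfy the weaker of the two bounds. *)
Lemma align N : forall (q1 q2 : F) v r1 r2, size r1 < N ->
    hurwitz_Q q1 -> hurwitz_Q q2 -> pi_W Gamma q1 = pi_W Gamma q2 ->
    tame m S (uw q1) -> tame m (fun k => k.*2 - 2) (uw q2) ->
    uw q1 = v ++ r1 :> seq nat -> uw q2 = v ++ r2 :> seq nat ->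
  exists2 b, B_hat Gamma b & uw (b ⋆ q2) = uw q1.
Proof.
elim: N => // N IH q1 q2 v r1 r2; rewrite ltnS => r1N Q1 Q2 W tm1 tm2 e1 e2.
have [_ nc1 pal1] := uw_Q Q1; have [_ nc2 pal2] := uw_Q Q2.
have E : fires m r1 start = fires m r2 start.
  by have := pi_W_fires m_ge5 W; rewrite e1 e2 !fires_cat => /fires_inj.
have tm1' := tame_double m_ge tm1.
have done : r1 = r2 -> exists2 b, B_hat Gamma b & uw (b ⋆ q2) = uw q1.
  move=> rr; exists 1; first exact: B_hat1.
  by apply: uval_inj; rewrite braid_act1 e1 e2 rr.
have [r10|r10] := eqVneq r1 [::].
  by apply: done; rewrite r10 (start_nil m_sym m_ge nc2 pal2 tm2 e2) // -E r10.
have [r20|r20] := eqVneq r2 [::].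
  by apply: done; rewrite r20 (start_nil m_sym m_ge nc1 pal1 tm1' e1) // E r20.
case: r1 r10 => // c1 r1 _ in e1 E r1N done *.
have [h12|h12] := eqVneq c1 (head 0 r2).
  case: r2 r20 => // c2 r2 _ in e2 E done h12 *; rewrite /= in h12; subst c2.
  by apply: (IH q1 q2 (rcons v c1) r1 r2) => //; rewrite cat_rcons.
have [l2 m0 [L [s [r2E hs L3 lL]]]] :=
  divergence m_sym m_ge nc1 pal1 nc2 pal2 tm1 tm2 e1 e2 isT r20 (erefl : head 0 (c1 :: r1) = c1) erefl h12 E.
set c2 := head 0 r2 in h12 l2 m0 r2E hs lL.
rewrite r2E in e2 E.
have c21 : c2 != c1 by rewrite eq_sym.
have lv : last 0 v \notin [:: c1; c2].
  have key (u : uword) c r : u = v ++ c :: r :> seq nat -> last 0 v != c.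
    case/lastP: v {e1 e2 E IH} => [|v y] ue; first by rewrite eq_sym -lt0n (@pos_in u) // ue inE eqxx.
    move: (uvalP u); rewrite ue cat_rcons => /reduced_catr.
    by rewrite reduced_cons last_rcons => /and3P[].
  rewrite !inE negb_or (key _ _ _ e1) (key (uw q2) c2 (alt c1 c2 L.-1 ++ s)) //.
  by rewrite e2; case: (L) L3.
have inert p c d L' s' : v = p ++ alt c d L' ++ s' -> s' != [::] ->
    pairq c2 c1 c d -> last 0 p \notin [:: c2; c1] -> head 0 s' \notin [:: c2; c1] ->
    ~~ essential c d L' (last 0 p) (head 0 s').
  apply: (prefix_inert m_sym m_ge nc1 pal1 nc2 pal2 tm1 tm2 e1 e2 erefl h12 m0 L3 hs lv E l2 lL).
have B2 : block (uw q2) v c2 c1 L s.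
  by split=> //; move: lv hs; rewrite !inE ![_ || (_ == c2)]orbC.
have [c0 [d0 [c0g [d0g [qq tm' [r rE hr]]]]]] := shift_word m_sym m_ge nc2 pal2 tm2 h12 m0 B2 L3 inert.
have mE : m c0 d0 = m c1 c2 by move/pairqP: qq => [][-> ->]; rewrite // m_sym.
have cd0 : c0 != d0 by move: c21; move/pairqP: qq => [][-> ->]; rewrite // eq_sym.
rewrite -mE in m0 tm' rE.
have [b bB bq] := twist_B_hat c0g d0g cd0 m0.
rewrite -bq in tm' rE.
have c1g : 0 < c1 by rewrite (@pos_in (uw q1)) // e1 mem_cat inE eqxx orbT.
have {hr} rE' : r = c1 :: behead r by case: (r) hr c1g => [<-|? ? /= ->].
have [b' b'B Eb] : exists2 b', B_hat Gamma b' & uw (b' ⋆ (b ⋆ q2)) = uw q1.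
  apply: (IH q1 (b ⋆ q2) (rcons v c1) r1 (behead r)) => //.
  - exact: hurwitz_Q_act.
  - by rewrite pi_W_B_hat.
  - by rewrite cat_rcons.
  - by rewrite cat_rcons -rE'.
by exists (b' * b); [exact: B_hatM | rewrite braid_actM].
Qed.

End Align.

(** * The words of Q are determined by their images in the universal group *)

Section UsigGen.
Variables (a : nat) (a0 : 0 < a).

Lemma usig_lo : usig a0 (ugen a) = ugen a * ugen a.+1 * ugen a.
Proof. by rewrite usig_gen /usig_img eqxx. Qed.

Lemma usig_hi : usig a0 (ugen a.+1) = ugen a.
Proof. by rewrite usig_gen /usig_img gtn_eqF // eqxx. Qed.

Lemma usig_far c : (c < a) || (a.+1 < c) -> usig a0 (ugen c) = ugen c.
Proof.
move=> far; have [ca cb] : c != a /\ c != a.+1 by lia.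
by rewrite usig_gen /usig_img (negbTE ca) (negbTE cb).
Qed.

End UsigGen.

(** * Doubling the strands *)

Section Cabling.
Variable n : nat.
Local Notation F := (free_group 'I_n).
Local Notation x := (@free_gen 'I_n).

(** Unlike its image under [uw], the image of a generator here differs from its inverse, so
    exponents remain visible. *)
Definition cable : group_hom F uword :=
  free_lift (fun i : 'I_n => ugen i.*2.+1 * ugen i.*2.+2).

Lemma cable_gen i : cable (x i) = ugen i.*2.+1 * ugen i.*2.+2.
Proof. exact: free_lift_gen. Qed.

(** Two doubled strands cross in four simple crossings. *)
Definition cable_sig (i : nat) (u : uword) : uword :=
  usig (ltn0Sn i.*2.+1) (usig (ltn0Sn i.*2) (usig (ltn0Sn i.*2.+2) (usig (ltn0Sn i.*2.+1) u))).

Lemma cable_sigM i u v : cable_sig i (u * v) = cable_sig i u * cable_sig i v.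
Proof. by rewrite /cable_sig !gmulfM. Qed.

Lemma cable_sig_far i c : (c < i.*2.+1) || (i.*2.+4 < c) -> cable_sig i (ugen c) = ugen c.
Proof. by move=> far; rewrite /cable_sig !usig_far //; lia. Qed.

Lemma cable_sig_lo i : cable_sig i (ugen i.*2.+1 * ugen i.*2.+2) =
  ugen i.*2.+1 * ugen i.*2.+2 * (ugen i.*2.+3 * ugen i.*2.+4) * (ugen i.*2.+1 * ugen i.*2.+2)^-1.
Proof.
have c1 : cable_sig i (ugen i.*2.+1) =
    ugen i.*2.+1 * (ugen i.*2.+2 * ugen i.*2.+3 * ugen i.*2.+2) * ugen i.*2.+1.
  rewrite /cable_sig usig_far ?ltnSn // usig_far; last by lia.
  by rewrite usig_lo !gmulfM usig_lo usig_far // ltnSn.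
have c2 : cable_sig i (ugen i.*2.+2) =
    ugen i.*2.+1 * ugen i.*2.+2 * ugen i.*2.+4 * ugen i.*2.+2 * ugen i.*2.+1.
  rewrite /cable_sig usig_lo !gmulfM usig_lo usig_far ?ltnSn // usig_hi !gmulfM.
  rewrite (usig_far _ (c := i.*2.+3)); last by lia.
  rewrite (usig_far _ (c := i.*2.+4)); last by lia.
  rewrite (usig_far _ (c := i.*2.+1)) ?ltnSn // usig_hi (usig_far _ (c := i.*2.+4)); last by lia.
  by rewrite !mulgA.
rewrite cable_sigM c1 c2 invgM !ugenV !mulgA.
by rewrite -[_ * ugen i.*2.+1 * ugen i.*2.+1]mulgA ugenK mulg1 -[_ * ugen i.*2.+2 * ugen i.*2.+2]mulgA ugenK mulg1.
Qed.

Lemma cable_sig_hi i : cable_sig i (ugen i.*2.+3 * ugen i.*2.+4) = ugen i.*2.+1 * ugen i.*2.+2.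
Proof.
rewrite cable_sigM /cable_sig usig_hi usig_far ?ltnSn // usig_hi.
rewrite (usig_far _ (c := i.*2.+1)) ?ltnSn // (usig_far _ (c := i.*2.+4)); last by lia.
by rewrite usig_hi (usig_far _ (c := i.*2.+3)) ?usig_hi //; lia.
Qed.

Lemma cable_sigma (i : 'I_n.-1) (q : F) : cable (sigma i ⋆ q) = cable_sig i (cable q).
Proof.
rewrite sigma_act.
pose h1 : group_hom F uword := cable \o artin_aut i.
pose h2 : group_hom F uword :=
  usig (ltn0Sn i.*2.+1) \o (usig (ltn0Sn i.*2) \o (usig (ltn0Sn i.*2.+2) \o (usig (ltn0Sn i.*2.+1) \o cable))).
apply: (@free_hom_ext _ _ h1 h2) => j.
rewrite -[LHS]/(cable (artin_aut i (x j))) -[RHS]/(cable_sig i (cable (x j))).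
rewrite [artin_aut i _]free_lift_gen cable_gen.
case: (j =P ord_lo i) => [->|/eqP jl].
  have cV : cable (x (ord_lo i))^-1 = (ugen i.*2.+1 * ugen i.*2.+2)^-1 by rewrite gmulfV cable_gen.
  by rewrite !gmulfM cV !cable_gen /= doubleS cable_sig_lo.
case: (j =P ord_hi i) => [->|/eqP jh]; first by rewrite cable_gen /= doubleS cable_sig_hi.
by rewrite cable_gen cable_sigM !cable_sig_far //;
   move: jl jh; rewrite -!val_eqE /=; lia.
Qed.

Lemma cable_sig_noncrossing i u :
  (cable_sig i u != 1 /\ noncrossing (cable_sig i u)) <-> (u != 1 /\ noncrossing u).
Proof.
have st a (a0 : 0 < a) v : (usig a0 v != 1 /\ noncrossing (usig a0 v)) <-> (v != 1 /\ noncrossing v).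
  by rewrite usig_eq1; split=> -[v1 nc]; have [h1 h2] := noncrossing_usig a0 v1; split; auto.
by rewrite /cable_sig !st.
Qed.

Lemma cable_Q (q : F) : hurwitz_Q q -> cable q != 1 /\ noncrossing (cable q).
Proof.
move=> /hurwitz_QP[b [k ->]]; elim/braid_ind: b => [|i b IH|i b IH].
- rewrite braid_act1 cable_gen; split; last exact: noncrossing_gen2.
  by rewrite uval_eqE uval_cat //= /reduced /= /neqn ltn_eqF.
- by rewrite braid_actM cable_sigma; apply/cable_sig_noncrossing.
by rewrite braid_actM; apply/(cable_sig_noncrossing i); rewrite -cable_sigma braid_actKV.
Qed.

Definition cable_word (w : word 'I_n) : seq nat :=
  flatten [seq if p.2 then [:: p.1.*2.+2; p.1.*2.+1] else [:: p.1.*2.+1; p.1.*2.+2] | p : 'I_n * bool <- w].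

Lemma cable_class w : cable (free_class w) = uprod (cable_word w).
Proof.
rewrite /cable /= free_lift_class /cable_word.
elim: w => [|[i b] w IH]; first by rewrite /word_eval big_nil uprod_nil.
rewrite /word_eval big_cons [X in _ * X]IH /= uprod_cat /letter_eval.
by case: b; rewrite /= !uprod_cons uprod_nil mulg1 // invgM !ugenV.
Qed.

Definition cancel_free (w : word 'I_n) :=
  forall p s (i : 'I_n) b, w <> p ++ (i, b) :: (i, ~~ b) :: s.

Lemma cancel_free_exists (q : F) : exists2 w, free_class w = q & cancel_free w.
Proof.
have [N] := ubnP (size (repr q)); move: (repr q) (free_reprK q) => w.
elim: N w => // N IH w wq; rewrite ltnS => wN.
have [cf|] := pselect (cancel_free w); first by exists w.
move/existsNP=> [p /existsNP[s /existsNP[i /existsNP[b /contrapT we]]]].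
apply: (IH (p ++ s)); last by apply: leq_trans wN; rewrite we !size_cat /= !addnS ltnS leqnSn.
rewrite -wq we; apply: free_eq_class; apply: FreeCat; first exact: FreeRefl.
rewrite -[X in free_eq X _]cat0s -[X in free_eq _ X]/([:: (i, b); (i, ~~ b)] ++ s).
by apply: FreeCat; [apply: FreeSym; exact: FreeCancel | exact: FreeRefl].
Qed.

(** Equal neighbouring letters can only come from a generator next to its own inverse. *)
Lemma cable_word_reduced w : cancel_free w -> reduced (cable_word w).
Proof.
elim: w => [//|[i b] w IH cf]; have {IH} rw : reduced (cable_word w).
  by apply: IH => p s j b' we; apply: (cf ((i, b) :: p) s j b'); rewrite we.
have hd : head 0 (cable_word w) != (if b then i.*2.+1 else i.*2.+2).
  case: w cf {rw} => [|[j b'] w] cf; first by case: (b).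
  apply/negP => /eqP e; apply: (cf [::] w i b) => /=.
  have [-> -> //] : j = i /\ b' = ~~ b.
  by move: e; clear cf; case: b; case: b' => /= e; split=> //; (apply: val_inj => /=; lia) || lia.
rewrite /cable_word /= -/(cable_word w); move: hd; case: b {cf} => /= hd;
  rewrite !reduced_cons rw /= [_ == head _ _]eq_sym hd; lia.
Qed.

Lemma cable_word_cat u v : cable_word (u ++ v) = cable_word u ++ cable_word v.
Proof. by rewrite /cable_word map_cat flatten_cat. Qed.

Lemma cable_word_nseq (i : 'I_n) b k : cable_word (nseq k (i, b)) =
  alt (if b then i.*2.+2 else i.*2.+1) (if b then i.*2.+1 else i.*2.+2) k.*2.
Proof. by elim: k => // k IH; rewrite doubleS /cable_word /= -/(cable_word _) IH; case: (b). Qed.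

(* Two consecutive integers c, c+1 have all other letters on the same side,   *)
(* so that a block of even length on them is never essential.                 *)
Lemma cancel_free_no_square (q : F) w p (i : 'I_n) b s : hurwitz_Q q -> free_class w = q ->
  cancel_free w -> w = p ++ [:: (i, b); (i, b)] ++ s -> False.
Proof.
move=> Qq wq cf we; have rw := cable_word_reduced cf.
have [_ nc] := cable_Q Qq.
have uE : cable q = cable_word w :> seq nat by rewrite -wq cable_class uprod_reduced.
(* A maximal power around the square gives a block: free reducedness excludes the opposite letter as
   a neighbour, maximality the same one. *)
pose P k := `[< exists p s, w = p ++ nseq k (i, b) ++ s >].
have P2 : exists k, P k by exists 2%N; apply/asboolP; exists p, s.
have Pmax k : P k -> k <= size w.
  by move/asboolP=> [p' [s' ->]]; rewrite !size_cat size_nseq addnCA leq_addr.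
have [k /asboolP[p' [s' we']] kmax] := ex_maxnP P2 Pmax.
have k2 : 1 < k by apply: kmax; apply/asboolP; exists p, s.
set c := (if b then i.*2.+2 else i.*2.+1); set d := (if b then i.*2.+1 else i.*2.+2).
have cd : c != d by rewrite /c /d; case: (b); lia.
have uE' : cable q = cable_word p' ++ alt c d k.*2 ++ cable_word s' :> seq nat.
  by rewrite uE we' !cable_word_cat cable_word_nseq.
have hs : head 0 (cable_word s') \notin [:: c; d].
  case: s' we' {uE'} => [|[j b'] s'] we'; first by rewrite /c /d; case: (b).
  have [ji|ji] := eqVneq j i; last first.
    by move: ji; rewrite -val_eqE /c /d; case: (b); case: b' {we'}; rewrite /cable_word /= !inE /=; lia.
  subst j; have [bb|bb] := eqVneq b' b.
    have : k.+1 <= k; last by rewrite ltnn.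
    apply: kmax; apply/asboolP; exists p', s'; rewrite we' bb -addn1 nseqD -!catA //.
  have {}bb : b' = ~~ b by case: (b) (b') bb => [] [].
  case: (k) k2 we' => // k' _; rewrite -addn1 nseqD -catA bb /= => we'.
  by case: (cf (p' ++ nseq k' (i, b)) s' i b); rewrite we' -catA.
have lp : last 0 (cable_word p') \notin [:: c; d].
  case/lastP: p' we' {uE'} => [|p' [j b']] we'; first by rewrite /c /d; case: (b).
  rewrite -cats1 cable_word_cat last_cat.
  have [ji|ji] := eqVneq j i; last first.
    by move: ji; rewrite -val_eqE /c /d; case: (b); case: b' {we'}; rewrite /cable_word /= !inE /=; lia.
  subst j; have [bb|bb] := eqVneq b' b.
    have : k.+1 <= k; last by rewrite ltnn.
    by apply: kmax; apply/asboolP; exists p', s'; rewrite we' bb cat_rcons.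
  have {}bb : b = ~~ b' by case: (b) (b') bb => [] [].
  case: (k) k2 we' => // k' _; rewrite cat_rcons bb /= => we'.
  by case: (cf p' (nseq k' (i, ~~ b') ++ s') i b'); rewrite we'.
have k4 : 2 < k.*2 by lia.
have := long_essential nc cd k4 (And3 uE' lp hs).
rewrite /essential /rsign odd_double.
move: lp hs; rewrite !inE !negb_or /ccw /c /d; case: (b); lia.
Qed.

End Cabling.

Section Injectivity.
Variable n : nat.
Local Notation F := (free_group 'I_n).
Local Notation x := (@free_gen 'I_n).

Lemma uw_act b (q1 q2 : F) : uw q1 = uw q2 -> uw (b ⋆ q1) = uw (b ⋆ q2).
Proof.
move=> e; elim/braid_ind: b => [|i b IH|i b IH]; first by rewrite !braid_act1.
- by rewrite !braid_actM !uw_sigma IH.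
apply/eqP; rewrite -(usig_inj (ltn0Sn i)) -!uw_sigma !braid_actM !braid_actKV.
exact/eqP.
Qed.

(** The Artin action only conjugates and permutes generators, and all of these have the same
    image. *)
Lemma collapse_Q (G : groupType) (g : G) (f : group_hom F G) (q : F) :
  (forall i, f (x i) = g) -> hurwitz_Q q -> f q = g.
Proof.
move=> fx /hurwitz_QP[b [k ->]].
have st (i : 'I_n.-1) (p : F) : f (sigma i ⋆ p) = f p.
  rewrite sigma_act; pose h : group_hom F G := f \o artin_aut i.
  apply: (@free_hom_ext _ _ h f) => j; rewrite -[LHS]/(f (artin_aut i (x j))).
  rewrite [artin_aut i _]free_lift_gen fx.
  have fV : f (x (ord_lo i))^-1 = g^-1 by rewrite gmulfV fx.
  case: eqP => _; first by rewrite !gmulfM fV !fx mulgK.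
  by case: eqP => _; rewrite fx.
elim/braid_ind: b => [|i b IH|i b IH]; first by rewrite braid_act1 fx.
- by rewrite braid_actM st.
by rewrite braid_actM -(st i) braid_actKV.
Qed.

Lemma uw_class (w : word 'I_n) : uw (free_class w) = uprod [seq p.1.+1 | p : 'I_n * bool <- w].
Proof.
rewrite /uw /= free_lift_class; elim: w => [|[i b] w IH]; first by rewrite /word_eval big_nil uprod_nil.
rewrite /word_eval big_cons [X in _ * X]IH /= uprod_cons /letter_eval.
by case: b; rewrite //= ugenV.
Qed.

(** Without squares or cancelling pairs, forgetting the exponents of a freely reduced word leaves a
    reduced one. So that word has a single letter, and only its exponent is left to be found. *)
Lemma uw_eq_gen (q : F) (i : 'I_n) : hurwitz_Q q -> uw q = ugen i.+1 -> q = x i.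
Proof.
move=> Qq uq; have [w wq cf] := cancel_free_exists q.
have rw : reduced [seq p.1.+1 | p : 'I_n * bool <- w].
  have sq p j b s := cancel_free_no_square (p := p) (i := j) (b := b) (s := s) Qq wq cf.
  elim: (w) cf sq {wq} => [//|[j b] w' IH] cf sq.
  rewrite /= reduced_cons /= IH //.
  - case: w' cf sq {IH} => [//|[k b'] w'] cf sq /=; rewrite andbT eqSS.
    apply/negP => /eqP jk; have {}jk : j = k by exact: val_inj.
    subst k; have [e|e] := eqVneq b' b; first by apply: (sq [::] j b w'); rewrite e.
    by apply: (cf [::] w' j b); case: (b) (b') e => [] [].
  - by move=> p s k b' e; apply: (cf ((j, b) :: p) s k b'); rewrite e.
  by move=> p k b' s e; apply: (sq ((j, b) :: p) k b' s); rewrite e.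
have : [seq p.1.+1 | p : 'I_n * bool <- w] = [:: i.+1].
  by rewrite -(uprod_reduced rw) -uw_class wq uq uval_gen.
case: w wq {cf rw} => [|[j b] [|? ?]] //= wq [ji].
have {}ji : j = i by exact: val_inj.
subst j; case: b wq => // wq.
have qV : q = (x i)^-1 by rewrite -wq -[(x i)^-1]/(free_inv _) free_invE.
(* Any element different from its inverse would rule out the exponent -1. *)
pose g : uword := ugen 1 * ugen 2.
have := collapse_Q (free_lift_gen (fun=> g)) Qq.
rewrite qV gmulfV free_lift_gen /g invgM !ugenV => /(congr1 uval).
by rewrite !uval_cat.
Qed.

(** A braid takes [q1] to a generator, which reduces the claim to [uw_eq_gen]. *)
Lemma uw_inj_Q (q1 q2 : F) : hurwitz_Q q1 -> hurwitz_Q q2 -> uw q1 = uw q2 -> q1 = q2.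
Proof.
move=> /hurwitz_QP[b [k ->]] Q2 e.
have := uw_act b^-1 e; rewrite braid_actK uw_gen => /esym /(uw_eq_gen (hurwitz_Q_act _ Q2)) <-.
by rewrite braid_actKV.
Qed.

End Injectivity.

Lemma same_reflection n (Gamma : coxeter_graph n)
    (m_ge5 : forall i j : 'I_n, i != j -> label_ge (cox_m Gamma i j) 5)
    (q1 q2 : free_group 'I_n) :
  hurwitz_Q q1 -> hurwitz_Q q2 -> pi_W Gamma q1 = pi_W Gamma q2 ->
  exists2 b, B_hat Gamma b & q2 = b ⋆ q1.
Proof.
move=> Q1 Q2 W; have [b1 B1 t1] := Q_shorten m_ge5 Q1; have [b2 B2 t2] := Q_shorten m_ge5 Q2.
have W' : pi_W Gamma (b1 ⋆ q1) = pi_W Gamma (b2 ⋆ q2) by rewrite !pi_W_B_hat.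
have Q1' := hurwitz_Q_act b1 Q1; have Q2' := hurwitz_Q_act b2 Q2.
have t2' := tame_double (label_ge5 m_ge5) t2.
have [b B e] := align m_ge5 (v := [::]) (ltnSn _) Q1' Q2' W' t1 t2' erefl erefl.
have E := uw_inj_Q (hurwitz_Q_act b Q2') Q1' e.
(* The alignment gives [b ⋆ (b2 ⋆ q2) = b1 ⋆ q1], which is solved for [q2]. *)
exists ((b * b2)^-1 * b1); first by apply: B_hatM => //; apply: B_hatV; exact: B_hatM.
by rewrite braid_actM -E -[b ⋆ _]braid_actM braid_actK.
Qed.

(** * The dual presentation *)

Section Moves.
Variables (G : groupType) (n : nat).
Local Notation act := (hurwitz_action G n).

Lemma hurwitz_act1 (g : 'I_n -> G) : act 1 g = g.
Proof. by rewrite gmulf1. Qed.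

Lemma hurwitz_actM b1 b2 (g : 'I_n -> G) : act (b1 * b2) g = act b1 (act b2 g).
Proof. by rewrite gmulfM symM. Qed.

Lemma hurwitz_move (p k : 'I_n) : p <= k -> exists b, forall g : 'I_n -> G,
  act b g p = g k /\ forall l : 'I_n, (l < p) || (k < l) -> act b g l = g l.
Proof.
case: k => k kn /=; elim: k kn => [|k IH] kn pk.
  exists 1 => g; rewrite hurwitz_act1; split=> //; congr g; apply: val_inj => /=; lia.
have [pk'|pk'] := eqVneq (p : nat) k.+1.
  by exists 1 => g; rewrite hurwitz_act1; split=> //; congr g; apply: val_inj.
have kn' : k < n by exact: ltnW.
have [|b bE] := IH kn'; first by lia.
have kn1 : k < n.-1 by lia.
exists (b * sigma (Ordinal kn1)) => g; rewrite hurwitz_actM hurwitz_action_sigma.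
have [b1 b2] := bE (hurwitz_step (ord_lo (Ordinal kn1)) (ord_hi (Ordinal kn1)) g).
rewrite b1; split.
  rewrite /hurwitz_step; case: eqP => [_|[]]; last exact: val_inj.
  by congr g; apply: val_inj.
move=> l lpk; rewrite b2; last by lia.
rewrite /hurwitz_step; case: eqP => [e|_]; first by have := congr1 val e => /=; lia.
by case: eqP => [e|//]; have := congr1 val e => /=; lia.
Qed.

(** Moving entry [i] to the front leaves entry [j] in place, since [j] is larger; moving [j] to the
    second place then leaves the front alone. *)
Lemma hurwitz_front (i j k1 k2 : 'I_n) : i < j -> k1 = 0%N :> nat -> k2 = 1%N :> nat ->
  exists b, forall g : 'I_n -> G, act b g k1 = g i /\ act b g k2 = g j.
Proof.
move=> ij k10 k21; have [|b1 h1] := @hurwitz_move k1 i; first by rewrite k10.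
have [|b2 h2] := @hurwitz_move k2 j; first by rewrite k21; apply: leq_ltn_trans ij.
exists (b2 * b1) => g; rewrite hurwitz_actM.
have [a1 a2] := h1 g; have [a3 a4] := h2 (act b1 g).
by rewrite a3 a4 ?a1 ?a2 ?ij ?orbT // k10 k21.
Qed.

Definition dstep (p : G * G) : G * G := (p.2, p.2^-1 * p.1 * p.2).

Lemma dstep2 a b : dstep (dstep (a, b)) = (a ^ (a * b), b ^ (a * b)).
Proof.
have e1 : b^-1 * a * b = a ^ (a * b) by rewrite conjgE invgM !mulgA mulgVK.
by rewrite /dstep /= e1 conjgE !invgM !invgK !mulgA mulgVK e1 !conjgE invgM !mulgA !mulgVK mulgK.
Qed.

Lemma dstep_double k a b :
  iter k.*2 dstep (a, b) = (a ^ ((a * b) ^+ k), b ^ ((a * b) ^+ k)).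
Proof.
elim: k a b => [|k IH] a b; first by rewrite expg0 !conjg1.
rewrite doubleS 2!iterSr dstep2 IH -conjMg.
have -> : (a * b) ^ (a * b) = a * b by rewrite conjgE mulKg.
by rewrite -!conjgM -expgS.
Qed.

Lemma altprod_double k (a b : G) : altprod a b k.*2 = (a * b) ^+ k.
Proof. by elim: k => [|k IH] //=; rewrite IH expgS mulgA. Qed.

Lemma altprod_doubleS k (a b : G) : altprod a b k.*2.+1 = (a * b) ^+ k * a.
Proof.
elim: k => [|k IH]; first by rewrite /= expg0 mul1g mulg1.
by rewrite doubleS -[LHS]/(a * (b * altprod a b k.*2.+1)) IH expgS !mulgA.
Qed.

(** Two steps conjugate both entries by [a * b], and alternating products are powers of [a * b], up
    to one factor. *)
Lemma altprod_dstep k (a b : G) :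
  altprod a b k = altprod b a k <-> (iter k dstep (a, b)).1 = a.
Proof.
rewrite -{1 2 3}(odd_double_half k); case: (odd k); rewrite /= ?add0n ?add1n.
  rewrite -[a * altprod b a _]/(altprod a b k./2.*2.+1) altprod_doubleS altprod_double.
  rewrite dstep_double /= conjgE; move: (_ ^+ _) => D.
  by split=> [<-|e]; [rewrite mulKg | rewrite -e mulVKg].
rewrite altprod_double dstep_double /= -[altprod b a _](mulKg a) -[a * altprod b a _]/(altprod a b k./2.*2.+1).
rewrite altprod_doubleS conjgE; move: (_ ^+ _) => D; split=> e.
  by rewrite {2}e mulVKg mulKg.
have e' : a * D = D * a by rewrite -{2}e mulVKg.
by rewrite -e' mulKg.
Qed.

End Moves.

Arguments dstep : simpl never.

Section Bracket.
Variables (G : groupType) (n : nat) (g : 'I_n -> G).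
Local Notation H := (hurwitz_group g).
Local Notation act := (hurwitz_action G n).

(* The generator [y], with junk value 1 outside of Hur. *)
Definition brk (y : G) : H := if pselect (hur g y) is left h then hurwitz_pt h else 1.

Lemma brk_gen (a : hur g) : brk (val a) = pres_gen (@hurwitz_rel G n g) a.
Proof.
rewrite /brk; case: pselect => [h|[]]; last exact: set_mem (valP a).
by congr pres_gen; apply: val_inj.
Qed.

Lemma brk_pt y (h : hur g y) : brk y = hurwitz_pt h.
Proof. exact: (brk_gen (exist _ y (mem_set h))). Qed.

Lemma orbit_act b r : hurwitz_orbit g r -> hurwitz_orbit g (act b r).
Proof. by case=> b' ->; exists (b * b'); rewrite hurwitz_actM. Qed.

(** The presentation only has relations for the first two entries; a braid brings any two entries
    there, in order. *)
Lemma brk_rel r (i j : 'I_n) : hurwitz_orbit g r -> i < j ->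
  brk ((r j)^-1 * r i * r j) = (brk (r j))^-1 * brk (r i) * brk (r j).
Proof.
move=> or ij; have n0 : 0 < n by apply: leq_ltn_trans (ltn_ord i).
have n1 : 1 < n by apply: leq_ltn_trans (ltn_ord j); apply: leq_ltn_trans ij.
pose k1 := Ordinal n0; pose k2 := Ordinal n1.
have [b /(_ r)[e1 e2]] := @hurwitz_front G n i j k1 k2 ij erefl erefl.
have or' := orbit_act b or; have [hi hj hc] := hurwitz_rel_mem or' (erefl : k1 = 0%N :> nat) (erefl : k2 = 1%N :> nat).
rewrite e1 e2 in hi hj hc.
pose a' : hur g := exist _ (r i) (mem_set hi); pose b' : hur g := exist _ (r j) (mem_set hj).
pose c' : hur g := exist _ ((r j)^-1 * r i * r j) (mem_set hc).
have rel : hurwitz_rel (g := g) ((free_gen b')^-1 * free_gen a' * free_gen b') (free_gen c').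
  by apply: (HurwitzRel or' (erefl : k1 = 0%N :> nat) (erefl : k2 = 1%N :> nat)); rewrite ?e1 ?e2.
rewrite (brk_gen a') (brk_gen b') (brk_gen c') /pres_gen -(quot_class_rel rel) !gmulfM.
by rewrite gmulfV.
Qed.

(** The relations make the bracket of a Hurwitz move the Hurwitz move of the brackets, although
    [brk] itself is not a morphism. *)
Lemma brk_act b : brk \o act b g = hurwitz_action H n b (brk \o g).
Proof.
have st (i : 'I_n.-1) r : hurwitz_orbit g r ->
    brk \o act (sigma i) r = hurwitz_action H n (sigma i) (brk \o r).
  move=> or; apply: funext => k /=; rewrite !hurwitz_action_sigma /hurwitz_step.
  case: eqP => // _; case: eqP => // _; exact (brk_rel or (ltnSn i : ord_lo i < ord_hi i)).
have orb b' : hurwitz_orbit g (act b' g) by exists b'.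
elim/braid_ind: b => [|i b IH|i b IH]; first by rewrite !hurwitz_act1.
  by rewrite !hurwitz_actM st // IH.
apply: (can_inj (hurwitz_stepK i)).
rewrite -!hurwitz_action_sigma -st // -!hurwitz_actM !mulVKg //.
Qed.

Lemma brk_iter r (k1 k2 : 'I_n) k : hurwitz_orbit g r -> k1 = 0%N :> nat -> k2 = 1%N :> nat ->
  let d := iter k (@dstep G) (r k1, r k2) in
  iter k (@dstep H) (brk (r k1), brk (r k2)) = (brk d.1, brk d.2).
Proof.
move=> or k10 k21; elim: k r or => // k IH r or d; rewrite /d !iterSr.
have n1 : 0 < n.-1 by have := ltn_ord k2; rewrite k21; case: (n) => [|[]].
pose i := Ordinal n1; pose r' := act (sigma i) r.
have lo : k1 = ord_lo i by exact: val_inj.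
have hi : k2 = ord_hi i by exact: val_inj.
have e1 : r' k1 = r k2 by rewrite /r' hurwitz_action_sigma /hurwitz_step -lo eqxx -hi.
have e2 : r' k2 = (r k2)^-1 * r k1 * r k2.
  by rewrite /r' hurwitz_action_sigma /hurwitz_step -hi -lo eqxx -val_eqE /= k10 k21.
have -> : dstep (r k1, r k2) = (r' k1, r' k2) by rewrite e1 e2.
by rewrite -(IH r' (orbit_act _ or)) e1 e2 [in LHS]/dstep /= brk_rel // k10 k21.
Qed.

End Bracket.

Lemma hurwitz_hom (G H : groupType) n (f : group_hom G H) b (g : 'I_n -> G) :
  f \o hurwitz_action G n b g = hurwitz_action H n b (f \o g).
Proof.
have st (i : 'I_n.-1) r : f \o hurwitz_action G n (sigma i) r =
    hurwitz_action H n (sigma i) (f \o r).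
  apply: funext => k /=; rewrite !hurwitz_action_sigma /hurwitz_step.
  by case: eqP => // _; case: eqP => // _; rewrite !gmulfM gmulfV.
elim/braid_ind: b => [|i b IH|i b IH]; first by rewrite !hurwitz_act1.
  by rewrite !hurwitz_actM st IH.
apply: (can_inj (hurwitz_stepK i)).
by rewrite -!hurwitz_action_sigma -st -!hurwitz_actM !mulVKg.
Qed.

Section CanonicalIso.
Variables (n : nat) (Gamma : coxeter_graph n).
Local Notation F := (free_group 'I_n).
Local Notation x := (@free_gen 'I_n).
Local Notation s := (coxeter_s Gamma).
Local Notation dual := (dual_artin_group Gamma).
Local Notation br := (brk s).

Lemma dual_artin_sE i : dual_artin_s Gamma i = br (s i).
Proof. by rewrite (brk_pt (hur_id s i)). Qed.

Lemma coxeter_braid (i j : 'I_n) k : i != j -> cox_m Gamma i j = Some k ->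
  altprod (s i) (s j) k = altprod (s j) (s i) k.
Proof.
move=> ij mk; have := quot_class_rel (CoxeterBraid ij mk); rewrite !altprod_hom.
by [].
Qed.

(** The braid relation in W makes the iterated move on the two reflections return to the first of
    them. The brackets follow the same moves ([brk_iter]), so they satisfy the relation in the dual
    group. *)
Lemma dual_artin_braid (i j : 'I_n) k : i < j -> cox_m Gamma i j = Some k ->
  altprod (br (s i)) (br (s j)) k = altprod (br (s j)) (br (s i)) k.
Proof.
move=> ij mk; have ne : i != j by rewrite neq_ltn ij.
have n0 : 0 < n by apply: leq_ltn_trans (ltn_ord i).
have n1 : 1 < n by apply: leq_ltn_trans (ltn_ord j); apply: leq_ltn_trans ij.
pose k1 := Ordinal n0; pose k2 := Ordinal n1.
have [b /(_ s)[e1 e2]] := @hurwitz_front (coxeter_group Gamma) n i j k1 k2 ij erefl erefl.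
have or : hurwitz_orbit s (hurwitz_action _ n b s) by exists b.
apply/altprod_dstep.
have := brk_iter k or (erefl : k1 = 0%N :> nat) (erefl : k2 = 1%N :> nat).
rewrite /= e1 e2 => -> /=; congr brk.
by apply/altprod_dstep; exact: coxeter_braid.
Qed.

Lemma dual_artin_rel u v : artin_rel Gamma u v ->
  free_lift (dual_artin_s Gamma) u = free_lift (dual_artin_s Gamma) v.
Proof.
case=> i j k; rewrite neq_ltn !altprod_hom !free_lift_gen !dual_artin_sE.
by case/orP=> [ij|ji] mk; last apply/esym; apply: dual_artin_braid => //; rewrite cox_m_sym.
Qed.

Definition canonical_map : group_hom (artin_group Gamma) dual := pres_lift dual_artin_rel.

Lemma canonical_map_t i : canonical_map (artin_t Gamma i) = br (s i).
Proof. by rewrite -dual_artin_sE; exact: pres_lift_gen. Qed.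

Lemma pi_W_tuple b : pi_W Gamma \o hurwitz_action F n b x = hurwitz_action _ n b s.
Proof. by rewrite hurwitz_hom; congr (hurwitz_action _ n b _); apply: funext => i; exact: free_lift_gen. Qed.

Lemma canonical_map_tuple b :
  (canonical_map \o pi_A Gamma) \o hurwitz_action F n b x = br \o hurwitz_action _ n b s.
Proof.
rewrite brk_act; pose f : group_hom F dual := canonical_map \o pi_A Gamma.
rewrite -[LHS]/(f \o hurwitz_action F n b x) hurwitz_hom.
congr (hurwitz_action _ n b _); apply: funext => i; rewrite /f /=.
by rewrite -canonical_map_t /pi_A free_lift_gen.
Qed.

Lemma hur_lift r : hur s r -> exists2 q, hurwitz_Q q & pi_W Gamma q = r.
Proof.
case=> _ [b ->] [k ->]; exists (hurwitz_action F n b x k); last by rewrite -pi_W_tuple.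
by exists (hurwitz_action F n b x); [exists b | exists k].
Qed.

Hypothesis same_A : forall q1 q2 : F, hurwitz_Q q1 -> hurwitz_Q q2 ->
  pi_W Gamma q1 = pi_W Gamma q2 -> pi_A Gamma q1 = pi_A Gamma q2.

(** The chosen element of Q above the reflection is immaterial, by [same_A]. *)
Definition lift_A (a : hur s) : artin_group Gamma :=
  pi_A Gamma (sval (cid2 (hur_lift (set_mem (valP a))))).

Lemma lift_AE (a : hur s) q : hurwitz_Q q -> pi_W Gamma q = val a -> lift_A a = pi_A Gamma q.
Proof.
rewrite /lift_A; case: cid2 => q' Q' e Q w.
exact: same_A Q' Q (etrans e (esym w)).
Qed.

(** The tuple of reflections lifts to a Hurwitz tuple in the free group, whose three relevant
    elements lie in Q and satisfy the relation there. *)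
Lemma lift_A_rel u v : hurwitz_rel (g := s) u v -> free_lift lift_A u = free_lift lift_A v.
Proof.
case=> r k1 k2 a b c [b' rE] k10 k21 aE bE cE; rewrite !gmulfM gmulfV !free_lift_gen.
pose q := hurwitz_action F n b' x.
have orq : hurwitz_orbit x q by exists b'.
have [Q1 Q2 Q3] := hurwitz_rel_mem orq k10 k21.
have qr k : pi_W Gamma (q k) = r k by rewrite rE -pi_W_tuple.
rewrite (lift_AE (a := a) Q1) ?aE // (lift_AE (a := b) Q2) ?bE // (lift_AE (a := c) Q3).
  by rewrite !gmulfM gmulfV.
by rewrite cE !gmulfM gmulfV !qr.
Qed.

Lemma canonical_map_bij : bijective canonical_map.
Proof.
pose psi : group_hom dual (artin_group Gamma) := pres_lift lift_A_rel.
have psi_gen a : psi (pres_gen _ a) = lift_A a by exact: pres_lift_gen.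
exists psi.
  pose h : group_hom (artin_group Gamma) (artin_group Gamma) := psi \o canonical_map.
  pose id' : group_hom (artin_group Gamma) (artin_group Gamma) := idfun.
  apply: (@pres_hom_ext _ _ _ h id') => i.
  rewrite -[LHS]/(psi (canonical_map (artin_t Gamma i))) canonical_map_t.
  pose a : hur s := exist _ (s i) (mem_set (hur_id s i)).
  have gW : pi_W Gamma (x i) = s i by exact: free_lift_gen.
  rewrite (brk_gen a) psi_gen (lift_AE (a := a) (hur_id _ i) gW).
  exact: free_lift_gen.
pose h : group_hom dual dual := canonical_map \o psi.
pose id' : group_hom dual dual := idfun.
apply: (@pres_hom_ext _ _ _ h id') => a.
rewrite -[LHS]/(canonical_map (psi (pres_gen _ a))) psi_gen -[RHS]brk_gen.
have [_ [b ->] [k aE]] := set_mem (valP a).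
have Q : hurwitz_Q (hurwitz_action F n b x k).
  by exists (hurwitz_action F n b x); [exists b | exists k].
rewrite (lift_AE Q); last by rewrite aE -pi_W_tuple.
by have := congr1 (fun f => f k) (canonical_map_tuple b); rewrite /= -aE.
Qed.

End CanonicalIso.

Theorem theorem5p14 (n : nat) (Gamma : coxeter_graph n)
    (m_ge5 : forall i j : 'I_n, i != j -> label_ge (cox_m Gamma i j) 5) :
  [/\ forall q1 q2 : free_group 'I_n,
        hurwitz_Q q1 -> hurwitz_Q q2 -> pi_W Gamma q1 = pi_W Gamma q2 ->
        exists2 b : braid_group n, B_hat Gamma b & q2 = b ⋆ q1,
      forall q1 q2 : free_group 'I_n,
        hurwitz_Q q1 -> hurwitz_Q q2 -> pi_W Gamma q1 = pi_W Gamma q2 ->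
        pi_A Gamma q1 = pi_A Gamma q2
    & canonically_isomorphic Gamma].
Proof.
have part1 := same_reflection m_ge5.
have part2 (q1 q2 : free_group 'I_n) : hurwitz_Q q1 -> hurwitz_Q q2 ->
    pi_W Gamma q1 = pi_W Gamma q2 -> pi_A Gamma q1 = pi_A Gamma q2.
  by move=> Q1 Q2 /(part1 _ _ Q1 Q2)[b B ->]; rewrite pi_A_B_hat.
split=> //; exists (canonical_map Gamma); split; last exact: canonical_map_bij.
by move=> i; rewrite canonical_map_t -dual_artin_sE.
Qed.
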